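(* Assume $\mathbb{E}\eta<\infty$, and let $\tilde S(t)$, $t\ge 0$, be the linear interpolation of $(\tilde S(n))_{n\ge 0}$. Then, as $n\to\infty$, the sequence of processes $$\Big(\frac{\tilde S(nt)}{\sqrt n},\ t\in[0,1]\Big)_{n\ge 1}$$ converges weakly in $C[0,1]$ to the reflected Brownian motion $$W_{\mathrm{reflected}}(t):=W(t)-\min_{0\le s\le t}W(s),\qquad t\in[0,1],$$ where $W=\sigma B$ with $B$ a standard Brownian motion started at $0$.
   Context: Let $\{\xi_n\}_{n\ge1}$ be i.i.d. real random variables with generic copy $\xi$, $\mathbb{E}\xi=0$, $\mathbb{E}\xi^2=\sigma^2<\infty$. Let $\{\eta_n\}_{n\ge1}$ be (strictly) positive i.i.d. random variables with generic copy $\eta$, independent of $\{\xi_n\}_{n\ge1}$. The random walk $\tilde S$ is defined by $\tilde S(0)=0$ and, for integers $n\ge 0$, $$\tilde S(n+1)=\begin{cases}\tilde S(n)+\xi_{n+1}, & \tilde S(n)>0,\\ \tilde S(n)+\eta_{n+1}, & \tilde S(n)\le 0.\end{cases}$$ Linear interpolation means: for real $t\ge 0$, $\tilde S(t)=\tilde S(\lfloor t\rfloor)+(t-\lfloor t\rfloor)\big(\tilde S(\lceil t\rceil)-\tilde S(\lfloor t\rfloor)\big)$. $C[0,1]$ carries the uniform topology. *)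

(* Defs.v *)
From HB Require Import structures.
From mathcomp Require Import all_boot all_order all_algebra.
From mathcomp Require Import all_classical all_reals all_analysis.
From mathcomp Require Import ring lra.

Set Implicit Arguments.
Unset Strict Implicit.
Unset Printing Implicit Defensive.

Import Order.TTheory GRing.Theory Num.Theory.
Import numFieldNormedType.Exports.

Local Open Scope classical_set_scope.
Local Open Scope ring_scope.

Section PathSpace.
Variable R : realType.

Definition unitI : set R := `[0, 1].

Definition C01 := continuousType unitI R.

(* The uniform topology: induced by the inclusion into all functions from
   [0, 1] to R with the uniformity of uniform convergence. *)
HB.instance Definition _ := Uniform.copy C01
  (initial_topology (id : continuousType unitI R -> {uniform unitI -> R})).

Lemma nbhs_C01P (f : C01) (A : set C01) :
  nbhs f A <->
  exists2 e : R, 0 < e & [set g : C01 | forall t, `|f t - g t| < e] `<=` A.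
Proof.
split.
  move=> [U [[V oV <-]] Vf UA].
  have : nbhs (f : {uniform unitI -> R}) V by exact: open_nbhs_nbhs.
  move=> /uniform_nbhs [E [entE EV]].
  move: entE; rewrite -entourage_ballE => -[e /= e0 eE].
  exists e => // g fg; apply: UA => /=; apply: EV => /= t _; apply: eE; exact: fg.
move=> [e e0 eA].
pose V : set {uniform unitI -> R} := [set g | forall t, `|f t - g t| < e].
have hn : nbhs (f : {uniform unitI -> R}) V.
  apply/uniform_nbhs; exists [set xy | ball xy.1 e xy.2]; split.
    by rewrite -entourage_ballE; exists e.
  by move=> g /= hg t; exact: hg.
exists ((id : C01 -> {uniform unitI -> R}) @^-1` V°); split.
- by exists V° => //; exact: open_interior.
- exact: hn.
- by move=> g /interior_subset; exact: eA.
Qed.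

Lemma sig_continuous (f : R -> R) :
  {within unitI, continuous f} -> continuous (f \o set_val : unitI -> R).
Proof. by move=> /subspace_sigL_continuousP. Qed.

Definition path01 (f : R -> R) (cf : {within unitI, continuous f}) : C01 :=
  mkcts (sig_continuous cf).

End PathSpace.
Arguments unitI : clear implicits.
Arguments C01 : clear implicits.

Section WeakConvergence.
Context {R : realType}.

Definition borel_measurable d (T : measurableType d) (E : topologicalType)
  (X : T -> E) := forall A : set E, <<s open >> A -> measurable (X @^-1` A).

Definition converges_weakly d (T : measurableType d) (P : probability T R)
    d' (T' : measurableType d') (Q : probability T' R) (E : topologicalType)
    (X : nat -> T -> E) (Y : T' -> E) :=
  [/\ forall n, borel_measurable (X n),
      borel_measurable Y &
      forall F : E -> R, continuous F -> bounded_fun F ->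
        ('E_P[F \o X n])%E @[n --> \oo] --> ('E_Q[F \o Y])%E].

End WeakConvergence.

Section Independence.
Context {R : realType} d (T : measurableType d) (P : probability T R).

Definition mutually_independent (I : choiceType) (X : I -> T -> R) :=
  forall (s : seq I) (A : I -> set R), uniq s -> (forall i, measurable (A i)) ->
    P (\bigcap_(i in [set` s]) (X i @^-1` A i)) =
    (\prod_(i <- s) P (X i @^-1` A i))%E.

Definition identically_distributed (I : choiceType) (X : I -> T -> R) :=
  forall i j (A : set R), measurable A -> P (X i @^-1` A) = P (X j @^-1` A).

Definition iid (I : choiceType) (X : I -> T -> R) :=
  mutually_independent X /\ identically_distributed X.

Definition sigma_of (I : choiceType) (X : I -> T -> R) : set (set T) :=
  <<s \bigcup_i preimage_set_system [set: T] (X i) measurable >>.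

Definition independent_families (I J : choiceType)
    (X : I -> T -> R) (Y : J -> T -> R) :=
  forall A B, sigma_of X A -> sigma_of Y B -> P (A `&` B) = (P A * P B)%E.

End Independence.

Section BrownianMotion.
Context {R : realType} d (T : measurableType d) (Q : probability T R).

(* The process is indexed by R but only nonnegative times are constrained. *)
Record standard_brownian_motion (B : R -> {RV Q >-> R}) : Prop := {
  bm_start : {ae Q, forall w, B 0 w = 0} ;
  bm_indep_increments : forall t : nat -> R, 0 <= t 0%N ->
    {homo t : i j / (i <= j)%N >-> i <= j} ->
    mutually_independent Q (fun (i : nat) w => B (t i.+1) w - B (t i) w) ;
  bm_gaussian_increments : forall s t, 0 <= s -> s < t ->
    forall A : set R, measurable A ->
      Q [set w | A (B t w - B s w)] = normal_prob 0 (Num.sqrt (t - s)) A ;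
  bm_continuous_paths : forall w,
    {within `[0, +oo[, continuous (fun t => B t w)} }.

End BrownianMotion.

Section Reflection.
Context {R : realType}.

(* For continuous f the infimum is attained, so it is the minimum over [0, t]. *)
Definition reflect (f : R -> R) (t : R) : R :=
  f t - inf [set f s | s in `[0, t]].

Lemma reflect_continuous (f : R -> R) :
  {within unitI R, continuous f} -> {within unitI R, continuous (reflect f)}.
Proof.
move=> cf; have cfI := cf.
pose m t := inf [set f s | s in `[0, t]].
have [lb lbP] : exists lb, forall s, unitI R s -> lb <= f s.
  have [c _ cP] := @EVT_min _ f 0 1 ler01 cf.
  by exists (f c).
have sub t s : unitI R t -> s \in `[0, t] -> unitI R s.
  rewrite /unitI /= !in_itv /= => /andP[_ t1] /andP[s0 st].
  by rewrite s0 (le_trans st).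
have hi t : unitI R t -> has_inf [set f s | s in `[0, t]].
  move=> It; split.
    exists (f 0), 0 => //=; rewrite in_itv /= lexx.
    by move: It; rewrite /unitI /= in_itv /= => /andP[].
  by exists lb => _ [s /= st <-]; apply: lbP; exact: sub st.
have mle t s : unitI R t -> s \in `[0, t] -> m t <= f s.
  move=> It st; apply: ge_inf; last by exists s.
  by have [] := hi t It.
have lem t c : unitI R t -> (forall s, s \in `[0, t] -> c <= f s) -> c <= m t.
  move=> It h; apply: lb_le_inf; first by have [] := hi t It.
  by move=> _ [s /= st <-]; exact: h.
have tt t : unitI R t -> t \in `[0, t].
  by rewrite /unitI /= !in_itv /= => /andP[-> _] /=.
have mono u v : unitI R v -> u \in `[0, v] -> m v <= m u.
  move=> Iv uv; apply: lem; first exact: sub uv.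
  move=> s su; apply: mle => //; move: uv su; rewrite !in_itv /=.
  by move=> /andP[_ uv] /andP[-> su] /=; rewrite (le_trans su).
move/subspace_continuousP: cf => cf.
apply/subspace_continuousP => x Ix.
apply: cvgB; first exact: cf.
rewrite -/(m x); change (m @ within (unitI R) (nbhs x) --> m x).
apply/cvgrPdist_le => e e0.
have /cvgrPdist_lt /(_ (e / 2)) := cf x Ix.
rewrite divr_gt0 // => /(_ isT) /nbhs_ballP [r /= r0 hr].
have H s : `|x - s| < r -> unitI R s -> `|f x - f s| < e / 2.
  by move=> xs Is; exact: hr.
have osc u v : unitI R u -> unitI R v -> u <= v ->
    (forall s, u <= s <= v -> `|x - s| < r) -> `|m u - m v| <= e.
  move=> Iu Iv uv hs.
  have mvu : m v <= m u.
    apply: mono => //; move: Iu; rewrite /unitI /= !in_itv /= => /andP[-> _].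
    by rewrite uv.
  rewrite ger0_norm ?subr_ge0 // lerBlDr -lerBlDl.
  apply: lem => // s sv.
  have [su|us] := leP s u.
    have : m u <= f s.
      by apply: mle => //; move: sv; rewrite !in_itv /= => /andP[-> _].
    by lra.
  have Is := sub _ _ Iv sv.
  have sv' : s <= v by move: sv; rewrite in_itv /= => /andP[].
  have h1 := H s (hs s _) Is; have h2 := H u (hs u _) Iu.
  rewrite (ltW us) sv' in h1; rewrite lexx uv in h2.
  move: (h1 isT) (h2 isT) (mle u u Iu (tt _ Iu)); rewrite !ltr_norml.
  by move=> /andP[a b] /andP[c d'] k; lra.
apply/nbhs_ballP; exists r => //= y /= xy Iy.
rewrite /ball /= in xy; move: xy; rewrite ltr_norml => /andP[xy1 xy2].
have [xy|yx] := leP x y.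
  by apply: osc => // s /andP[a b]; rewrite ltr_norml; apply/andP; split; lra.
rewrite distrC; apply: osc => //; first exact: ltW.
by move=> s /andP[a b]; rewrite ltr_norml; apply/andP; split; lra.
Qed.

End Reflection.

Section ReflectedBrownianMotion.
Context {R : realType} d (T : measurableType d) (Q : probability T R).
Context (sigma : R) (B : R -> {RV Q >-> R}) (hB : standard_brownian_motion B).

Lemma scaled_bm_continuous w :
  {within unitI R, continuous (fun t => sigma * B t w)}.
Proof.
have /(@continuous_subspaceW _ _ (unitI R)) cB := bm_continuous_paths hB (w := w).
have {}cB : {within unitI R, continuous (fun t => B t w)}.
  by apply: cB => x; rewrite /unitI /= !in_itv /= => /andP[->].
by move=> x; apply: cvgM; [exact: cvg_cst | exact: cB].
Qed.

Definition reflected_brownian_motion (w : T) : C01 R :=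
  path01 (reflect_continuous (@scaled_bm_continuous w)).

End ReflectedBrownianMotion.

Section Walk.
Context {R : realType}.

(* [x m] and [y m] stand for the (m+1)-st terms of sequences indexed from 1. *)
Fixpoint walk (x y : nat -> R) (n : nat) : R :=
  if n is m.+1 then
    let s := walk x y m in if 0 < s then s + x m else s + y m
  else 0.

(* Meaningful for 0 <= t. *)
Definition interpolate (s : nat -> R) (t : R) : R :=
  let lo := s (Num.truncn t) in
  let hi := s `|Num.ceil t|%N in
  lo + (t - (Num.truncn t)%:R) * (hi - lo).

Lemma interpolateE (s : nat -> R) (N : nat) (t : R) : 0 <= t -> t <= N%:R ->
  interpolate s t = s 0%N +
    \sum_(0 <= k < N) (s k.+1 - s k) * Num.min 1 (Num.max 0 (t - k%:R)).
Proof.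
move=> t0; elim: N => [|N IH] tN.
  have -> : t = 0 by apply/eqP; rewrite eq_le t0 andbT.
  by rewrite big_nil /interpolate truncn0 ceil0 /= !subrr mul0r.
rewrite big_nat_recr //=.
have [tN'|Nt] := leP t N%:R.
  rewrite IH // (max_idPl _) ?subr_le0 // (min_idPr _) ?ler01 //.
  by rewrite mulr0 addr0.
have -> : \sum_(0 <= k < N) (s k.+1 - s k) * Num.min 1 (Num.max 0 (t - k%:R)) =
          s N - s 0%N.
  rewrite -telescope_sumr //; apply: eq_big_nat => k /andP[_ kN].
  have : k.+1%:R <= N%:R :> R by rewrite ler_nat.
  rewrite -natr1 => kN'.
  by rewrite (max_idPr _) ?(min_idPl _) ?mulr1 //; lra.
rewrite (max_idPr _); last by lra.
rewrite (min_idPr _); last by move: tN; rewrite -natr1; lra.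
move: tN; rewrite le_eqVlt => /predU1P[->|tN].
  have cN : Num.ceil (N.+1%:R : R) = N.+1%:Z by rewrite pmulrn intrKceil.
  by rewrite /interpolate natrK cN /= -natr1; ring.
have -> : interpolate s t = s N + (t - N%:R) * (s N.+1 - s N).
  rewrite /interpolate (@truncn_def _ t N) ?(ltW Nt) //.
  have -> // : Num.ceil t = N.+1%:Z.
  apply: ceil_def; rewrite -pmulrn (ltW tN) andbT intrD /=.
  by rewrite -pmulrn -natr1 addrK.
ring.
Qed.

Lemma rescaled_continuous (s : nat -> R) (n : nat) :
  {within unitI R,
    continuous (fun t => interpolate s (n%:R * t) / Num.sqrt n%:R)}.
Proof.
pose g (t : R) := (s 0%N + \sum_(0 <= k < n) (s k.+1 - s k) *
  Num.min 1 (Num.max 0 (n%:R * t - k%:R))) / Num.sqrt n%:R.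
have cl k : continuous (fun t : R => n%:R * t - k%:R : R).
  by move=> t; apply: cvgB; [apply: cvgM; [exact: cvg_cst|exact: cvg_id]|
                             exact: cvg_cst].
have cm k : continuous (fun t : R => Num.min 1 (Num.max 0 (n%:R * t - k%:R))).
  move=> t; have c1 : {for t, continuous (fun=> 1 : R)} by exact: cvg_cst.
  have c0 : {for t, continuous (fun=> 0 : R)} by exact: cvg_cst.
  exact: (continuous_min c1 (continuous_max c0 (cl k t))).
have cg : continuous g.
  move=> t; apply: cvgM; last exact: cvg_cst.
  apply: cvgD; first exact: cvg_cst.
  apply: cvg_big => [|k _]; first exact: add_continuous.
  by apply: cvgM; [exact: cvg_cst | exact: cm].
apply: (@subspace_eq_continuous _ _ _ g); last exact: continuous_subspaceT.
move=> t; rewrite inE /unitI /= in_itv /= => /andP[t0 t1].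
rewrite /from_subspace /g (@interpolateE _ n) //; first by rewrite mulr_ge0.
by rewrite ler_piMr.
Qed.

Definition rescaled_path (s : nat -> R) (n : nat) : C01 R :=
  path01 (rescaled_continuous (s := s) (n := n)).

End Walk.

(* Main.v *)
(** Write S for the driftless walk with steps xi and s for the given walk. The
    walk s equals S, minus the xi-steps that are skipped while s <= 0, plus a
    nondecreasing drift that grows only while s <= 0. The expected number of
    steps spent in (-oo, 0] is O(sqrt n), because the drift is of the order of
    the running maximum of S; hence by Doob the skipped part is of order
    n^(1/4), single steps are o(sqrt n), and s/sqrt n is uniformly L^1-close to
    the Skorokhod reflection of S/sqrt n.

    By inf-convolution, weak convergence in C[0, 1] only has to be tested on
    bounded Lipschitz functionals F. For F composed with the reflection of S:
    replace S by its values on a mesh of m blocks (Doob's weak inequality bounds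
    the oscillations inside the blocks by Gaussian tails), so that F becomes a
    Lipschitz function of m independent block sums; replace these one at a time
    by the increments of sigma B, using a central limit theorem that is uniform
    over Lipschitz test functions and is proved by Lindeberg replacement; and
    finally let m tend to infinity, using the continuity of the Brownian
    paths. *)

Require Import Defs.
From HB Require Import structures.
From mathcomp Require Import all_boot all_order all_algebra.
From mathcomp Require Import all_classical all_reals all_analysis.
From mathcomp Require Import measurable_realfun.
From mathcomp Require Import ring lra.

Set Implicit Arguments.
Unset Strict Implicit.
Unset Printing Implicit Defensive.

Import Order.TTheory GRing.Theory Num.Theory.
Import numFieldNormedType.Exports.

Local Open Scope classical_set_scope.
Local Open Scope ring_scope.

(** * Means and independence *)

(** Only a first moment of [eta] is available, so the largest of the first n variables [eta k] need
    not be o(sqrt n). What helps is that [eta k] is used only when s k <= 0, an event independent of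
    [eta k], and that such k are O(sqrt n) in mean. Their number is bounded by absorption: the last
    jump of the drift is at most a level a plus the sum of all used jumps exceeding a, whose mean is
    at most half the mean drift once a is large, and so moves to the left-hand side. In the
    invariance principle the obstacle is the number m of blocks. A second-moment maximal inequality
    bounds the probability of a large oscillation in one block by a constant over m, and m blocks
    add this up to a constant. Keeping the positive part of S - lam in Doob's inequality and passing
    to its Gaussian limit replaces the constant by a Gaussian tail that vanishes as m grows.
    Conditional expectations are replaced by Fubini on disjoint index sets, and the Gaussian facts
    about sums are read off from the increments of [B]. *)

Notation "P .-L1" := (fun f => P.-integrable [set: _] (EFin \o f))
  (at level 2, format "P .-L1").

Section Mean.
Context d (T : measurableType d) (R : realType).
Variable P : probability T R.
Implicit Types f g : T -> R.

Lemma L1_measurable f : P.-L1 f -> measurable_fun setT f.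
Proof. by move=> /measurable_int /measurable_EFinP. Qed.

Lemma L1_integral f : P.-L1 f -> (\int[P]_x (f x)%:E)%E = (\int[P]_x f x)%:E.
Proof. by move=> i; rewrite /Rintegral fineK //; exact: integrable_fin_num. Qed.

Lemma L1_cst (c : R) : P.-L1 (fun=> c).
Proof. exact: finite_measure_integrable_cst. Qed.

Lemma mean_cst (c : R) : \int[P]_x c = c.
Proof.
by rewrite Rintegral_cst //= (_ : P setT = 1%E) ?mulr1 // probability_setT.
Qed.

Lemma L1_eq f g : f =1 g -> P.-L1 f -> P.-L1 g.
Proof. by move=> /funext ->. Qed.

Lemma L1_add f g : P.-L1 f -> P.-L1 g -> P.-L1 (fun x => f x + g x).
Proof. by move=> h1 h2; exact: (integrableD measurableT h1 h2). Qed.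

Lemma L1_scale (c : R) f : P.-L1 f -> P.-L1 (fun x => c * f x).
Proof. by move=> h; exact: (integrableZl measurableT c h). Qed.

Lemma L1_opp f : P.-L1 f -> P.-L1 (fun x => - f x).
Proof. by move=> h; apply: L1_eq (L1_scale (-1) h) => x; rewrite mulN1r. Qed.

Lemma L1_sub f g : P.-L1 f -> P.-L1 g -> P.-L1 (fun x => f x - g x).
Proof. by move=> h1 h2; exact: L1_add (L1_opp h2). Qed.

Lemma L1_sum I (s : seq I) (p : pred I) (F : I -> T -> R) :
  (forall i, P.-L1 (F i)) -> P.-L1 (fun x => \sum_(i <- s | p i) F i x).
Proof.
move=> h; elim: s => [|a s IH].
  by apply: L1_eq (L1_cst 0) => x; rewrite big_nil.
have [pa|pa] := boolP (p a).
  by apply: L1_eq (L1_add (h a) IH) => x; rewrite big_cons pa.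
by apply: L1_eq IH => x; rewrite big_cons (negbTE pa).
Qed.

Lemma L1_norm f : P.-L1 f -> P.-L1 (fun x => `|f x|).
Proof. by move=> h; exact: integrable_norm. Qed.

Lemma L1_le f g : measurable_fun setT f -> (forall x, `|f x| <= g x) ->
  P.-L1 g -> P.-L1 f.
Proof.
move=> mf fg ig; apply: le_integrable ig => //; first exact/measurable_EFinP.
by move=> x _; rewrite /= lee_fin (le_trans (fg x)) // ler_norm.
Qed.

Lemma L1_bounded f (M : R) : measurable_fun setT f -> (forall x, `|f x| <= M) ->
  P.-L1 f.
Proof. by move=> mf h; apply: L1_le (L1_cst M). Qed.

Lemma meanD f g : P.-L1 f -> P.-L1 g ->
  \int[P]_x (f x + g x) = \int[P]_x f x + \int[P]_x g x.
Proof. exact: RintegralD. Qed.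

Lemma meanB f g : P.-L1 f -> P.-L1 g ->
  \int[P]_x (f x - g x) = \int[P]_x f x - \int[P]_x g x.
Proof. exact: RintegralB. Qed.

Lemma meanZ (c : R) f : P.-L1 f -> \int[P]_x (c * f x) = c * \int[P]_x f x.
Proof. by move=> h; rewrite RintegralZl. Qed.

Lemma meanN f : P.-L1 f -> \int[P]_x (- f x) = - \int[P]_x f x.
Proof.
move=> h; rewrite -mulN1r -meanZ //; apply: eq_Rintegral => x _.
by rewrite mulN1r.
Qed.

Lemma mean_sum I (s : seq I) (p : pred I) (F : I -> T -> R) :
  (forall i, P.-L1 (F i)) ->
  \int[P]_x (\sum_(i <- s | p i) F i x) = \sum_(i <- s | p i) \int[P]_x F i x.
Proof.
move=> h; elim: s => [|a s IH].
  rewrite big_nil; under eq_Rintegral do rewrite big_nil.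
  exact: mean_cst.
rewrite big_cons; under eq_Rintegral do rewrite big_cons.
by case: (p a) => //; rewrite meanD // ?IH //; exact: L1_sum.
Qed.

Lemma le_mean_ae f g : P.-L1 f -> P.-L1 g -> {ae P, forall x, f x <= g x} ->
  \int[P]_x f x <= \int[P]_x g x.
Proof.
move=> hf hg fg; rewrite -subr_ge0 -meanB //.
have mfg := L1_measurable (L1_sub hg hf).
(* An a.e. nonnegative function agrees a.e. with its positive part, which is nonnegative
   everywhere. *)
rewrite (_ : \int[P]_x (g x - f x) = \int[P]_x Num.max (g x - f x) 0).
  by apply: Rintegral_ge0 => x _; rewrite le_max lexx orbT.
rewrite /Rintegral; congr fine; apply: ae_eq_integral => //.
- exact/measurable_EFinP.
- by apply/measurable_EFinP; exact: measurable_maxr.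
- apply: filterS fg => x /= fgx _; congr EFin.
  by rewrite max_l // subr_ge0.
Qed.

Lemma le_mean f g : P.-L1 f -> P.-L1 g -> (forall x, f x <= g x) ->
  \int[P]_x f x <= \int[P]_x g x.
Proof. by move=> hf hg fg; apply: le_mean_ae => //; exact: aeW. Qed.

Lemma mean_ge0 f : (forall x, 0 <= f x) -> 0 <= \int[P]_x f x.
Proof. by move=> h; apply: Rintegral_ge0 => x _. Qed.

Lemma le_mean_norm f : P.-L1 f -> `|\int[P]_x f x| <= \int[P]_x `|f x|.
Proof. exact: le_normr_Rintegral. Qed.

Lemma mean_le_cst f (c : R) : P.-L1 f -> (forall x, f x <= c) ->
  \int[P]_x f x <= c.
Proof. by move=> hf h; rewrite -[leRHS]mean_cst; exact: le_mean (L1_cst _) _. Qed.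

Lemma mean_norm_le f (c : R) : P.-L1 f -> (forall x, `|f x| <= c) ->
  `|\int[P]_x f x| <= c.
Proof.
move=> hf h; apply: le_trans (le_mean_norm hf) _.
by apply: mean_le_cst => //; exact: L1_norm.
Qed.

Lemma mean_dist_le f g h : P.-L1 f -> P.-L1 g -> P.-L1 h ->
  {ae P, forall x, `|f x - g x| <= h x} ->
  `|\int[P]_x f x - \int[P]_x g x| <= \int[P]_x h x.
Proof.
move=> hf hg hh fgh; rewrite -meanB //.
apply: le_trans (le_mean_norm (L1_sub hf hg)) _.
by apply: le_mean_ae => //; apply: L1_norm; exact: L1_sub.
Qed.

Lemma mean_dominated (f_ : nat -> T -> R) f g :
  (forall n, measurable_fun setT (f_ n)) -> measurable_fun setT f ->
  P.-L1 g -> (forall n x, `|f_ n x| <= g x) ->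
  (forall x, f_ ^~ x @ \oo --> f x) ->
  (fun n => \int[P]_x f_ n x) @ \oo --> \int[P]_x f x.
Proof.
move=> mf_ mf ig fg cf.
have dom : {ae P, forall x n, setT x -> (`|(f_ n x)%:E| <= (g x)%:E)%E}.
  by apply: aeW => x n _; rewrite lee_fin.
have cfe : {ae P, forall x, setT x -> (fun n => (f_ n x)%:E) @ \oo --> (f x)%:E}.
  by apply: aeW => x _; apply: cvg_EFin; [exact: nearW | exact: cf].
have mE n : measurable_fun setT (EFin \o f_ n) by exact/measurable_EFinP.
have mfE : measurable_fun setT (EFin \o f) by exact/measurable_EFinP.
have [inf _ c] := dominated_convergence measurableT mE mfE cfe ig dom.
have l : (\int[P]_x (f x)%:E)%E = (\int[P]_x f x)%:E by exact: L1_integral.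
rewrite l in c; exact: (fine_cvg c).
Qed.

End Mean.

(** * Independence of generated sigma-algebras and Fubini for independent variables *)

Section Independence_sigma_algebras.
Context d (T : measurableType d) (R : realType).
Variable P : probability T R.

(** Dynkin's pi-lambda theorem: for fixed [B], the events independent of [B] form a lambda-system,
    which contains the pi-system [G]. *)
Lemma indep_g_sigma_algebra (G : set (set T)) (B : set T) :
  setI_closed G -> G `<=` measurable -> measurable B ->
  (forall A, G A -> P (A `&` B) = (P A * P B)%E) ->
  forall A, <<s G >> A -> P (A `&` B) = (P A * P B)%E.
Proof.
move=> GI Gm mB GB.
have sGm A : <<s G >> A -> measurable A.
  by apply: smallest_sub => //; exact: sigma_algebra_measurable.
have PC (S : set T) : measurable S -> P (S `&` B) = (P S * P B)%E ->
    P (~` S `&` B) = (P (~` S) * P B)%E.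
  move=> mS PS; have -> : ~` S `&` B = B `\` (S `&` B).
    by apply/seteqP; split => x /=; tauto.
  have -> : P (B `\` (S `&` B)) = (P B - P S * P B)%E.
    rewrite -PS measureD //=; last by rewrite ltey_eq fin_num_measure.
    - by rewrite setICA setIid.
    - exact: measurableI.
  rewrite probability_setC //.
  have -> : P S = (fine (P S))%:E by rewrite fineK // fin_num_measure.
  have -> : P B = (fine (P B))%:E by rewrite fineK // fin_num_measure.
  by rewrite -EFinM -!EFinB -EFinM mulrBl mul1r.
have PU (F : (set T)^nat) : (forall n, measurable (F n)) ->
    trivIset setT F -> (forall n, P (F n `&` B) = (P (F n) * P B)%E) ->
    P (\bigcup_k F k `&` B) = (P (\bigcup_k F k) * P B)%E.
  move=> mF tF PF; rewrite setI_bigcupl measure_bigcup //; last first.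
    - by move=> i j _ _ [x [[Fi _] [Fj _]]]; apply: tF => //; exists x.
    - by move=> n _; exact: measurableI.
  have PB : P B = (fine (P B))%:E by rewrite fineK // fin_num_measure.
  rewrite measure_bigcup // PB muleC -nneseriesZl; last by move=> i _.
  apply: eq_eseriesr => n _; apply: etrans (PF n) _.
  by rewrite PB muleC.
have H := @dynkin_induction _ (g_sigma_algebraType G) G
  (fun A : set T => P (A `&` B) = (P A * P B)%E).
apply: H => //.
- by rewrite setTI probability_setT mul1e.
- by move=> S /sGm; exact: PC.
- by move=> F mF; apply: PU => n; apply: sGm; exact: mF.
Qed.

End Independence_sigma_algebras.

Lemma ge0_integral_distr d (T : measurableType d) (R : realType)
    (P : probability T R) d' (T' : measurableType d') (X : {mfun T >-> T'})
    (f : T' -> \bar R) : measurable_fun setT f -> (forall y, (0%:E <= f y)%E) ->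
  (\int[distribution P X]_y f y = \int[P]_x f (X x))%E.
Proof. by move=> mf f0; exact: (ge0_integral_distribution X mf f0). Qed.

Lemma integral_distr d (T : measurableType d) (R : realType)
    (P : probability T R) d' (T' : measurableType d') (X : {mfun T >-> T'})
    (f : T' -> \bar R) : measurable_fun setT f ->
  P.-integrable setT (fun w => f (X w)) ->
  (\int[distribution P X]_y f y = \int[P]_x f (X x))%E.
Proof. by move=> mf fi; exact: (integral_distribution mf fi). Qed.

Section Independent_pair.
Context d (T : measurableType d) (R : realType).
Variable P : probability T R.
Context d1 (T1 : measurableType d1) d2 (T2 : measurableType d2).

Let indep (U : T -> T1) (V : T -> T2) := forall A B, measurable A ->
  measurable B -> P (U @^-1` A `&` V @^-1` B) = (P (U @^-1` A) * P (V @^-1` B))%E.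

Section random_variables.
Variables (U : {mfun T >-> T1}) (V : {mfun T >-> T2}).
Hypothesis UV : indep U V.

Let phi w := (U w, V w).

Let mphi : measurable_fun setT phi.
Proof. exact: measurable_fun_pair. Qed.

Let Phi : {mfun T >-> (T1 * T2)%type} :=
  HB.pack phi (isMeasurableFun.Build _ _ _ _ phi mphi).

Let distr_pair A : measurable A ->
  distribution P Phi A = (distribution P U \x distribution P V)%E A.
Proof.
by move=> mA; apply/esym; exact: product_measure_unique.
Qed.

Let integral_pair (f : T1 * T2 -> \bar R) : measurable_fun setT f ->
  (\int[distribution P Phi]_z f z =
   \int[distribution P U \x distribution P V]_z f z)%E.
Proof. by move=> mf; apply: eq_measure_integral => A mA _; exact: distr_pair. Qed.

(** The joint law of [U] and [V] is the product of their laws; the independent copy of [V] is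
    realized by a separate sample point [v] of the same space. *)
Lemma indep_tonelli (h : T1 * T2 -> R) : measurable_fun setT h ->
  (forall z, 0 <= h z) ->
  (\int[P]_w (h (U w, V w))%:E = \int[P]_w \int[P]_v (h (U w, V v))%:E)%E.
Proof.
move=> mh h0.
have mhE : measurable_fun setT (EFin \o h) by exact/measurable_EFinP.
have hE0 z : (0%:E <= (h z)%:E)%E by rewrite lee_fin.
transitivity (\int[distribution P Phi]_z (h z)%:E)%E.
  by rewrite ge0_integral_distr.
rewrite integral_pair // fubini_tonelli1 //=.
rewrite ge0_integral_distr //=.
- apply: eq_integral => w _ /=; rewrite /fubini_F.
  rewrite (@ge0_integral_distr _ _ _ P _ _ V (fun y => (h (U w, y))%:E)) //.
  by apply: (measurableT_comp mhE); exact: measurable_pair1.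
- exact: measurable_fun_fubini_tonelli_F.
- by move=> x; apply: integral_ge0 => y _; exact: hE0.
Qed.

(** The section at every [x], not merely at almost every one, is integrable, so that the real-valued
    inner integral agrees everywhere with the extended-real one. *)
Lemma indep_fubini (h : T1 * T2 -> R) : measurable_fun setT h ->
  P.-L1 (fun w => h (U w, V w)) -> (forall x, P.-L1 (fun v => h (x, V v))) ->
  P.-L1 (fun w => \int[P]_v h (U w, V v)) /\
  \int[P]_w h (U w, V w) = \int[P]_w \int[P]_v h (U w, V v).
Proof.
move=> mh ih ihx.
have mhE : measurable_fun setT (EFin \o h) by exact/measurable_EFinP.
have ihP : (distribution P U \x distribution P V)%E.-integrable setT (EFin \o h).
  apply/integrableP; split => //.
  have mA : measurable_fun setT (fun z => `|(EFin \o h) z|)%E.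
    exact: measurableT_comp.
  rewrite -(integral_pair mA) (ge0_integral_distr P Phi mA) => [|y].
    by move/integrableP : ih => [].
  exact: abse_ge0.
have FE x : fubini_F (distribution P V) (EFin \o h) x = (\int[P]_v h (x, V v))%:E.
  rewrite /fubini_F /= (@integral_distr _ _ _ P _ _ V (fun y => (h (x, y))%:E)).
  - by rewrite -L1_integral.
  - by apply: (measurableT_comp mhE); exact: measurable_pair1.
  - exact: ihx.
have iF := integrable_fubini_F ihP.
have L1F : P.-L1 (fun w => \int[P]_v h (U w, V v)).
  have mF := measurable_int _ iF.
  apply/integrableP; split.
    apply: (eq_measurable_fun (fubini_F (distribution P V) (EFin \o h) \o U)).
      by move=> w _; rewrite /= FE.
    exact: measurableT_comp.
  have mA : measurable_fun setT
      (fun x => `|fubini_F (distribution P V) (EFin \o h) x|)%E.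
    exact: measurableT_comp.
  move/integrableP : iF => [_]; rewrite (ge0_integral_distr P U mA) => [|y].
    by under eq_integral do rewrite /= FE.
  exact: abse_ge0.
split => //.
apply: EFin_inj; rewrite -!L1_integral //.
transitivity (\int[distribution P Phi]_z (h z)%:E)%E.
  by rewrite integral_distr.
rewrite integral_pair // -integral12_prod_meas1 //.
rewrite integral_distr //.
- by apply: eq_integral => w _; rewrite /= FE.
- exact: measurable_int iF.
- by apply: eq_integrable L1F => // w _; rewrite /= FE.
Qed.

End random_variables.

End Independent_pair.

Section Caratheodory.
Context d0 (T0 : measurableType d0) (R : realType).

(* Approximate [h] by [h x (c k y)] where [c k] takes countably many values. *)
Lemma measurable_lipschitz2 (h : T0 -> R -> R) (L : R) :
  (forall y, measurable_fun setT (h ^~ y)) ->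
  (forall x y y', `|h x y - h x y'| <= L * `|y - y'|) ->
  measurable_fun setT (fun z : T0 * R => h z.1 z.2).
Proof.
move=> mh hL.
pose c (k : nat) (y : R) : R := (Num.floor (k.+1%:R * y))%:~R / k.+1%:R.
have k0 k : (0 : R) < k.+1%:R by rewrite ltr0n.
have cP k y : `|c k y - y| <= k.+1%:R^-1.
  have -> : c k y - y = - ((k.+1%:R * y - (Num.floor (k.+1%:R * y))%:~R) / k.+1%:R).
    by rewrite /c; field; rewrite gt_eqF.
  have f1 := floor_le_tmp (k.+1%:R * y); have f2 := floorD1_gt (k.+1%:R * y).
  rewrite normrN ger0_norm; last by rewrite divr_ge0 ?(ltW (k0 k)) // subr_ge0.
  rewrite -[leRHS]mul1r ler_pM2r ?invr_gt0 //.
  by move: f2; rewrite intrD /= => f2; lra.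
apply: (@measurable_fun_cvg _ _ _ setT (fun k z => h z.1 (c k z.2))).
  move=> k _ A mA; rewrite setTI.
  rewrite (_ : _ @^-1` A = \bigcup_(j : int) ((h ^~ (j%:~R / k.+1%:R)) @^-1` A `*`
      [set` `[j%:~R / k.+1%:R, (j + 1)%:~R / k.+1%:R[ ])).
    apply: countable_bigcupT_measurable => // j; apply: measurableX => //.
    by rewrite -[X in measurable X]setTI; exact: mh.
  have fE (y : R) (j : int) : (y \in `[j%:~R / k.+1%:R, (j + 1)%:~R / k.+1%:R[) =
      (Num.floor (k.+1%:R * y) == j).
    rewrite in_itv /= ler_pdivrMr // ltr_pdivlMr // [y * _]mulrC.
    apply/idP/eqP => [h2|<-].
      exact: floor_def.
    by rewrite floor_le_tmp floorD1_gt.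
  apply/seteqP; split => [[x y] /= xyA|[x y] /= [j _ [/= hA]]].
    exists (Num.floor (k.+1%:R * y)) => //; split => //=.
    by rewrite fE.
  by rewrite fE => /eqP e; rewrite /c e.
move=> [x y] _ /=; apply/cvgrPdist_le => e e0.
have LT : 0 <= L.
  by move: (hL x 0 1); rewrite sub0r normrN normr1 mulr1; exact: le_trans.
near=> k.
apply: (le_trans (hL _ _ _)); rewrite distrC.
apply: (@le_trans _ _ (L * k.+1%:R^-1)); first by rewrite ler_wpM2l.
have : (L + 1) / e <= k.+1%:R.
  near: k; exists (Num.trunc ((L + 1) / e)) => // k /= kk.
  apply/ltW; apply: lt_le_trans (truncnS_gt _) _.
  by rewrite ler_nat.
rewrite ler_pdivrMr // ler_pdivrMr // => h1.
by rewrite mulrC; lra.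
Unshelve. all: by end_near. Qed.

End Caratheodory.

(** * Sigma-algebras of subfamilies of an independent family *)

Section Families.
Context d (T : measurableType d) (R : realType) (P : probability T R).
Context (I : choiceType) (Z : I -> T -> R).

(** A pi-system of finite-dimensional events, in the very form to which [mutually_independent]
    applies; it generates the sigma-algebra of the [Z i] with [i] in [J]. *)
Definition cylinders (J : set I) : set (set T) :=
  [set A | exists (s : seq I) (B : I -> set R),
    [/\ uniq s, forall i, i \in s -> J i, forall i, measurable (B i) &
        A = \bigcap_(i in [set` s]) (Z i @^-1` B i)]].

Definition adapted (J : set I) (X : T -> R) :=
  measurable_fun setT (X : g_sigma_algebraType (cylinders J) -> R).

Lemma cylinders_setI J : setI_closed (cylinders J).
Proof.
move=> _ _ [s [B [us sJ mB ->]]] [s' [B' [us' sJ' mB' ->]]].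
exists (undup (s ++ s')), (fun i => (if i \in s then B i else setT) `&`
  (if i \in s' then B' i else setT)); split.
- exact: undup_uniq.
- by move=> i; rewrite mem_undup mem_cat => /orP[/sJ|/sJ'].
- by move=> i; apply: measurableI; case: ifP.
- apply/seteqP; split => w /=.
    move=> [h1 h2] i /= _; split.
      by case: ifP => // si; exact: h1.
    by case: ifP => // si; exact: h2.
  move=> h; split => i /= si; have := h i; rewrite /= mem_undup mem_cat si ?orbT;
    by move=> /(_ isT) [].
Qed.

Lemma cylinders_sub J J' : J `<=` J' -> cylinders J `<=` cylinders J'.
Proof.
by move=> JJ' A [s [B [us sJ mB ->]]]; exists s, B; split => // i /sJ /JJ'.
Qed.

Lemma adapted_sub J J' X : J `<=` J' -> adapted J X -> adapted J' X.
Proof.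
move=> JJ' aX _ B mB; have := aX measurableT B mB.
exact: (sub_sigma_algebra2 (cylinders_sub JJ')).
Qed.

Lemma adapted_index (J : set I) i : J i -> adapted J (Z i).
Proof.
move=> Ji _ B mB; rewrite setTI; apply: sub_gen_smallest.
exists [:: i], (fun=> B); split => //.
- by move=> j; rewrite inE => /eqP ->.
- apply/seteqP; split => w /=; first by move=> h j; rewrite /= inE => /eqP ->.
  by apply; rewrite /= inE.
Qed.

Hypothesis mZ : forall i, measurable_fun setT (Z i).

Lemma cylinders_measurable J : cylinders J `<=` measurable.
Proof.
move=> _ [s [B [us sJ mB ->]]]; apply: fin_bigcap_measurable => [|i _]; first exact: finite_seq.
by rewrite -[X in measurable X]setTI; exact: mZ.
Qed.

Lemma sigma_cylinders_measurable J : <<s cylinders J >> `<=` measurable.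
Proof.
apply: smallest_sub; first exact: sigma_algebra_measurable.
exact: cylinders_measurable.
Qed.

Lemma adapted_measurable J X : adapted J X -> measurable_fun setT X.
Proof.
by move=> aX _ B mB; apply: (@sigma_cylinders_measurable J); exact: aX.
Qed.

Hypothesis iZ : mutually_independent P Z.

Lemma cylinders_indep J J' A B : J `&` J' = set0 ->
  cylinders J A -> cylinders J' B -> P (A `&` B) = (P A * P B)%E.
Proof.
move=> JJ' [s [C [us sJ mC ->]]] [s' [C' [us' sJ' mC' ->]]].
have ss' i : i \in s -> i \in s' -> False.
  by move=> /sJ Ji /sJ' J'i; have : set0 i by rewrite -JJ'.
pose D i := if i \in s then C i else C' i.
have mD i : measurable (D i) by rewrite /D; case: ifP.
have uss : uniq (s ++ s').
  rewrite cat_uniq us us' andbT /=; apply/hasPn => i /= is'.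
  by apply/negP => /ss'; exact.
have -> : \bigcap_(i in [set` s]) (Z i @^-1` C i) `&`
    \bigcap_(i in [set` s']) (Z i @^-1` C' i) =
    \bigcap_(i in [set` s ++ s']) (Z i @^-1` D i).
  apply/seteqP; split => w /=.
    move=> [h1 h2] i /=; rewrite mem_cat /D; case: ifP => // si.
      by move=> _; exact: h1.
    by rewrite /= => si'; exact: h2.
  move=> h; split => i /= si; have := h i; rewrite /= mem_cat si ?orbT => /(_ isT).
    by rewrite /D si.
  by rewrite /D; case: ifP => // /ss' /(_ si).
rewrite (iZ uss mD) big_cat /=; congr (_ * _)%E.
  rewrite (iZ us mC) [LHS]big_seq [RHS]big_seq.
  by apply: eq_bigr => i si; rewrite /D si.
rewrite (iZ us' mC') [LHS]big_seq [RHS]big_seq.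
by apply: eq_bigr => i si; rewrite /D; case: ifP => // /ss' /(_ si).
Qed.

(** The pi-lambda argument is applied twice: one event ranges over its sigma-algebra while the other
    is held fixed, then the roles are exchanged. *)
Lemma sigma_cylinders_indep J J' A B : J `&` J' = set0 ->
  <<s cylinders J >> A -> <<s cylinders J' >> B ->
  P (A `&` B) = (P A * P B)%E.
Proof.
move=> JJ' sA sB; have mB := sigma_cylinders_measurable sB.
apply: (indep_g_sigma_algebra (@cylinders_setI J) (@cylinders_measurable J)
  mB _ sA) => A' cA'; rewrite setIC muleC.
have mA' := cylinders_measurable cA'.
apply: (indep_g_sigma_algebra (@cylinders_setI J') (@cylinders_measurable J')
  mA' _ sB) => B' cB'; rewrite setIC muleC.
exact: cylinders_indep cA' cB'.
Qed.

Lemma adapted_indep J J' X Y : J `&` J' = set0 -> adapted J X -> adapted J' Y ->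
  forall A B, measurable A -> measurable B ->
  P (X @^-1` A `&` Y @^-1` B) = (P (X @^-1` A) * P (Y @^-1` B))%E.
Proof.
move=> JJ' aX aY A B mA mB; apply: (sigma_cylinders_indep JJ').
  by rewrite -[X in <<s _ >> X]setTI; exact: aX.
by rewrite -[X in <<s _ >> X]setTI; exact: aY.
Qed.

(** Stands in for conditioning on the [J]-variables: they stay frozen at [w] while [Y] is averaged
    over a fresh sample point. The conditioning variable is the identity map into the sample space
    equipped with the sigma-algebra of [J]. The Lipschitz bound in [y] gives both the joint
    measurability and the integrability of each section. *)
Lemma adapted_fubini J J' (h : T -> R -> R) (L : R) Y : J `&` J' = set0 ->
  adapted J' Y -> (forall y, adapted J (h ^~ y)) ->
  (forall w y y', `|h w y - h w y'| <= L * `|y - y'|) -> P.-L1 Y ->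
  P.-L1 (fun w => h w (Y w)) ->
  P.-L1 (fun w => \int[P]_v h w (Y v)) /\
  \int[P]_w h w (Y w) = \int[P]_w \int[P]_v h w (Y v).
Proof.
move=> JJ' aY ah hL iY ih.
have mY := adapted_measurable aY.
pose T0 := g_sigma_algebraType (cylinders J).
have mid : measurable_fun setT (id : T -> T0).
  by move=> _ A sA; rewrite setTI; exact: sigma_cylinders_measurable sA.
pose U : {mfun T >-> T0} := HB.pack (id : T -> T0) (isMeasurableFun.Build _ _ _ _ _ mid).
pose V : {mfun T >-> R} := HB.pack Y (isMeasurableFun.Build _ _ _ _ _ mY).
have mh : measurable_fun setT (fun z : T0 * R => h z.1 z.2).
  exact: (@measurable_lipschitz2 _ T0 R h L ah hL).
have UV A B : measurable A -> measurable B ->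
    P (U @^-1` A `&` V @^-1` B) = (P (U @^-1` A) * P (V @^-1` B))%E.
  move=> mA mB; apply: (sigma_cylinders_indep JJ'); first exact: mA.
  by rewrite -[X in <<s _ >> X]setTI; exact: aY.
apply: (indep_fubini UV mh) => //= x.
apply: (@L1_le _ _ _ _ _ (fun v => `|h x 0| + L * `|Y v|)).
- apply: (measurableT_comp (f := h x)) => //.
  have mhT : measurable_fun setT (fun z : T * R => h z.1 z.2).
    apply: (@measurable_lipschitz2 _ T R h L) => // y.
    exact: adapted_measurable (ah y).
  exact: (@measurableT_comp _ _ _ _ _ _ _ _ _ mhT (measurable_pair1 (x : T))).
- move=> v; have := hL x (Y v) 0; rewrite subr0 => h1.
  by have := ler_normD (h x (Y v) - h x 0) (h x 0); rewrite subrK; lra.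
- by apply: L1_add (L1_cst _ _) _; apply: L1_scale; exact: L1_norm.
Qed.

Lemma adapted_mul J J' X Y : J `&` J' = set0 -> adapted J X -> adapted J' Y ->
  P.-L1 X -> P.-L1 Y ->
  P.-L1 (fun w => X w * Y w) /\
  \int[P]_w (X w * Y w) = \int[P]_w X w * \int[P]_w Y w.
Proof.
move=> JJ' aX aY iX iY.
have mX := L1_measurable iX; have mY := L1_measurable iY.
pose U : {mfun T >-> R} := HB.pack X (isMeasurableFun.Build _ _ _ _ _ mX).
pose V : {mfun T >-> R} := HB.pack Y (isMeasurableFun.Build _ _ _ _ _ mY).
have UV : forall A B, measurable A -> measurable B ->
    P (U @^-1` A `&` V @^-1` B) = (P (U @^-1` A) * P (V @^-1` B))%E.
  by move=> A B mA mB; exact: (adapted_indep JJ' aX aY).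
have mm : measurable_fun setT (fun z : R * R => z.1 * z.2).
  by apply: measurable_funM; [exact: measurable_fst|exact: measurable_snd].
(* Integrability of the product comes from Tonelli: E|XY| = E|X| E|Y|. *)
have iXY : P.-L1 (fun w => X w * Y w).
  apply/integrableP; split.
    by apply/measurable_EFinP; exact: measurable_funM.
  have mn : measurable_fun setT (fun z : R * R => `|z.1 * z.2|).
    exact: measurableT_comp.
  have := indep_tonelli UV mn (fun z => normr_ge0 _) => /= ->.
  have E w : (\int[P]_v (`|X w * Y v|)%:E = (`|X w| * \int[P]_v `|Y v|)%:E)%E.
    under eq_integral do rewrite normrM.
    rewrite L1_integral ?meanZ //; first exact: L1_norm.
    by apply: L1_scale; exact: L1_norm.
  under eq_integral do rewrite E.
  rewrite L1_integral ?ltry //.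
  apply: L1_eq (L1_scale (\int[P]_v `|Y v|) (L1_norm iX)) => w.
  by rewrite mulrC.
split => //.
have [_ /= ->] := indep_fubini UV mm iXY (fun x => L1_scale x iY).
under eq_Rintegral do rewrite meanZ //.
under eq_Rintegral do rewrite mulrC.
by rewrite meanZ // mulrC.
Qed.

End Families.

Definition upd (R : Type) (x : nat -> R) (i : nat) (v : R) : nat -> R :=
  fun j => if j == i then v else x j.

(** The l1 bound over [j < m] also forces [H] to depend on the first m coordinates only ([lip1_eq]),
    so functions of m variables are handled on infinite sequences, without tuples. *)
Definition lip1 (R : realType) (m : nat) (L : R) (H : (nat -> R) -> R) :=
  0 <= L /\ forall x y, `|H x - H y| <= L * \sum_(j < m) `|x j - y j|.

Section Lip1.
Context (R : realType).

Lemma lip1_eq m (L : R) H x y : lip1 m L H ->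
  (forall j, (j < m)%N -> x j = y j) -> H x = H y.
Proof.
move=> [_ hH] xy; apply/eqP; rewrite -subr_eq0 -normr_eq0 eq_le normr_ge0 andbT.
apply: (le_trans (hH x y)); rewrite big1 ?mulr0 // => j _.
by rewrite xy // subrr normr0.
Qed.

Lemma lip1_upd m (L : R) H x i v v' : lip1 m L H ->
  `|H (upd x i v) - H (upd x i v')| <= L * `|v - v'|.
Proof.
move=> [L0 hH]; apply: (le_trans (hH _ _)); rewrite ler_wpM2l //.
have [im|mi] := ltnP i m; last first.
  rewrite big1 ?normr_ge0 // => j _; rewrite /upd ltn_eqF ?subrr ?normr0 //.
  exact: leq_trans (ltn_ord j) mi.
rewrite (bigD1 (Ordinal im)) //= /upd eqxx big1 ?addr0 // => j.
by rewrite -val_eqE /= => /negbTE ->; rewrite subrr normr0.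
Qed.

Lemma lip1_norm m (L : R) H x : lip1 m L H ->
  `|H x| <= `|H (fun=> 0)| + L * \sum_(j < m) `|x j|.
Proof.
move=> [_ /(_ x (fun=> 0))].
under eq_bigr do rewrite subr0.
by have := ler_normD (H x - H (fun=> 0)) (H (fun=> 0)); rewrite subrK; lra.
Qed.

End Lip1.

(** * Lipschitz functions of independent coordinates *)

Section Tensor.
Context d (T : measurableType d) (R : realType) (P : probability T R).
Context (I : choiceType) (Z : I -> T -> R).
Hypothesis mZ : forall i, measurable_fun setT (Z i).
Hypothesis iZ : mutually_independent P Z.
Variables (J K : nat -> set I) (X : nat -> T -> R).
Hypothesis JK : forall i, J i `&` K i = set0.
Hypothesis JS : forall i, J i `<=` J i.+1.
Hypothesis KS : forall i, K i `<=` J i.+1.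
Hypothesis aX : forall i, adapted Z (K i) (X i).
Hypothesis iX : forall i, P.-L1 (X i).

Lemma adapted_lip1 m (L : R) H i x : lip1 m L H ->
  adapted Z (J i) (fun w => H (fun j => if (j < i)%N then X j w else x j)).
Proof.
move=> hH; elim: i x => [|i IH] x.
  exact: (@measurable_cst _ _ (g_sigma_algebraType (cylinders Z (J 0))) R setT (H x)).
pose h w y := H (fun j => if (j < i)%N then X j w else upd x i y j).
have hE w : H (fun j => if (j < i.+1)%N then X j w else x j) = h w (X i w).
  congr H; apply/funext => j; rewrite /upd ltnS leq_eqVlt.
  by case: eqP => [->|_] //=; rewrite ltnn.
have -> : (fun w => H (fun j => if (j < i.+1)%N then X j w else x j)) =
  (fun w => h w (X i w)) by apply/funext.
pose T0 := g_sigma_algebraType (cylinders Z (J i.+1)).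
have ah y : measurable_fun setT (h ^~ y : T0 -> R).
  by apply: adapted_sub (JS (i := i)) _; exact: IH.
have hL w y y' : `|h w y - h w y'| <= L * `|y - y'|.
  have e v : h w v = H (upd (fun j => if (j < i)%N then X j w else x j) i v).
    congr H; apply/funext => j; rewrite /upd.
    by case: eqP => [->|//]; rewrite ltnn.
  by rewrite !e; exact: lip1_upd hH.
have mh := @measurable_lipschitz2 _ T0 R h L ah hL.
have mX : measurable_fun setT (X i : T0 -> R).
  by apply: adapted_sub (KS (i := i)) _; exact: aX.
exact: (measurableT_comp mh (measurable_fun_pair (@measurable_id _ T0 setT) mX)).
Qed.

Lemma lip1_L1 m (L : R) H : lip1 m L H -> P.-L1 (fun w => H (X ^~ w)).
Proof.
move=> hH; apply: (@L1_le _ _ _ _ _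
  (fun w => `|H (fun=> 0)| + L * \sum_(j < m) `|X j w|)).
- have := adapted_measurable mZ (adapted_lip1 (i := m) (fun=> 0) hH).
  apply: eq_measurable_fun => w _; apply: (lip1_eq hH) => j ->.
  by [].
- by move=> w; exact: lip1_norm.
- apply: L1_add (L1_cst _ _) _; apply: L1_scale; apply: L1_sum => j.
  exact: L1_norm.
Qed.

Lemma lip1_int m (L : R) H i : lip1 m L H ->
  (forall x, P.-L1 (fun w => H (upd x i (X i w)))).
Proof.
move=> hH x.
have mi : measurable_fun setT (fun y => H (upd x i y)).
  have := @measurable_lipschitz2 _ T R (fun _ y => H (upd x i y)) L.
  move=> /(_ (fun=> measurable_cst _) (fun _ y y' => lip1_upd x i y y' hH)) m2.
  exact: (measurableT_comp m2 (measurable_pair1 point)).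
apply: (@L1_le _ _ _ _ _ (fun w => `|H (upd x i 0)| + L * `|X i w|)).
- exact: (measurableT_comp mi (L1_measurable (iX i))).
- move=> w; have := lip1_upd x i (X i w) 0 hH; rewrite subr0.
  by have := ler_normD (H (upd x i (X i w)) - H (upd x i 0)) (H (upd x i 0));
    rewrite subrK; lra.
- by apply: L1_add (L1_cst _ _) _; apply: L1_scale; exact: L1_norm.
Qed.

Lemma lip1_integrate m (L : R) H : lip1 m.+1 L H ->
  lip1 m L (fun x => \int[P]_w H (upd x m (X m w))).
Proof.
move=> hH; have [L0 hL] := hH; split => // x y.
rewrite -meanB; [|exact: (lip1_int m hH) ..].
apply: mean_norm_le; first by apply: L1_sub; exact: (lip1_int m hH).
move=> w; apply: (le_trans (hL _ _)); rewrite ler_wpM2l //.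
rewrite big_ord_recr /= /upd eqxx subrr normr0 addr0.
by apply: ler_sum => j _; rewrite ltn_eqF.
Qed.

(** Fubini with the earlier coordinates frozen integrates out the last one; what remains has one
    coordinate fewer and, by [lip1_integrate], the same Lipschitz constant. *)
Lemma mean_lip1_step m (L : R) H : lip1 m.+1 L H ->
  \int[P]_w H (X ^~ w) = \int[P]_w \int[P]_v H (upd (X ^~ w) m (X m v)).
Proof.
move=> hH; pose h w y := H (upd (X ^~ w) m y).
have hE w : h w (X m w) = H (X ^~ w).
  congr H; apply/funext => j; rewrite /upd.
  by case: eqP => // ->.
transitivity (\int[P]_w h w (X m w)).
  by apply: eq_Rintegral => w _; rewrite hE.
have ah y : adapted Z (J m) (h ^~ y).
  have := adapted_lip1 (i := m) (fun=> y) hH.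
  apply: eq_measurable_fun => w _; apply: (lip1_eq hH) => j jm.
  rewrite /upd; case: ltnP => mj; first by rewrite ltn_eqF.
  by rewrite eqn_leq mj -ltnS jm.
have [] := @adapted_fubini _ T R P _ Z mZ iZ (J m) (K m) h L (X m) (JK m)
  (@aX m) ah (fun w y y' => lip1_upd _ _ _ _ hH) (iX m).
  by apply: L1_eq (lip1_L1 hH) => w; rewrite hE.
by [].
Qed.

End Tensor.

Section Comparison.
Context (R : realType).
Context d (T : measurableType d) (P : probability T R).
Context (I : choiceType) (Z : I -> T -> R).
Hypothesis mZ : forall i, measurable_fun setT (Z i).
Hypothesis iZ : mutually_independent P Z.
Variables (J K : nat -> set I) (X : nat -> T -> R).
Hypothesis JK : forall i, J i `&` K i = set0.
Hypothesis JS : forall i, J i `<=` J i.+1.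
Hypothesis KS : forall i, K i `<=` J i.+1.
Hypothesis aX : forall i, adapted Z (K i) (X i).
Hypothesis iX : forall i, P.-L1 (X i).
Context d' (T' : measurableType d') (Q : probability T' R).
Context (I' : choiceType) (Z' : I' -> T' -> R).
Hypothesis mZ' : forall i, measurable_fun setT (Z' i).
Hypothesis iZ' : mutually_independent Q Z'.
Variables (J' K' : nat -> set I') (Y : nat -> T' -> R).
Hypothesis JK' : forall i, J' i `&` K' i = set0.
Hypothesis JS' : forall i, J' i `<=` J' i.+1.
Hypothesis KS' : forall i, K' i `<=` J' i.+1.
Hypothesis aY : forall i, adapted Z' (K' i) (Y i).
Hypothesis iY : forall i, Q.-L1 (Y i).

(** Integrating out the last coordinate under either law yields functions [HP] and [HQ] of m
    coordinates that differ by at most [e] everywhere, since [H] is Lipschitz in its last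
    coordinate. What is left is [HQ] alone, compared under both laws, so each coordinate costs one
    [e]. *)
Lemma tensor_comparison m (L e : R) (H : (nat -> R) -> R) : lip1 m L H ->
  (forall i (f : R -> R), (forall x y, `|f x - f y| <= L * `|x - y|) ->
    `|\int[P]_w f (X i w) - \int[Q]_w f (Y i w)| <= e) ->
  `|\int[P]_w H (X ^~ w) - \int[Q]_w H (Y ^~ w)| <= m%:R * e.
Proof.
move=> hH hf; elim: m H hH => [|m IH] H hH.
  have E (x : nat -> R) : H x = H (fun=> 0) by apply: (lip1_eq hH).
  under eq_Rintegral do rewrite E.
  under [X in _ - X]eq_Rintegral do rewrite E.
  by rewrite !mean_cst subrr normr0 mul0r.
pose HP x := \int[P]_w H (upd x m (X m w)).
pose HQ x := \int[Q]_w H (upd x m (Y m w)).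
have hP : lip1 m L HP by exact: lip1_integrate hH.
have hQ : lip1 m L HQ by exact: lip1_integrate hH.
rewrite (mean_lip1_step mZ iZ JK JS KS aX iX hH).
rewrite (mean_lip1_step mZ' iZ' JK' JS' KS' aY iY hH).
rewrite -/(HP _) -/(HQ _).
have h1 : `|\int[P]_w HP (X ^~ w) - \int[P]_w HQ (X ^~ w)| <= e.
  rewrite -meanB; [|exact: (lip1_L1 mZ JS KS aX iX hP)
                   |exact: (lip1_L1 mZ JS KS aX iX hQ)].
  apply: mean_norm_le => [|w].
    by apply: L1_sub; [exact: (lip1_L1 mZ JS KS aX iX hP)
                      |exact: (lip1_L1 mZ JS KS aX iX hQ)].
  apply: (hf m (fun y => H (upd (X ^~ w) m y))) => x y.
  exact: lip1_upd hH.
have h2 := IH _ hQ.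
rewrite -natr1 mulrDl mul1r [leRHS]addrC.
apply: (le_trans (ler_distD (\int[P]_w HQ (X ^~ w)) _ _)). exact: lerD.
Qed.

End Comparison.

(** * The central limit theorem for Lipschitz functions *)

Section Derivatives.
Context (R : realType).
Implicit Types (f g : R -> R) (x a b c : R).

Lemma is_derive1_eq f x a b : is_derive x 1 f a -> a = b -> is_derive x 1 f b.
Proof. by move=> h <-. Qed.

Lemma is_derive1D f g x a b : is_derive x 1 f a -> is_derive x 1 g b ->
  is_derive x 1 (fun y => f y + g y) (a + b).
Proof. exact: is_deriveD. Qed.

Lemma is_derive1B f g x a b : is_derive x 1 f a -> is_derive x 1 g b ->
  is_derive x 1 (fun y => f y - g y) (a - b).
Proof. exact: is_deriveB. Qed.

Lemma is_derive1M f g x a b : is_derive x 1 f a -> is_derive x 1 g b ->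
  is_derive x 1 (fun y => f y * g y) (f x * b + g x * a).
Proof. exact: is_deriveM. Qed.

Lemma is_derive1Z c f x a : is_derive x 1 f a ->
  is_derive x 1 (fun y => c * f y) (c * a).
Proof. exact: is_deriveZ. Qed.

Lemma is_derive1_shift c f x a : is_derive (c + x) 1 f a ->
  is_derive x 1 (fun y => f (c + y)) a.
Proof.
move=> h; have h1 : is_derive x 1 (fun y => c + y) (0 + 1).
  exact: is_derive1D.
by have := is_derive1_comp h h1; rewrite add0r mulr1.
Qed.

End Derivatives.

(** * Gaussian integrals and scaling *)

Section Gaussian.
Context (R : realType).
Notation mu := (@lebesgue_measure R).

(** The Radon-Nikodym derivative of [normal_prob 0 s] and [normal_pdf 0 s] have the same integral
    over every measurable set, hence agree a.e.; the rest is change of measure. *)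
Lemma ge0_integral_normal_prob (s : R) (f : R -> \bar R) :
  measurable_fun setT f -> (forall x, (0%:E <= f x)%E) ->
  (\int[normal_prob 0 s]_x f x = \int[mu]_x (f x * (normal_pdf 0 s x)%:E))%E.
Proof.
move=> mf f0; have dom := normal_prob_dominates 0 s.
rewrite -(Radon_Nikodym_SigmaFinite.change_of_variables dom) //.
have mp : measurable_fun setT (fun x => (normal_pdf 0 s x)%:E).
  by apply/measurable_EFinP; exact: measurable_normal_pdf.
have iRN := Radon_Nikodym_SigmaFinite.f_integrable dom.
apply: ae_eq_integral => //.
- by apply: emeasurable_funM => //; exact: measurable_int iRN.
- exact: emeasurable_funM.
- apply: ae_eqe_mul2l; apply: integral_ae_eq => // E _ mE.
  by rewrite -(Radon_Nikodym_SigmaFinite.f_integral dom).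
Qed.

Lemma normal_pdf_scale (s y : R) : 0 < s ->
  normal_pdf 0 s (s * y) * s = normal_pdf 0 1 y.
Proof.
move=> s0; rewrite !normal_pdfE ?oner_neq0 ?gt_eqF // /normal_fun !subr0.
rewrite /normal_peak expr1n mul1r exprMn.
have -> : - (s ^+ 2 * y ^+ 2) / (s ^+ 2 *+ 2) = - y ^+ 2 / (1 *+ 2).
  by field; rewrite gt_eqF.
rewrite mulrAC; congr (_ * _).
rewrite -mulrnAr sqrtrM ?sqr_ge0 // sqrtr_sqr gtr0_norm // invfM.
by rewrite mulrAC mulVf ?gt_eqF // mul1r.
Qed.

Lemma ge0_normal_prob_scale (s : R) (f : R -> R) : 0 < s -> continuous f ->
  (forall x, 0 <= f x) ->
  (\int[normal_prob 0 s]_x (f x)%:E = \int[normal_prob 0 1]_x (f (s * x))%:E)%E.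
Proof.
move=> s0 cf f0.
have cs : continuous (fun x : R => s * x).
  by move=> x; apply: cvgM; [exact: cvg_cst|exact: cvg_id].
have cfs : continuous (fun x => f (s * x)).
  by move=> x; apply: (continuous_comp (f := fun x => s * x)); [exact: cs|exact: cf].
have m1 : measurable_fun setT (fun x => (f x)%:E).
  by apply/measurable_EFinP; exact: continuous_measurable_fun.
have m2 : measurable_fun setT (fun x => (f (s * x))%:E).
  by apply/measurable_EFinP; exact: continuous_measurable_fun.
have h0 x : (0%:E <= (f (s * x))%:E)%E by rewrite lee_fin.
rewrite (ge0_integral_normal_prob _ m1) // (ge0_integral_normal_prob _ m2) //.
have dF (x : R) : is_derive x (1 : R) (fun x : R => s * x) s.
  exact: is_derive1_eq (is_derive1Z s (is_derive_id x 1)) (mulr1 s).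
have dFE : ((fun x : R => s * x)^`())%classic = cst s.
  by apply/funext => x; rewrite derive1E; have [_ ->] := dF x.
have cp : continuous (normal_pdf (0 : R) s).
  by apply: continuous_normal_pdf; rewrite gt_eqF.
transitivity (\int[mu]_x (f x * normal_pdf 0 s x)%:E)%E.
  by apply: eq_integral => x _; rewrite EFinM.
rewrite (@increasing_ge0_integration_by_substitutionT _ (fun x => s * x)).
- apply: eq_integral => x _; rewrite -EFinM; congr EFin.
  by rewrite /= dFE -(normal_pdf_scale x s0) /= mulrA.
- by move=> x y xy; rewrite ltr_pM2l.
- by rewrite dFE => x; exact: cvg_cst.
- by rewrite dFE; exact: is_cvg_cst.
- by rewrite dFE; exact: is_cvg_cst.
- by move=> x; have [] := dF x.
- by apply: gt0_cvgMrNy => //; exact: cvg_id.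
- by apply: gt0_cvgMry => //; exact: cvg_id.
- by move=> x; apply: cvgM; [exact: cf|exact: cp].
- by move=> x; rewrite mulr_ge0 // normal_pdf_ge0.
Qed.

Lemma normal_prob_scale (s : R) (f : R -> R) : 0 < s -> continuous f ->
  (\int[normal_prob 0 s]_x (f x)%:E = \int[normal_prob 0 1]_x (f (s * x))%:E)%E.
Proof.
move=> s0 cf.
have c0 : continuous (fun _ : R => 0 : R) by move=> x; exact: cvg_cst.
have cp : continuous (fun x : R => Num.max (f x) 0).
  move=> x; have cfx : {for x, continuous f} by exact: cf.
  exact: (continuous_max cfx (c0 x)).
have cn : continuous (fun x : R => Num.max (- f x) 0).
  move=> x; have cNx : {for x, continuous (fun x => - f x)}.
    by move: (cf x) => cfx; exact: cvgN cfx.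
  exact: (continuous_max cNx (c0 x)).
have Ep : (\int[normal_prob 0 s]_x ((EFin \o f)^\+ x) =
    \int[normal_prob 0 1]_x ((fun x => (f (s * x))%:E)^\+ x))%E.
  transitivity (\int[normal_prob 0 s]_x (Num.max (f x) 0)%:E)%E.
    by apply: eq_integral => x _; rewrite funeposE -EFin_max.
  rewrite (ge0_normal_prob_scale s0 cp) => [|x]; last by rewrite le_max lexx orbT.
  by apply: eq_integral => x _; rewrite funeposE -EFin_max.
have En : (\int[normal_prob 0 s]_x ((EFin \o f)^\- x) =
    \int[normal_prob 0 1]_x ((fun x => (f (s * x))%:E)^\- x))%E.
  transitivity (\int[normal_prob 0 s]_x (Num.max (- f x) 0)%:E)%E.
    by apply: eq_integral => x _; rewrite funenegE -EFinN -EFin_max.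
  rewrite (ge0_normal_prob_scale s0 cn) => [|x]; last by rewrite le_max lexx orbT.
  by apply: eq_integral => x _; rewrite funenegE -EFinN -EFin_max.
rewrite (integralE (normal_prob 0 s)) Ep En.
by rewrite -(integralE (normal_prob 0 1)).
Qed.

Let g (x : R) := x ^+ 2 * gauss_fun x.

Let cg : continuous g.
Proof.
by move=> x; apply: cvgM; [exact: exprn_continuous|exact: continuous_gauss_fun].
Qed.

Let g0 x : 0 <= g x.
Proof. by rewrite mulr_ge0 ?sqr_ge0 // gauss_fun_ge0. Qed.

(** Integration by parts in disguise: integrating this derivative over [0, n] reduces the integral
    of x^2 exp(-x^2) to the known one of exp(-x^2), with a boundary term that vanishes. *)
Let dxg (x : R) : is_derive x 1 (fun x => x * gauss_fun x) (gauss_fun x - 2 * g x).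
Proof.
have dgf : is_derive x 1 (@gauss_fun R) (gauss_fun x * (- (2 * x))).
  have dsq : is_derive x (1:R) (fun x : R => - x ^+ 2) (- (2 * x)).
    have h := is_derive1M (is_derive_id x 1) (is_derive_id x 1).
    rewrite (_ : (fun y : R => - y ^+ 2) = (fun y => -1 * (y * y))).
      by apply: is_derive1_eq (is_derive1Z (-1) h) _; ring.
    by apply/funext => y; rewrite mulN1r expr2.
  have dex := is_derive_expR (- x ^+ 2).
  exact: (@is_derive1_comp _ expR (fun y => - y ^+ 2) _ _ _ dex dsq).
apply: is_derive1_eq (is_derive1M (is_derive_id x 1) dgf) _.
by rewrite /g; ring.
Qed.

Let int_gauss n : (0 < n)%N ->
  \int[mu]_(x in `[0, n%:R]) gauss_fun x - 2 * \int[mu]_(x in `[0, n%:R]) g x =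
  n%:R * gauss_fun (n%:R : R).
Proof.
move=> n0; have n0R : 0 < n%:R :> R by rewrite ltr0n.
have ii f : continuous f -> mu.-integrable `[0, n%:R] (EFin \o f).
  move=> cf; apply: continuous_compact_integrable; first exact: segment_compact.
  exact: continuous_subspaceT.
have c2 : continuous (fun x => 2 * g x).
  by move=> x; apply: cvgM; [exact: cvg_cst|exact: cg].
have cgf := @continuous_gauss_fun R.
have cd : continuous (fun x => gauss_fun x - 2 * g x).
  by move=> x; apply: cvgB; [exact: cgf|exact: c2].
rewrite -RintegralZl //; last exact: ii.
rewrite -RintegralB //; [|exact: ii|exact: ii].
rewrite /Rintegral (@continuous_FTC2 _ _ (fun x => x * gauss_fun x)) //=.
- by rewrite mul0r subr0.
- exact: continuous_subspaceT.
- have cxg : continuous (fun x : R => x * gauss_fun x).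
    by move=> x; apply: cvgM; [exact: cvg_id|exact: cgf].
  split.
  + by move=> x _; have [] := dxg x.
  + by apply: cvg_at_right_filter; exact: cxg.
  + by apply: cvg_at_left_filter; exact: cxg.
- by move=> x _; rewrite derive1E; have [_ ->] := dxg x.
Qed.

Let cvg_ngauss : (fun n => n%:R * gauss_fun (n%:R : R)) @ \oo --> (0 : R).
Proof.
apply: (@squeeze_cvgr _ _ _ _ (cst 0) (fun n => 2 * n.+1%:R^-1)).
- near=> n; rewrite mulr_ge0 ?gauss_fun_ge0 //=.
  (* From 1 + n^2 <= exp(n^2), the boundary term n exp(-n^2) is at most n / (1 + n^2), hence at most
     2 / (n + 1). *)
  have e1 := expR_ge1Dx ((n%:R : R) ^+ 2).
  have n1 : 0 < (n.+1%:R : R) by rewrite ltr0n.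
  rewrite ler_pdivlMr // /gauss_fun expRN mulrAC ler_pdivrMr ?expR_gt0 //.
  apply: le_trans (_ : 2 * (1 + n%:R ^+ 2) <= _); last by rewrite ler_pM2l.
  by rewrite -natr1; have := sqr_ge0 (n%:R - 1 : R); rewrite expr2 expr2; nra.
- exact: cvg_cst.
- rewrite -[X in _ --> X](mulr0 2); apply: cvgM; first exact: cvg_cst.
  exact: cvg_harmonic.
Unshelve. all: by end_near. Qed.

Let int_g : (\int[mu]_(x in `[0%R, +oo[) (g x)%:E = (Num.sqrt pi / 4)%:E)%E.
Proof.
have mg : measurable_fun setT g by exact: continuous_measurable_fun.
have c1 := @ge0_cvgn_integral R mu _ (@gauss_fun_ge0 R) (@measurable_gauss_fun R).
have c2 := @ge0_cvgn_integral R mu _ g0 mg.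
rewrite integral0y_gauss in c1.
have {}c1 := fine_cvg c1.
apply: (cvg_unique _ c2) => //.
have ii n : mu.-integrable `[0, n%:R] (EFin \o g).
  apply: continuous_compact_integrable; first exact: segment_compact.
  exact: continuous_subspaceT.
have E n : (0 < n)%N -> (\int[mu]_(x in `[0%R, n%:R]) (g x)%:E)%E =
  ((\int[mu]_(x in `[0%R, n%:R]) gauss_fun x - n%:R * gauss_fun (n%:R : R)) / 2)%:E.
  move=> n0; rewrite -int_gauss // opprB addrC subrK mulrAC divff // mul1r.
  by rewrite /Rintegral fineK //; apply: integrable_fin_num => //; exact: ii.
apply: cvg_trans (_ : ((\int[mu]_(x in `[0%R, n%:R]) gauss_fun x -
   n%:R * gauss_fun (n%:R : R)) / 2)%:E @[n --> \oo] --> _).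
  by apply: near_eq_cvg; exists 1%N => // n /= n1; rewrite E.
apply: cvg_EFin; first exact: nearW.
have -> : Num.sqrt pi / 4 = (Num.sqrt pi / 2 - 0) / 2 :> R by field.
apply: cvgM; last exact: cvg_cst.
by apply: cvgB; [exact: c1|exact: cvg_ngauss].
Qed.

Let int_gT : (\int[mu]_x (g x)%:E = (Num.sqrt pi / 2)%:E)%E.
Proof.
rewrite ge0_symfun_integralT //.
- rewrite (_ : [set x | _] = `[0, +oo[%classic); last first.
    by apply/seteqP; split => x/=; rewrite in_itv/= andbT.
  by rewrite int_g -EFinM; congr EFin; field.
- by move=> x; rewrite /g /gauss_fun /= sqrrN.
Qed.

Lemma integral_normal_prob_sqr :
  (\int[normal_prob 0 1]_x ((x : R) ^+ 2)%:E = 1%:E)%E.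
Proof.
(* With variance 1/2 the density is exp(-x^2) / sqrt pi, so the integral is the one just computed;
   scaling then transfers it to variance 1. *)
pose s : R := Num.sqrt (1 / 2).
have s0 : 0 < s by rewrite sqrtr_gt0; lra.
have ss : s ^+ 2 = 1 / 2 by rewrite sqr_sqrtr //; lra.
have csq : continuous (fun x : R => x ^+ 2) by exact: exprn_continuous.
have msq : measurable_fun setT (fun x : R => (x ^+ 2)%:E).
  by apply/measurable_EFinP; exact: continuous_measurable_fun.
have sq0 x : (0%:E <= (x ^+ 2 : R)%:E)%E by rewrite lee_fin sqr_ge0.
have h1 : (\int[normal_prob 0 s]_x (x ^+ 2)%:E = (1 / 2)%:E)%E.
  rewrite ge0_integral_normal_prob //.
  have -> : (1 / 2)%:E = ((Num.sqrt pi)^-1%:E * (\int[mu]_x (g x)%:E))%E.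
    rewrite int_gT -EFinM; congr EFin.
    by rewrite mulrA mulVf // gt_eqF // sqrtr_gt0 pi_gt0.
  have mgE : measurable_fun setT (fun x => (g x)%:E).
    by apply/measurable_EFinP; exact: continuous_measurable_fun.
  have gE0 (x : R) : setT x -> (0%:E <= (g x)%:E)%E by rewrite lee_fin.
  have c0 : (0%:E <= (Num.sqrt (pi : R))^-1%:E)%E by rewrite lee_fin invr_ge0.
  rewrite -ge0_integralZl //.
  apply: eq_integral => x _; rewrite -!EFinM; congr EFin.
  rewrite normal_pdfE ?gt_eqF // /normal_fun subr0 /normal_peak ss.
  have -> : 1 / 2 * pi *+ 2 = pi :> R by rewrite -mulr_natr; field.
  have -> : - x ^+ 2 / ((1 / 2) *+ 2) = - x ^+ 2 by rewrite -mulr_natr; field.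
  by rewrite /g /gauss_fun; ring.
rewrite normal_prob_scale // in h1.
have h2 : (\int[normal_prob 0 1]_x ((s * x) ^+ 2)%:E =
    (1 / 2)%:E * \int[normal_prob 0 1]_x (x ^+ 2)%:E)%E.
  have c0 : (0%:E <= (1 / 2 : R)%:E)%E by rewrite lee_fin; lra.
  rewrite -ge0_integralZl //.
  by apply: eq_integral => x _; rewrite exprMn ss EFinM.
rewrite h2 in h1.
have : (2%:E * ((1 / 2)%:E * \int[normal_prob 0 1]_x ((x : R) ^+ 2)%:E) =
    2%:E * (1 / 2)%:E)%E by rewrite h1.
by rewrite muleA -!EFinM mul1r divff // mul1e.
Qed.

Lemma normal_prob_L1_sqr : (normal_prob (0 : R) 1).-L1 (fun x => x ^+ 2).
Proof.
have msq : measurable_fun setT (fun x : R => x ^+ 2).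
  by apply: continuous_measurable_fun; exact: exprn_continuous.
apply/integrableP; split; first exact/measurable_EFinP.
under eq_integral do rewrite /= ger0_norm ?sqr_ge0 //.
by rewrite integral_normal_prob_sqr ltry.
Qed.

Lemma normal_prob_L1_id : (normal_prob (0 : R) 1).-L1 id.
Proof.
apply: (@L1_le _ _ R (normal_prob 0 1) id (fun x => 1 + x ^+ 2)).
- exact: measurable_id.
- move=> x; have := sqr_ge0 (`|x| - 1); rewrite sqrrB1 real_normK ?num_real //.
  by have := normr_ge0 x; lra.
- by apply: L1_add normal_prob_L1_sqr; exact: L1_cst.
Qed.

End Gaussian.

(** * Taylor expansion and smoothing of Lipschitz functions *)

Section Taylor.
Context (R : realType).
Implicit Types (f g : R -> R).

Lemma is_derive_continuous f (df : R -> R) :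
  (forall u : R, is_derive u 1 f (df u)) -> continuous f.
Proof.
move=> dff u; have [h _] := dff u.
by apply: differentiable_continuous; apply/derivable1_diffP.
Qed.

Lemma mean_value f (df : R -> R) (x y : R) : (forall u : R, is_derive u 1 f (df u)) ->
  exists2 c, `|c - x| <= `|y - x| & f y - f x = df c * (y - x).
Proof.
move=> dff.
have cf := is_derive_continuous dff.
have [xy|yx] := leP x y.
  have [c cxy e] := MVT_segment xy (fun u _ => dff u) (continuous_subspaceT cf).
  exists c => //; move: cxy; rewrite in_itv /= => /andP[h1 h2].
  by rewrite !ger0_norm; lra.
have [c cxy e] := MVT_segment (ltW yx) (fun u _ => dff u) (continuous_subspaceT cf).
exists c; last by rewrite -opprB e; ring.
move: cxy; rewrite in_itv /= => /andP[h1 h2].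
by rewrite !ler0_norm; lra.
Qed.

Lemma derive_lipschitz f (df : R -> R) (C : R) :
  (forall u : R, is_derive u 1 f (df u)) -> (forall u, `|df u| <= C) ->
  forall x y, `|f x - f y| <= C * `|x - y|.
Proof.
move=> dff dC x y; have [c _ ->] := mean_value y x dff.
by rewrite normrM ler_wpM2r.
Qed.

(** The remainder is phi y - phi 0, where phi' = psi - psi 0 and psi' is the increment of [g2] from
    x. Two mean value steps leave only the oscillation of [g2] within distance |y| of x. *)
Lemma taylor2 g (g1 g2 : R -> R) (x y C : R) :
  (forall u : R, is_derive u 1 g (g1 u)) -> (forall u : R, is_derive u 1 g1 (g2 u)) ->
  (forall v, `|v| <= `|y| -> `|g2 (x + v) - g2 x| <= C) ->
  `|g (x + y) - g x - g1 x * y - g2 x * (y ^+ 2 / 2)| <= C * y ^+ 2.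
Proof.
move=> dg dg1 hC.
have did (a u : R) : is_derive u 1 (fun v : R => a * v) a.
  exact: is_derive1_eq (is_derive1Z a (is_derive_id u 1)) (mulr1 a).
pose psi u := g1 (x + u) - g2 x * u.
have dpsi (u : R) : is_derive u 1 psi (g2 (x + u) - g2 x).
  by apply: is_derive1B (did _ _); apply: is_derive1_shift.
pose phi u := g (x + u) - (g1 x * u + g2 x / 2 * (u * u)).
have dphi (u : R) : is_derive u 1 phi (psi u - psi 0).
  have dsq := is_derive1M (is_derive_id u 1) (is_derive_id u 1).
  have := is_derive1B (is_derive1_shift (dg (x + u)))
    (is_derive1D (did (g1 x) u) (is_derive1Z (g2 x / 2) dsq)).
  by move/is_derive1_eq; apply; rewrite /psi addr0; field.
have [c cy e] := mean_value 0 y dphi; rewrite !subr0 in cy.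
have -> : g (x + y) - g x - g1 x * y - g2 x * (y ^+ 2 / 2) = phi y - phi 0.
  by rewrite /phi addr0; field.
rewrite e subr0.
have [c' cc' ->] := mean_value 0 c dpsi; rewrite !subr0 in cc' *.
rewrite !normrM -(real_normK (num_real y)) expr2 mulrA.
apply: ler_wpM2r => //; apply: ler_pM => //.
by apply: hC; exact: le_trans cc' cy.
Qed.

Lemma lipschitz_continuous f (L : R) :
  (forall x y, `|f x - f y| <= L * `|x - y|) -> continuous f.
Proof.
move=> fL x; have L0 : 0 <= L.
  by move: (fL 0 1); rewrite sub0r normrN normr1 mulr1; exact: le_trans.
apply/cvgrPdist_le => e e0; near=> y; apply: (le_trans (fL _ _)).
have : `|x - y| <= e / (L + 1).
  near: y; apply: (@cvgr_dist_le _ _ _ (nbhs x)); first exact: cvg_id.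
  by rewrite divr_gt0 //; lra.
rewrite ler_pdivlMr; last by lra.
by have := normr_ge0 (x - y); nra.
Unshelve. all: by end_near. Qed.

Lemma continuous_primitive f : continuous f ->
  exists F : R -> R, forall x : R, is_derive x 1 F (f x).
Proof.
move=> cf; pose mu := @lebesgue_measure R.
have ii a b : mu.-integrable `[a, b] (EFin \o f).
  apply: continuous_compact_integrable; first exact: segment_compact.
  exact: continuous_subspaceT.
pose G a x := \int[mu]_(t in `[a, x]) f t.
(* An integral over an interval with reversed endpoints is 0, so this is the signed integral from 0
   to x. *)
pose F x := G 0 x - G x 0.
(* The base point lies to the left of both x and 0; near x, [F] is then [G a] minus a constant, to
   which the fundamental theorem of calculus applies. *)
exists F => x; pose a := Num.min x 0 - 1.
have [ax a0] : a < x /\ a < 0.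
  have h1 : Num.min x 0 <= x by rewrite ge_min lexx.
  have h2 : Num.min x 0 <= 0 by rewrite ge_min lexx orbT.
  by rewrite /a; split; lra.
have split3 b c : a < b -> b <= c -> G a c - G a b = G b c.
  move=> ab bc; rewrite /G Rintegral_itvB //.
  - by rewrite Rintegral_itv_obnd_cbnd //; apply: integrableS (ii b c) => //;
      exact: subset_itv_oc_cc.
  - by rewrite bnd_simp ltW.
have G0 b c : c < b -> G b c = 0.
  by move=> cb; rewrite /G set_itv_ge ?bnd_simp -?ltNge // Rintegral_set0.
have Gxx b : G b b = 0 by rewrite /G set_itv1 Rintegral_set1.
have FE y : a < y -> F y = G a y - G a 0.
  move=> ay; rewrite /F; case: (ltgtP 0 y) => [y0|y0|<-].
  - by rewrite [G y 0]G0 // subr0 split3 // ltW.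
  - by rewrite [G 0 y]G0 // sub0r -split3 ?(ltW y0) // opprB.
  - by rewrite Gxx !subrr.
have [dG dGE] : derivable (G a) x 1 /\ ((G a)^`())%classic x = f x.
  have xx1 : x < x + 1 by rewrite ltrDl.
  exact: continuous_FTC1_closed xx1 (ii a (x + 1)) ax (cf x).
have iG : is_derive x 1 (fun y => G a y - G a 0) (f x).
  rewrite -[f x]subr0; apply: is_derive1B.
  by apply: DeriveDef => //; rewrite -derive1E.
apply: near_eq_is_derive iG.
near=> y; rewrite FE //.
near: y; exact: lt_nbhsr.
Unshelve. all: by end_near. Qed.

(** The Lipschitz constants serve only for integrability and stay existential; the error depends on
    [C] alone, which has to survive iteration. The factor min(|y|, 1) is what makes a second moment
    suffice in Lindeberg's method. *)
Record taylor_class (C : R) (g g1 g2 : R -> R) : Prop := {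
  tc_lip : exists L, forall x y, `|g x - g y| <= L * `|x - y| ;
  tc_lip1 : exists L, forall x y, `|g1 x - g1 y| <= L * `|x - y| ;
  tc_lip2 : exists L, forall x y, `|g2 x - g2 y| <= L * `|x - y| ;
  tc_taylor : forall x y, `|g (x + y) - g x - g1 x * y - g2 x * (y ^+ 2 / 2)|
    <= C * (Num.min `|y| 1 * y ^+ 2) }.

(** [f] is averaged twice over windows of length h, written as the second difference of a second
    primitive [q]; differentiation turns it into the second differences of [p] and of [f]. In the
    Taylor constant, 4 L / h^2 is the Lipschitz constant of [D2 f] and serves for |y| <= 1, while 4
    L / h is twice its uniform bound and serves for larger y. *)
Lemma smoothing f (L h : R) : 0 <= L -> 0 < h ->
  (forall x y, `|f x - f y| <= L * `|x - y|) ->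
  exists g g1 g2, taylor_class (4 * L / h ^+ 2 + 4 * L / h) g g1 g2 /\
    forall x, `|g x - f x| <= 10 * L * h.
Proof.
move=> L0 h0 fL.
have [p dp] := continuous_primitive (lipschitz_continuous fL).
have cp := is_derive_continuous dp.
have [q dq] := continuous_primitive cp.
pose D2 (u : R -> R) x := (h ^+ 2)^-1 * (u (2 * h + x) - 2 * u (h + x) + u x).
have dD2 (u du : R -> R) (x : R) : (forall y : R, is_derive y 1 u (du y)) ->
    is_derive x 1 (D2 u) (D2 du x).
  move=> duu; apply: is_derive1Z; apply: is_derive1D => //.
  apply: is_derive1B; first exact: is_derive1_shift.
  by apply: is_derive1Z; exact: is_derive1_shift.
have h2 : 0 < h ^+ 2 by rewrite exprn_gt0.
have ih2 : 0 <= (h ^+ 2)^-1 by rewrite invr_ge0 ltW.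
have D2norm u x : `|D2 u x| = `|u (2 * h + x) - 2 * u (h + x) + u x| / h ^+ 2.
  by rewrite /D2 normrM ger0_norm // mulrC.
have fL2 x y : `|D2 f x - D2 f y| <= (4 * L / h ^+ 2) * `|x - y|.
  have -> : D2 f x - D2 f y = (h ^+ 2)^-1 * ((f (2 * h + x) - f (2 * h + y)) -
      2 * (f (h + x) - f (h + y)) + (f x - f y)) by rewrite /D2; ring.
  have -> : 4 * L / h ^+ 2 * `|x - y| = (h ^+ 2)^-1 * (4 * L * `|x - y|) by ring.
  rewrite normrM ger0_norm // ler_wpM2l //.
  have a1 := fL (2 * h + x) (2 * h + y); have a2 := fL (h + x) (h + y).
  have a3 := fL x y; have E c : c + x - (c + y) = x - y by ring.
  rewrite !E in a1 a2.
  move: a1 a2 a3; rewrite !ler_norml => /andP[a1 b1] /andP[a2 b2] /andP[a3 b3].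
  by apply/andP; split; lra.
have fB x : `|D2 f x| <= 2 * L / h.
  have e0 : 2 * L / h * h ^+ 2 = 2 * L * h by field; rewrite gt_eqF.
  rewrite D2norm ler_pdivrMr // e0.
  have a1 := fL (2 * h + x) (h + x); have a2 := fL (h + x) x.
  have e1 : 2 * h + x - (h + x) = h by ring.
  have e2 : h + x - x = h by ring.
  rewrite e1 e2 !(gtr0_norm h0) in a1 a2.
  move: a1 a2; rewrite !ler_norml => /andP[a1 b1] /andP[a2 b2].
  by apply/andP; split; lra.
have pB x : `|D2 p x| <= L.
  rewrite D2norm ler_pdivrMr //.
  have dk (u : R) : is_derive u 1 (fun u => p (h + u) - p u) (f (h + u) - f u).
    by apply: is_derive1B => //; exact: is_derive1_shift.
  have [c _ e] := mean_value x (h + x) dk.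
  have -> : p (2 * h + x) - 2 * p (h + x) + p x =
      p (h + (h + x)) - p (h + x) - (p (h + x) - p x).
    have -> : h + (h + x) = 2 * h + x by ring.
    by ring.
  rewrite e addrK normrM (gtr0_norm h0) expr2 mulrA ler_wpM2r ?(ltW h0) //.
  by have := fL (h + c) c; rewrite addrK (gtr0_norm h0).
exists (D2 q), (D2 p), (D2 f); split; last first.
  move=> x.
  have T (y : R) : 0 <= y -> `|q (x + y) - q x - p x * y - f x * (y ^+ 2 / 2)| <=
      L * y * y ^+ 2.
    move=> y0; apply: (taylor2 dq dp) => v vy; apply: (le_trans (fL _ _)).
    have -> : x + v - x = v by ring.
    by rewrite ler_wpM2l // (le_trans vy) // ger0_norm.
  have T1 := T h (ltW h0).
  have T2 : `|q (x + 2 * h) - q x - p x * (2 * h) - f x * ((2 * h) ^+ 2 / 2)| <=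
      L * (2 * h) * (2 * h) ^+ 2 by apply: T; lra.
  (* The second difference annihilates constant and linear terms and yields f x h^2 on the quadratic
     one, so two Taylor errors remain, bounded by 8 L h^3 and 2 L h^3. *)
  have -> : D2 q x - f x = (h ^+ 2)^-1 *
      ((q (x + 2 * h) - q x - p x * (2 * h) - f x * ((2 * h) ^+ 2 / 2)) -
       2 * (q (x + h) - q x - p x * h - f x * (h ^+ 2 / 2))).
    by rewrite /D2 [2 * h + x]addrC [h + x]addrC; field; rewrite gt_eqF.
  rewrite normrM ger0_norm // mulrC ler_pdivrMr //.
  have -> : 10 * L * h * h ^+ 2 =
    L * (2 * h) * (2 * h) ^+ 2 + 2 * (L * h * h ^+ 2) by ring.
  apply: (le_trans (ler_normB _ _)); apply: lerD => //.
  by rewrite normrM ger0_norm // ler_wpM2l.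
split.
- by exists L; exact: derive_lipschitz (fun u => dD2 _ _ u dq) pB.
- by exists (2 * L / h); exact: derive_lipschitz (fun u => dD2 _ _ u dp) fB.
- by exists (4 * L / h ^+ 2).
- move=> x y; rewrite [leRHS]mulrA.
  apply: (taylor2 (fun u => dD2 _ _ u dq) (fun u => dD2 _ _ u dp)) => v vy.
  have k1 : 0 <= 4 * L / h ^+ 2 by rewrite mulr_ge0 // mulr_ge0.
  have k2 : 0 <= 4 * L / h by rewrite mulr_ge0 ?invr_ge0 ?(ltW h0) // mulr_ge0.
  have [y1|y1] := leP `|y| 1.
    apply: (le_trans (fL2 _ _)); have -> : x + v - x = v by ring.
    apply: (@le_trans _ _ (4 * L / h ^+ 2 * `|y|)); first by rewrite ler_wpM2l.
    by rewrite ler_wpM2r // lerDl.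
  rewrite mulr1; apply: (le_trans (ler_normB _ _)).
  have := fB (x + v); have := fB x.
  have -> : 4 * L / h = 2 * (2 * L / h) by ring.
  by lra.
Qed.

End Taylor.

(** The transition operator of a random walk with steps c X; its n-th iterate at 0 is the mean of g
    at c times the sum of n independent copies of X ([mean_sum_iter]). *)
Definition shift_mean d (T : measurableType d) (R : realType)
  (P : probability T R) (X : T -> R) (c : R) (g : R -> R) (x : R) : R :=
  \int[P]_w g (x + c * X w).

Definition lips (R : realType) (L : R) (f : R -> R) :=
  forall x y, `|f x - f y| <= L * `|x - y|.

Section ShiftMean.
Context d (T : measurableType d) (R : realType) (P : probability T R).
Variables (X : T -> R) (c : R).
Hypothesis iX : P.-L1 X.

Lemma lips_ge0 L (f : R -> R) : lips L f -> 0 <= L.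
Proof.
by move=> /(_ 0 1); rewrite sub0r normrN normr1 mulr1; exact: le_trans.
Qed.

Lemma lips_L1 L f (Y : T -> R) : lips L f -> P.-L1 Y -> P.-L1 (fun w => f (Y w)).
Proof.
move=> fL iY; apply: (@L1_le _ _ _ _ _ (fun w => `|f 0| + L * `|Y w|)).
- have mf := continuous_measurable_fun (lipschitz_continuous fL).
  exact: (measurableT_comp mf (L1_measurable iY)).
- move=> w; have := fL (Y w) 0; rewrite subr0.
  by have := ler_normD (f (Y w) - f 0) (f 0); rewrite subrK; lra.
- by apply: L1_add (L1_cst _ _) _; apply: L1_scale; exact: L1_norm.
Qed.

Lemma shift_L1 L f x : lips L f -> P.-L1 (fun w => f (x + c * X w)).
Proof.
move=> fL; apply: (lips_L1 (f := f) fL).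
by apply: L1_add (L1_cst _ _) _; exact: L1_scale.
Qed.

Lemma shift_mean_lips L f : lips L f -> lips L (shift_mean P X c f).
Proof.
move=> fL x y; rewrite /shift_mean -meanB; [|exact: shift_L1 fL ..].
apply: mean_norm_le => [|w]; first by apply: L1_sub; exact: shift_L1 fL.
by apply: (le_trans (fL _ _)); rewrite (_ : _ - _ = x - y) //; ring.
Qed.

Lemma shift_mean_dist L L' f g e : lips L f -> lips L' g ->
  (forall x, `|f x - g x| <= e) ->
  forall x, `|shift_mean P X c f x - shift_mean P X c g x| <= e.
Proof.
move=> fL gL fg x; rewrite /shift_mean.
rewrite -meanB; [|exact: shift_L1 fL|exact: shift_L1 gL].
apply: mean_norm_le => [|w //].
by apply: L1_sub; [exact: shift_L1 fL|exact: shift_L1 gL].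
Qed.

(** The Taylor remainder is linear in the triple of functions, so averaging translates keeps the
    same [C]. *)
Lemma shift_mean_taylor_class C g g1 g2 : taylor_class C g g1 g2 ->
  taylor_class C (shift_mean P X c g) (shift_mean P X c g1) (shift_mean P X c g2).
Proof.
move=> [[L0 h0] [L1 h1] [L2 h2] ht]; split.
- by exists L0; exact: shift_mean_lips.
- by exists L1; exact: shift_mean_lips.
- by exists L2; exact: shift_mean_lips.
move=> x y; rewrite /shift_mean.
have i0 z := shift_L1 z h0; have i1 z := shift_L1 z h1.
have i2 z := shift_L1 z h2.
have i1y := L1_scale y (i1 x); have i2y := L1_scale (y ^+ 2 / 2) (i2 x).
have -> : \int[P]_w g (x + y + c * X w) - \int[P]_w g (x + c * X w) -
   \int[P]_w g1 (x + c * X w) * y - \int[P]_w g2 (x + c * X w) * (y ^+ 2 / 2) =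
   \int[P]_w (g (x + y + c * X w) - g (x + c * X w) - y * g1 (x + c * X w)
     - y ^+ 2 / 2 * g2 (x + c * X w)).
  rewrite meanB //; last by apply: L1_sub => //; exact: L1_sub.
  rewrite meanB //; last exact: L1_sub.
  by rewrite meanB // !meanZ // [y * _]mulrC [y ^+ 2 / 2 * _]mulrC.
apply: mean_norm_le.
  by do 2 (apply: L1_sub => //); exact: L1_sub.
move=> w; have := ht (x + c * X w) y.
have -> : x + c * X w + y = x + y + c * X w by ring.
by rewrite [g1 _ * y]mulrC [g2 _ * _]mulrC.
Qed.

Hypothesis iX2 : P.-L1 (fun w => X w ^+ 2).

(** A truncated third moment, carrying the remainder of one replacement; it vanishes along a = 1 /
    sqrt n by dominated convergence with majorant X^2. *)
Definition lindeberg (a : R) := \int[P]_w (Num.min `|a * X w| 1 * X w ^+ 2).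

Lemma lindeberg_L1 a : P.-L1 (fun w => Num.min `|a * X w| 1 * X w ^+ 2).
Proof.
have mX := L1_measurable iX; apply: L1_le iX2.
  apply: measurable_funM; last exact: measurable_funX.
  apply: measurable_minr => //; apply: measurableT_comp => //.
  exact: measurable_funM.
move=> w; rewrite normrM [X in _ * X]ger0_norm ?sqr_ge0 //.
by rewrite ler_piMl ?sqr_ge0 // ger0_norm ?ge_min ?lexx ?orbT.
Qed.

(** The first-order term vanishes by centering, so up to the Lindeberg error one step acts only
    through the second moment of X: centered laws with equal second moments cannot be told apart at
    this order. *)
Lemma shift_mean_taylor C g g1 g2 x : taylor_class C g g1 g2 ->
  \int[P]_w X w = 0 ->
  `|shift_mean P X c g x - g x - g2 x * (c ^+ 2 / 2 * \int[P]_w X w ^+ 2)|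
    <= C * (c ^+ 2 * lindeberg c).
Proof.
move=> tc EX; have [[L0 h0] _ _ ht] := tc.
have i0 := shift_L1 x h0.
have i1 := L1_scale (g1 x * c) iX; have i2 := L1_scale (g2 x * (c ^+ 2 / 2)) iX2.
have -> : shift_mean P X c g x - g x - g2 x * (c ^+ 2 / 2 * \int[P]_w X w ^+ 2) =
  \int[P]_w (g (x + c * X w) - g x - g1 x * c * X w - g2 x * (c ^+ 2 / 2) * X w ^+ 2).
  have i3 := L1_sub i0 (L1_cst P (g x)).
  rewrite meanB //; last exact: L1_sub.
  rewrite meanB // meanB //; last exact: L1_cst.
  by rewrite !meanZ // EX mulr0 subr0 mean_cst mulrA.
have il := L1_scale (C * c ^+ 2) (lindeberg_L1 c).
rewrite [leRHS]mulrA -meanZ; last exact: lindeberg_L1.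
have ii : P.-L1 (fun w => g (x + c * X w) - g x - g1 x * c * X w
    - g2 x * (c ^+ 2 / 2) * X w ^+ 2).
  by do 2 (apply: L1_sub => //); apply: L1_sub => //; exact: L1_cst.
apply: (le_trans (le_mean_norm ii)); apply: le_mean => //; first exact: L1_norm.
move=> w; have := ht x (c * X w).
have -> : g1 x * (c * X w) = g1 x * c * X w by ring.
have -> : g2 x * ((c * X w) ^+ 2 / 2) = g2 x * (c ^+ 2 / 2) * X w ^+ 2 by ring.
move/le_trans; apply.
by rewrite exprMn le_eqVlt; apply/orP; left; apply/eqP; ring.
Qed.

Lemma lindeberg_cvg0 : lindeberg (Num.sqrt n%:R)^-1 @[n --> \oo] --> 0.
Proof.
have -> : 0 = \int[P]_w (0 : R) by rewrite mean_cst.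
apply: (mean_dominated (g := fun w => X w ^+ 2)) => //.
- by move=> n; exact: L1_measurable (lindeberg_L1 _).
- move=> n w; rewrite normrM [X in _ * X]ger0_norm ?sqr_ge0 //.
  by rewrite ler_piMl ?sqr_ge0 // ger0_norm ?ge_min ?lexx ?orbT.
move=> w.
have sq0 : (Num.sqrt (n%:R : R))^-1 @[n --> \oo] --> 0.
  apply/gtr0_cvgV0; first by exists 1%N => // n /= n1; rewrite sqrtr_gt0 ltr0n.
  apply/cvgryPge => A; near=> n.
  have [A0|A0] := leP A 0; first by rewrite (le_trans A0) // sqrtr_ge0.
  rewrite -[A]ger0_norm ?(ltW A0) // -sqrtr_sqr ler_sqrt //.
  near: n; apply: nbhs_infty_ger.
apply: (@squeeze_cvgr _ _ _ _ (cst 0)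
  (fun n => (Num.sqrt n%:R)^-1 * (`|X w| * X w ^+ 2))).
- near=> n; rewrite mulr_ge0 ?sqr_ge0 ?le_min ?normr_ge0 ?ler01 //=.
  rewrite [leRHS]mulrA; apply: ler_wpM2r; first exact: sqr_ge0.
  have a0 : 0 <= (Num.sqrt (n%:R : R))^-1 by rewrite invr_ge0 sqrtr_ge0.
  by rewrite ge_min normrM (ger0_norm a0) lexx.
- exact: cvg_cst.
- by rewrite -[X in _ --> X](mul0r (`|X w| * X w ^+ 2)); apply: cvgM => //; exact: cvg_cst.
Unshelve. all: by end_near. Qed.

End ShiftMean.

Section IterShift.
Context (R : realType) d (T : measurableType d) (P : probability T R) (X : T -> R).
Hypothesis iX : P.-L1 X.

Lemma iter_shift_lips L f c n : lips L f -> lips L (iter n (shift_mean P X c) f).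
Proof. by move=> fL; elim: n => // n IH; exact: shift_mean_lips. Qed.

Lemma iter_shift_dist L L' f g c n e : lips L f -> lips L' g ->
  (forall x, `|f x - g x| <= e) ->
  forall x, `|iter n (shift_mean P X c) f x - iter n (shift_mean P X c) g x| <= e.
Proof.
move=> fL gL fg; elim: n => // n IH x.
exact: (shift_mean_dist c iX (iter_shift_lips c n fL) (iter_shift_lips c n gL) IH x).
Qed.

End IterShift.

Section CLT.
Context (R : realType) d (T : measurableType d) (P : probability T R) (X : T -> R).
Context d' (T' : measurableType d') (Q : probability T' R) (Y : T' -> R).
Hypotheses (iX : P.-L1 X) (iX2 : P.-L1 (fun w => X w ^+ 2)).
Hypotheses (iY : Q.-L1 Y) (iY2 : Q.-L1 (fun w => Y w ^+ 2)).
Hypotheses (EX : \int[P]_w X w = 0) (EY : \int[Q]_w Y w = 0).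
Hypothesis EXY : \int[P]_w X w ^+ 2 = \int[Q]_w Y w ^+ 2.

Lemma iter_shift_taylor C g g1 g2 c n : taylor_class C g g1 g2 ->
  exists h1 h2, taylor_class C (iter n (shift_mean Q Y c) g) h1 h2.
Proof.
move=> tc; elim: n => [|n [h1 [h2 IH]]]; first by exists g1, g2.
by do 2 eexists; apply: shift_mean_taylor_class IH.
Qed.

(** Telescoping: [shift_mean P X c] does not increase uniform distances, and on [gQ], which lies in
    the class with the same [C], the steps under P and under Q share their second-order term by
    [EXY]. *)
Lemma iter_shift_compare C g g1 g2 c n : taylor_class C g g1 g2 ->
  forall x, `|iter n (shift_mean P X c) g x - iter n (shift_mean Q Y c) g x| <=
    n%:R * (C * (c ^+ 2 * (lindeberg P X c + lindeberg Q Y c))).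
Proof.
move=> tc; elim: n => [|n IH] x; first by rewrite subrr normr0 mul0r.
have [[L gL] _ _ _] := tc.
have [h1 [h2 tcn]] := iter_shift_taylor c n tc.
set gP := iter n (shift_mean P X c) g; set gQ := iter n (shift_mean Q Y c) g.
have gPL : lips L gP by exact: iter_shift_lips.
have gQL : lips L gQ by exact: iter_shift_lips.
have a1 := shift_mean_dist c iX gPL gQL IH x.
have a2 := shift_mean_taylor c iX iX2 x tcn EX.
have a3 := shift_mean_taylor c iY iY2 x tcn EY.
rewrite -EXY in a3; rewrite -natr1 mulrDl mul1r !mulrDr /=.
rewrite -/gP -/gQ in a1 a2 a3 *.
move: a1 a2 a3; rewrite !mulrDr !ler_norml => /andP[p1 p2] /andP[p3 p4] /andP[p5 p6].
by apply/andP; split; lra.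
Qed.

(** [N] depends on [f] only through [L]. Smoothing at scale h costs 10 L h under each law, and h is
    chosen so that 20 L h <= e / 2. As c^2 = 1 / n, the n replacement errors add up to [C] times the
    two Lindeberg quantities. *)
Lemma lindeberg_clt (L e : R) : 0 <= L -> 0 < e ->
  exists N, forall n f, (N <= n)%N -> lips L f ->
    `|iter n (shift_mean P X (Num.sqrt n%:R)^-1) f 0 -
      iter n (shift_mean Q Y (Num.sqrt n%:R)^-1) f 0| <= e.
Proof.
move=> L0 e0; pose h := e / (40 * L + 40).
have h0 : 0 < h by rewrite divr_gt0 //; lra.
pose C := 4 * L / h ^+ 2 + 4 * L / h.
have C0 : 0 <= C.
  by rewrite addr_ge0 // mulr_ge0 ?invr_ge0 ?exprn_ge0 ?(ltW h0) // mulr_ge0.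
have hL : 20 * L * h <= e / 2.
  rewrite /h mulrA ler_pdivrMr; last by lra.
  by nra.
have cl : lindeberg P X (Num.sqrt n%:R)^-1 + lindeberg Q Y (Num.sqrt n%:R)^-1
    @[n --> \oo] --> (0 : R).
  rewrite -[X in _ --> X](addr0 0).
  by apply: cvgD; exact: lindeberg_cvg0.
have e1 : 0 < e / (2 * C + 2) by rewrite divr_gt0 //; lra.
have /cvgrPdist_le /(_ _ e1) [N _ hN] := cl.
exists N.+1 => n f nN fL.
have n0 : 0 < n%:R :> R by rewrite ltr0n (leq_trans _ nN).
set c := (Num.sqrt n%:R)^-1.
have [g [g1 [g2 [tc gf]]]] := smoothing L0 h0 fL.
have [[Lg gL] _ _ _] := tc.
have a1 := iter_shift_dist iX c n fL gL
  (fun x => etrans (congr1 (fun z => z <= _) (distrC _ _)) (gf x)) 0.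
have a2 := iter_shift_dist iY c n fL gL
  (fun x => etrans (congr1 (fun z => z <= _) (distrC _ _)) (gf x)) 0.
have a3 := iter_shift_compare c n tc 0.
have {}a3 : `|iter n (shift_mean P X c) g 0 - iter n (shift_mean Q Y c) g 0| <=
    C * (lindeberg P X c + lindeberg Q Y c).
  apply: (le_trans a3); rewrite -/C.
  have -> : c ^+ 2 = n%:R^-1 by rewrite /c exprVn sqr_sqrtr // ltW.
  have -> : n%:R * (C * (n%:R^-1 * (lindeberg P X c + lindeberg Q Y c))) =
    (n%:R * n%:R^-1) * (C * (lindeberg P X c + lindeberg Q Y c)) by ring.
  by rewrite divff ?mul1r // gt_eqF.
have := hN n (ltnW nN); rewrite /= sub0r normrN => b.
have {}b : C * (lindeberg P X c + lindeberg Q Y c) <= e / 2.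
  have : lindeberg P X c + lindeberg Q Y c <= e / (2 * C + 2).
    by apply: le_trans b; exact: ler_norm.
  rewrite ler_pdivlMr; last by lra.
  by nra.
move: a1 a2 a3; rewrite !ler_norml => /andP[p1 p2] /andP[p3 p4] /andP[p5 p6].
by apply/andP; split; lra.
Qed.

End CLT.

Section SumTrotter.
Context d (T : measurableType d) (R : realType) (P : probability T R).
Context (I : choiceType) (Z : I -> T -> R).
Hypothesis mZ : forall i, measurable_fun setT (Z i).
Hypothesis iZ : mutually_independent P Z.
Variables (J K : nat -> set I) (X : nat -> T -> R).
Hypothesis JK : forall i, J i `&` K i = set0.
Hypothesis JS : forall i, J i `<=` J i.+1.
Hypothesis KS : forall i, K i `<=` J i.+1.
Hypothesis aX : forall i, adapted Z (K i) (X i).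
Hypothesis iX : forall i, P.-L1 (X i).
Context d' (T' : measurableType d') (P' : probability T' R) (X' : T' -> R).
Hypothesis iX' : P'.-L1 X'.
Hypothesis XX' : forall i L f, lips L f ->
  \int[P]_w f (X i w) = \int[P']_w f (X' w).

(** Integrating out the last summand turns [f] into its shift mean and shortens the sum by one. The
    law of the steps enters only through means of Lipschitz functions, so [X'] may live on another
    space. *)
Lemma mean_sum_iter n L f c x : lips L f ->
  \int[P]_w f (x + c * \sum_(i < n) X i w) = iter n (shift_mean P' X' c) f x.
Proof.
elim: n f => [|n IH] f fL.
  under eq_Rintegral do rewrite big_ord0 mulr0 addr0.
  exact: mean_cst.
pose H (z : nat -> R) := f (x + c * \sum_(i < n.+1) z i).
have L0 := lips_ge0 fL.
have hH : lip1 n.+1 (L * `|c|) H.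
  split; first by rewrite mulr_ge0.
  move=> y z; apply: (le_trans (fL _ _)); rewrite -mulrA ler_wpM2l //.
  rewrite (_ : _ - _ = c * \sum_(i < n.+1) (y i - z i)).
    by rewrite normrM ler_wpM2l // ler_norm_sum.
  by rewrite sumrB; ring.
rewrite -/(H _) (mean_lip1_step mZ iZ JK JS KS aX iX hH).
rewrite iterSr -(IH (shift_mean P' X' c f)); last exact: shift_mean_lips.
apply: eq_Rintegral => w _; rewrite /shift_mean.
rewrite -(XX' n (f := fun y => f (x + c * \sum_(i < n) X i w + c * y)) (L := L * `|c|)).
  apply: eq_Rintegral => v _; rewrite /H big_ord_recr /= /upd eqxx.
  rewrite mulrDr addrA; congr (f (_ + _ * _ + _)).
  by apply: eq_bigr => i _; rewrite ltn_eqF.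
move=> y z; apply: (le_trans (fL _ _)); rewrite -mulrA ler_wpM2l //.
by rewrite -normrM (_ : _ - _ = c * (y - z)) //; ring.
Qed.

End SumTrotter.

(** * Pathwise inequalities *)

Section RunningMax.
Context (R : realType).
Implicit Types x : nat -> R.

(* The maximum of 0, x 1, ..., x n: the value [x 0] is ignored. *)
Fixpoint rmax x n : R := if n is m.+1 then Num.max (rmax x m) (x m.+1) else 0.

Lemma rmax_ge0 x n : 0 <= rmax x n.
Proof. by elim: n => //= n IH; rewrite le_max IH. Qed.

Lemma le_rmax x n k : x 0%N = 0 -> (k <= n)%N -> x k <= rmax x n.
Proof.
move=> x0; elim: n => [|n IH]; first by rewrite leqn0 => /eqP ->; rewrite x0.
rewrite leq_eqVlt => /predU1P[->|kn] /=; first by rewrite le_max lexx orbT.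
by rewrite le_max IH.
Qed.

(* Pathwise form of Doob's L^2 maximal inequality. *)
Lemma rmax_sqr x n : x 0%N = 0 ->
  rmax x n ^+ 2 <=
    4 * x n ^+ 2 - 4 * \sum_(k < n) rmax x k * (x k.+1 - x k).
Proof.
move=> x0; set y := rmax x.
have G : 0 <= y n * x n - y n ^+ 2 / 2 - \sum_(k < n) y k * (x k.+1 - x k).
  elim: n => [|n IH].
    by rewrite big_ord0 x0 /y /= expr2; lra.
  rewrite big_ord_recr /=.
  have -> : y n.+1 = Num.max (y n) (x n.+1) by [].
  have [yx|xy] := leP (x n.+1) (y n); first by lra.
  by have := sqr_ge0 (x n.+1 - y n); rewrite !expr2 in IH *; lra.
have := sqr_ge0 (y n - 2 * x n); move: G; rewrite !expr2.
by lra.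
Qed.

(* Pathwise form of Doob's weak maximal inequality. *)
Lemma rmax_weak x n (lam : R) : x 0%N = 0 -> 0 < lam ->
  lam * (2 * lam <= rmax x n)%R%:R <= Num.max (x n - lam) 0 -
    \sum_(k < n) (2 * lam <= rmax x k)%R%:R * (x k.+1 - x k).
Proof.
move=> x0 lam0; set b := fun k => 2 * lam <= rmax x k.
have [bF bT] : (b n = false -> \sum_(k < n) (b k)%:R * (x k.+1 - x k) = 0) /\
    (b n -> 2 * lam <= x n - \sum_(k < n) (b k)%:R * (x k.+1 - x k)).
  elim: n => [|n [IF IT]].
    rewrite big_ord0; split => //; rewrite /b /= => h.
    by exfalso; lra.
  rewrite big_ord_recr /=; case bn: (b n).
    have bn1 : b n.+1.
      by move: bn; rewrite /b /= le_max => ->.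
    rewrite bn1; split => // _; rewrite mul1r.
    by move: (IT bn); lra.
  rewrite (IF bn) mul0r addr0; split => // ; rewrite subr0.
  by move: bn; rewrite /b /= le_max => ->.
have [m1 m2] : x n - lam <= Num.max (x n - lam) 0 /\ 0 <= Num.max (x n - lam) 0.
  by rewrite !le_max !lexx orbT.
rewrite -/(b n); case bn: (b n).
  by move: (bT bn); rewrite mulr1; lra.
by rewrite (bF bn) mulr0 subr0.
Qed.

End RunningMax.

(** * Linear interpolation and reflection of paths *)

Section Interpolation.
Context (R : realType).
Implicit Types (s : nat -> R) (t : R).

Lemma interpolate_truncn s t : 0 <= t ->
  interpolate s t = s (Num.truncn t) +
    (t - (Num.truncn t)%:R) * (s (Num.truncn t).+1 - s (Num.truncn t)).
Proof.
move=> t0; rewrite /interpolate; set k := Num.truncn t.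
have /andP[kt tk] := truncn_itv t0; rewrite -/k in kt tk.
move: kt; rewrite le_eqVlt => /predU1P[<-|kt]; first by rewrite subrr !mul0r.
have -> // : Num.ceil t = k.+1%:Z.
apply: ceil_def; rewrite -pmulrn (ltW tk) andbT intrD /=.
by rewrite -pmulrn -natr1 addrK.
Qed.

Lemma interpolate_nat s k : interpolate s k%:R = s k.
Proof. by rewrite interpolate_truncn // natrK subrr mul0r addr0. Qed.

(** The cell and the weight depend on t alone, so several sequences can be compared at once. Cells
    are half-open except the last, which is closed at N to keep k < N. *)
Lemma interpolate_conv (N : nat) t : (0 < N)%N -> 0 <= t -> t <= N%:R ->
  exists k theta, [/\ (k < N)%N, k%:R <= t <= k.+1%:R,
    t < k.+1%:R \/ k.+1 = N, 0 <= theta <= 1 &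
    forall s, interpolate s t = (1 - theta) * s k + theta * s k.+1].
Proof.
move=> N0 t0; rewrite le_eqVlt => /predU1P[->|tN].
  exists N.-1, 1; rewrite prednK //; split => //.
  - by rewrite lexx andbT ler_nat leq_pred.
  - by right.
  - by rewrite lexx ler01.
  - by move=> s; rewrite interpolate_nat subrr mul0r mul1r add0r.
have /andP[kt tk] := truncn_itv t0.
exists (Num.truncn t), (t - (Num.truncn t)%:R); split.
- by rewrite truncn_lt_nat.
- by rewrite kt ltW.
- by left.
- by rewrite subr_ge0 kt /=; move: tk; rewrite -natr1; lra.
- by move=> s; rewrite interpolate_truncn //; ring.
Qed.

Lemma interpolate_dist (N : nat) t s (c e : R) : (0 < N)%N -> 0 <= t -> t <= N%:R ->
  (forall k, (k <= N)%N -> `|s k - c| <= e) -> `|interpolate s t - c| <= e.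
Proof.
move=> N0 t0 tN h.
have [k [th [kN _ _ /andP[th0 th1] E]]] := interpolate_conv N0 t0 tN.
have := h _ kN; have := h _ (ltnW kN); rewrite E !ler_norml.
by move=> /andP[a b] /andP[a' b']; apply/andP; split; nra.
Qed.

Lemma interpolate_ge (N : nat) t s (c : R) : (0 < N)%N -> 0 <= t -> t <= N%:R ->
  (forall k, (k <= N)%N -> c <= s k) -> c <= interpolate s t.
Proof.
move=> N0 t0 tN h.
have [k [th [kN _ _ /andP[th0 th1] E]]] := interpolate_conv N0 t0 tN.
by have := h _ kN; have := h _ (ltnW kN); rewrite E; nra.
Qed.

Lemma interpolate_homo (N : nat) s u t : 0 <= u -> u <= t -> t <= N%:R ->
  (forall k, (k < N)%N -> s k <= s k.+1) -> interpolate s u <= interpolate s t.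
Proof.
move=> u0 ut tN h; have t0 := le_trans u0 ut; have uN := le_trans ut tN.
rewrite (interpolateE s u0 uN) (interpolateE s t0 tN) lerD2l.
rewrite [leLHS]big_nat [leRHS]big_nat; apply: ler_sum => k /andP[_ kN].
apply: ler_wpM2l; first by rewrite subr_ge0 h.
rewrite le_min; apply/andP; split; first by rewrite ge_min lexx.
rewrite ge_min; apply/orP; right; rewrite ge_max le_max lexx /= le_max.
by apply/orP; right; lra.
Qed.

End Interpolation.

Section Reflect.
Context (R : realType).
Implicit Types (f g : R -> R).

Lemma reflect_inf f t : {within unitI R, continuous f} -> unitI R t ->
  (forall u, 0 <= u <= t -> inf [set f s | s in `[0, t]] <= f u) /\
  (forall c, (forall u, 0 <= u <= t -> c <= f u) ->
     c <= inf [set f s | s in `[0, t]]).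
Proof.
move=> cf; rewrite /unitI /= in_itv /= => /andP[t0 t1].
have [c _ cP] := @EVT_min _ f 0 1 ler01 cf.
have lb : has_lbound [set f s | s in `[0, t]].
  exists (f c) => _ [s /= st <-]; apply: cP; move: st; rewrite !in_itv /=.
  by move=> /andP[-> st]; rewrite (le_trans st).
split.
- by move=> u ut; apply: ge_inf => //; exists u => //=; rewrite in_itv.
- move=> b hb; apply: lb_le_inf.
    by exists (f 0), 0 => //=; rewrite in_itv /= lexx.
  by move=> _ [s /= + <-]; rewrite in_itv /=; exact: hb.
Qed.

(** The factor 2 arises because the path and its running infimum each move by at most e. *)
Lemma reflect_dist f g (e : R) : {within unitI R, continuous f} ->
  {within unitI R, continuous g} ->
  (forall t, unitI R t -> `|f t - g t| <= e) ->
  forall t, unitI R t -> `|Defs.reflect f t - Defs.reflect g t| <= 2 * e.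
Proof.
move=> cf cg fg t It; rewrite /Defs.reflect.
have [f1 f2] := reflect_inf cf It; have [g1 g2] := reflect_inf cg It.
set F := inf _ in f1 f2 *; set G := inf _ in g1 g2 *.
have Iu u : 0 <= u <= t -> unitI R u.
  move: It; rewrite /unitI /= !in_itv /= => /andP[_ t1] /andP[-> ut] /=.
  exact: le_trans t1.
have h1 : F - e <= G.
  apply: g2 => u ut; have := f1 u ut; have := fg u (Iu u ut).
  by rewrite ler_norml => /andP[a b]; lra.
have h2 : G - e <= F.
  apply: f2 => u ut; have := g1 u ut; have := fg u (Iu u ut).
  by rewrite ler_norml => /andP[a b]; lra.
have := fg t It; rewrite !ler_norml => /andP[a b].
by apply/andP; split; lra.
Qed.

End Reflect.

(** * Pathwise Skorokhod comparison *)

Section WalkComparison.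
Context (R : realType) (x y : nat -> R).
Notation s := (walk x y).

Definition drift n : R := \sum_(k < n) y k * (s k <= 0)%R%:R.
Definition skipped n : R := \sum_(k < n) x k * (s k <= 0)%R%:R.
Definition free_walk n : R := \sum_(k < n) x k.

Lemma walkE n : s n = free_walk n - skipped n + drift n.
Proof.
elim: n => [|n IH].
  by rewrite /free_walk /skipped /drift !big_ord0 /= subrr addr0.
rewrite /free_walk /skipped /drift !big_ord_recr /= -/(free_walk n).
rewrite -/(skipped n) -/(drift n); move: IH => /=; rewrite leNgt.
by case: ifP => _ -> /=; ring.
Qed.

(** j is the last time before n spent in (-oo, 0]; the drift is constant after the jump made there.
    As s j <= 0, the drift at time j is in turn controlled by the free walk. *)
Lemma driftP n : drift n = 0 \/
  exists j, [/\ (j < n)%N, s j <= 0 & drift n = drift j + y j].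
Proof.
elim: n => [|n IH]; first by left; rewrite /drift big_ord0.
have -> : drift n.+1 = drift n + y n * (s n <= 0)%R%:R.
  by rewrite /drift big_ord_recr.
have [sn|sn] := boolP (s n <= 0).
  by right; exists n; rewrite mulr1.
rewrite mulr0 addr0; case: IH => [->|[j [jn sj e]]]; first by left.
by right; exists j; split => //; exact: leqW.
Qed.

Variables (n : nat) (A De E : R).
Hypotheses (n0 : (0 < n)%N) (A0 : 0 <= A) (E0 : 0 <= E) (De0 : 0 <= De).
Hypothesis y0 : forall k, (k < n)%N -> 0 <= y k.
Hypothesis xA : forall k, (k < n)%N -> `|x k| <= A.
Hypothesis yE : forall k, (k < n)%N -> s k <= 0 -> y k <= E.
Hypothesis DD : forall k, (k <= n)%N -> `|skipped k| <= De.

(** The walk can enter the negative half-line only by one step [x k] from a positive position, and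
    there it can only move up. *)
Lemma walk_lb k : (k <= n)%N -> - A <= s k.
Proof.
elim: k => [|k IH] kn; first by rewrite /= oppr_le0.
have := IH (ltnW kn); have := xA kn; have := y0 kn; rewrite ler_norml /=.
by case: ifP => h1 h2 /andP[h3 h4] h5; lra.
Qed.

Let sqn0 : 0 < Num.sqrt (n%:R : R).
Proof. by rewrite sqrtr_gt0 ltr0n. Qed.

(** The drift [L] at time n t is squeezed around minus the running minimum of the free walk. On one
    side the walk stays above -A while the drift is nondecreasing; on the other, at the last
    nonpositive time j, [free_walk j] is at most [skipped j - drift j], and the drift gains only
    [y j] <= E afterwards. *)
Lemma reflect_comparison t : unitI R t ->
  `|interpolate s (n%:R * t) / Num.sqrt n%:R -
    Defs.reflect (fun t => interpolate free_walk (n%:R * t) / Num.sqrt n%:R) t| <=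
  (2 * De + A + E) / Num.sqrt n%:R.
Proof.
have [A0' E0' De0'] := And3 A0 E0 De0.
move=> It; set f := (X in Defs.reflect X t); rewrite /Defs.reflect.
have cf : {within unitI R, continuous f} by exact: rescaled_continuous.
have [f1 f2] := reflect_inf cf It; set F := inf _ in f1 f2 *.
have /andP[t0 t1] : 0 <= t <= 1 by move: It; rewrite /unitI /= in_itv.
have nR0 : 0 <= n%:R :> R by [].
have nt u : 0 <= u -> u <= 1 -> 0 <= n%:R * u /\ n%:R * u <= n%:R :> R.
  by move=> u0 u1; split; [rewrite mulr_ge0|rewrite ler_piMr].
have lin u : interpolate s u =
    interpolate free_walk u - interpolate skipped u + interpolate drift u.
  by rewrite /interpolate !walkE; ring.
have Db u : 0 <= u -> u <= 1 -> `|interpolate skipped (n%:R * u)| <= De.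
  move=> u0 u1; have [h1 h2] := nt u u0 u1.
  rewrite -[interpolate _ _]subr0; apply: (interpolate_dist n0 h1 h2) => k kn.
  by rewrite subr0; exact: DD.
set q := Num.sqrt n%:R; have q0 : 0 < q := sqn0.
have fq u : f u * q = interpolate free_walk (n%:R * u).
  by rewrite /f divfK // gt_eqF.
set L := interpolate drift (n%:R * t).
have lo : (- L - A - De) / q <= F.
  apply: f2 => u /andP[u0 ut]; rewrite ler_pdivrMr // fq.
  have [h1 h2] := nt u u0 (le_trans ut t1).
  have h3 := interpolate_ge n0 h1 h2 walk_lb.
  have h4 : interpolate drift (n%:R * u) <= L.
    apply: (@interpolate_homo _ n) => //.
    - by rewrite ler_wpM2l.
    - by have [] := nt t t0 t1.
    - move=> k kn; rewrite /drift big_ord_recr /= lerDl mulr_ge0 ?y0 //.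
  have := Db u u0 (le_trans ut t1); rewrite ler_norml => /andP[h5 h6].
  by rewrite lin in h3; lra.
have up : F <= (- L + E + De) / q.
  have [h1 h2] := nt t t0 t1.
  have [k [th [kn /andP[kt tk] _ /andP[th0 th1] Ei]]] := interpolate_conv n0 h1 h2.
  have dk : drift k <= drift k.+1.
    by rewrite /drift big_ord_recr /= lerDl mulr_ge0 ?y0.
  have Lk : L <= drift k.+1 by rewrite /L Ei; nra.
  have nn0 : 0 < n%:R :> R by rewrite ltr0n.
  have fj j : (j <= k)%N -> F * q <= free_walk j.
    move=> jk; have jt : j%:R / n%:R <= t.
      rewrite ler_pdivrMr // mulrC; apply: le_trans kt.
      by rewrite ler_nat.
    have := f1 (j%:R / n%:R); rewrite jt andbT divr_ge0 // => /(_ isT).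
    rewrite -(ler_pM2r q0) fq mulrCA divff ?gt_eqF // mulr1 interpolate_nat.
    by [].
  clearbody F L; rewrite ler_pdivlMr //; case: (driftP k.+1) => [d0|[j [jk sj dj]]].
    rewrite d0 in Lk; have := fj 0%N isT; rewrite /free_walk big_ord0.
    by lra.
  have := fj j jk; have := walkE j; have jn : (j < n)%N by exact: leq_trans jk kn.
  have := yE jn sj; have := DD (ltnW jn); rewrite ler_norml => /andP[h3 h4].
  by lra.
have := Db t t0 t1; rewrite ler_norml => /andP[h5 h6].
rewrite lin -/L /f.
have -> : (interpolate free_walk (n%:R * t) - interpolate skipped (n%:R * t) + L) / q
   - (interpolate free_walk (n%:R * t) / q - F) =
   (- interpolate skipped (n%:R * t) + L + F * q) / q.
  by field; rewrite gt_eqF.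
rewrite normrM (ger0_norm (x := q^-1)) ?invr_ge0 ?(ltW q0) //.
rewrite ler_pM2r ?invr_gt0 // ler_norml.
rewrite ler_pdivrMr // in lo; rewrite ler_pdivlMr // in up.
clearbody F L.
by apply/andP; split; lra.
Qed.

End WalkComparison.

(** * Discretization into blocks *)

Section Mesh.
Context (R : realType) (S : nat -> R) (n m l : nat) (osc : R).
Hypotheses (S0 : S 0%N = 0) (m0 : (0 < m)%N) (ml : (m <= l)%N).
Hypotheses (n1 : (m * l <= n)%N) (n2 : (n < m * l.+1)%N).
Hypothesis hosc : forall j k, (j <= m)%N -> (k <= l)%N ->
  `|S (j * l + k)%N - S (j * l)%N| <= osc.

Let l0 : (0 < l)%N. Proof. exact: leq_trans ml. Qed.

Let n0 : (0 < n)%N. Proof. by apply: leq_trans n1; rewrite muln_gt0 m0. Qed.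

Let osc2 i k : (i < m)%N -> (i * l <= k)%N -> (k <= i.+2 * l)%N ->
  `|S k - S (i * l)%N| <= 2 * osc.
Proof.
move=> im ik ki; have [kil|kil] := leqP k (i.+1 * l).
  have := hosc (ltnW im) (k := k - i * l)%N; rewrite subnKC //.
  rewrite leq_subLR -mulSnr kil => /(_ isT) h.
  by have := le_trans (normr_ge0 _) h; lra.
have h1 := hosc im (k := k - i.+1 * l)%N; rewrite subnKC ?(ltnW kil) // in h1.
rewrite leq_subLR -mulSnr ki in h1; have {}h1 := h1 isT.
have h2 := hosc (ltnW im) (leqnn l); rewrite -mulSnr in h2.
have -> : S k - S (i * l)%N = (S k - S (i.+1 * l)%N) + (S (i.+1 * l)%N - S (i * l)%N).
  by ring.
by apply: (le_trans (ler_normD _ _)); lra.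
Qed.

Let oscS i : (i <= m)%N -> `|S (i * l)%N| <= i%:R * osc.
Proof.
elim: i => [|i IH] im; first by rewrite mul0n S0 normr0 mul0r.
have h1 := IH (ltnW im); have h2 := hosc (ltnW im) (leqnn l).
rewrite -mulSnr in h2; rewrite -natr1 mulrDl mul1r.
have -> : S (i.+1 * l)%N = S (i * l)%N + (S (i.+1 * l)%N - S (i * l)%N) by ring.
by apply: (le_trans (ler_normD _ _)); exact: lerD.
Qed.

(** Since m l <= n < m (l + 1) and m <= l, the time n t falls between i l and (i + 2) l when m t
    lies in the cell [i, i + 1]; this possible lag of one block is why oscillations are also
    controlled for j = m. The positions then differ by at most 3 osc, and the change of
    normalization from sqrt (m l) to sqrt n costs one more. *)
Lemma mesh_comparison t : unitI R t ->
  `|interpolate S (n%:R * t) / Num.sqrt n%:R -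
    interpolate (fun i => S (i * l)%N / Num.sqrt l%:R) (m%:R * t) / Num.sqrt m%:R|
  <= 4 * osc / Num.sqrt n%:R.
Proof.
rewrite /unitI /= in_itv /= => /andP[t0 t1].
have osc0 : 0 <= osc by apply: le_trans (hosc (leq0n m) (leq0n l)); exact: normr_ge0.
have nR0 : 0 < n%:R :> R by rewrite ltr0n.
have mR0 : 0 < m%:R :> R by rewrite ltr0n.
have lR0 : 0 < l%:R :> R by rewrite ltr0n.
have [a1 a2] : 0 <= n%:R * t /\ n%:R * t <= n%:R.
  by split; [rewrite mulr_ge0 // ltW|rewrite ler_piMr // ltW].
have [b1 b2] : 0 <= m%:R * t /\ m%:R * t <= m%:R.
  by split; [rewrite mulr_ge0 // ltW|rewrite ler_piMr // ltW].
have [k [th [kn /andP[kt tk] kk /andP[th0 th1] Ek]]] := interpolate_conv n0 a1 a2.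
have [i [ph [im /andP[it ti] _ /andP[ph0 ph1] Ei]]] := interpolate_conv m0 b1 b2.
rewrite Ek Ei.
have n1R : m%:R * l%:R <= n%:R :> R by rewrite -natrM ler_nat.
have n2R : n%:R < m%:R * (l%:R + 1) :> R by rewrite natr1 -natrM ltr_nat.
have ik : (i * l <= k)%N.
  case: kk => [tk'|kn'].
    rewrite -ltnS -(ltr_nat R); apply: le_lt_trans tk'; rewrite natrM.
    apply: (@le_trans _ _ (m%:R * t * l%:R)); first by rewrite ler_wpM2r // ltW.
    by rewrite mulrAC; rewrite ler_wpM2r.
  rewrite -ltnS kn'; apply: leq_trans n1.
  by rewrite ltn_pmul2r.
have ki : (k.+1 <= i.+2 * l)%N.
  have : k%:R < (i.+1 * l.+1)%:R :> R.
    apply: le_lt_trans kt _; rewrite natrM -[l.+1%:R]natr1.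
    have h1 : n%:R * t <= m%:R * (l%:R + 1) * t by rewrite ler_wpM2r // ltW.
    have [->|tn] := eqVneq t 0.
      by rewrite mulr0 mulr_gt0 ?ltr0n // ltr_wpDr.
    have tp : 0 < t by rewrite lt_neqAle eq_sym tn.
    apply: (@lt_le_trans _ _ (m%:R * (l%:R + 1) * t)).
      by rewrite ltr_pM2r.
    by rewrite mulrAC ler_wpM2r // addr_ge0 // ltW.
  rewrite ltr_nat => h; apply: (leq_trans h).
  rewrite mulnS [(i.+2 * l)%N]mulSn leq_add2r.
  exact: leq_trans im ml.
have k1 := osc2 im ik (ltnW ki).
have k2 := osc2 im (leqW ik) ki.
have j1 := hosc (ltnW im) (leqnn l); rewrite -mulSnr in j1.
have s1 := oscS (ltnW im); have s2 := oscS im.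
set F := (1 - th) * S k + _.
pose G := (1 - ph) * S (i * l)%N + ph * S (i.+1 * l)%N.
have FG : `|F - G| <= 3 * osc.
  rewrite /F /G; move: k1 k2 j1; rewrite !ler_norml.
  move=> /andP[p1 p2] /andP[p3 p4] /andP[p5 p6].
  by apply/andP; split; nra.
have Gm : `|G| <= m%:R * osc.
  have im' : i%:R * osc <= m%:R * osc by rewrite ler_wpM2r // ler_nat ltnW.
  have im2 : i.+1%:R * osc <= m%:R * osc by rewrite ler_wpM2r // ler_nat.
  rewrite /G; move: (le_trans s1 im') (le_trans s2 im2); rewrite !ler_norml.
  move=> /andP[p1 p2] /andP[p3 p4].
  by apply/andP; split; nra.
pose qn := Num.sqrt (n%:R : R); pose qa := Num.sqrt (m%:R * l%:R : R).
have qn0 : 0 < qn by rewrite sqrtr_gt0.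
have qa0 : 0 < qa by rewrite sqrtr_gt0 mulr_gt0.
have qnE : qn ^+ 2 = n%:R by rewrite sqr_sqrtr // ltW.
have qaE : qa ^+ 2 = m%:R * l%:R by rewrite sqr_sqrtr // mulr_ge0 // ltW.
have qan : qa <= qn by rewrite ler_sqrt.
have -> : ((1 - ph) * (S (i * l)%N / Num.sqrt l%:R) +
    ph * (S (i.+1 * l)%N / Num.sqrt l%:R)) / Num.sqrt m%:R = G / qa.
  rewrite /qa sqrtrM ?(ltW mR0) // /G; field.
  by rewrite !gt_eqF // sqrtr_gt0.
(* The difference of the inverse roots multiplies a position of size at most m osc, and m <= l turns
   the product into osc / sqrt n. *)
have inv : qa^-1 - qn^-1 <= (l%:R * qn)^-1.
  have -> : qa^-1 - qn^-1 = (qn - qa) / (qa * qn).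
    by field; rewrite !gt_eqF.
  rewrite ler_pdivrMr ?mulr_gt0 //.
  have -> : (l%:R * qn)^-1 * (qa * qn) = qa / l%:R by field; rewrite !gt_eqF.
  rewrite ler_pdivlMr //.
  have h1 : (qn - qa) * (qn + qa) <= m%:R.
    have -> : (qn - qa) * (qn + qa) = qn ^+ 2 - qa ^+ 2 by ring.
    by rewrite qnE qaE; lra.
  have h2 : (qn - qa) * qa <= m%:R.
    apply: le_trans h1; apply: ler_wpM2l; first by rewrite subr_ge0.
    by rewrite lerDr ltW.
  rewrite -(ler_pM2r qa0) mulrAC -[leRHS]expr2 qaE.
  by rewrite ler_pM2r.
have inv0 : 0 <= qa^-1 - qn^-1 by rewrite subr_ge0 lef_pV2.
rewrite -/qn.
have -> : F / qn - G / qa = (F - G) / qn - G * (qa^-1 - qn^-1) by ring.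
have h1 : `|(F - G) / qn| <= 3 * osc / qn.
  by rewrite normrM (ger0_norm (x := qn^-1)) ?invr_ge0 ?(ltW qn0) // ler_pM2r // invr_gt0.
have h2 : `|G * (qa^-1 - qn^-1)| <= osc / qn.
  rewrite normrM (ger0_norm inv0).
  apply: (@le_trans _ _ (m%:R * osc * (l%:R * qn)^-1)).
    by apply: ler_pM.
  rewrite invfM mulrA ler_pM2r ?invr_gt0 // ler_pdivrMr // mulrC ler_wpM2l //.
  by rewrite ler_nat.
apply: (le_trans (ler_normB _ _)).
have -> : 4 * osc / qn = 3 * osc / qn + osc / qn by ring.
exact: lerD.
Qed.

End Mesh.

(** * Weak convergence in C[0, 1] *)

Section PathFunctionals.
Context (R : realType).
Implicit Types (F : C01 R -> R) (x y : C01 R).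

Definition lipC (L : R) F := forall x y (e : R), 0 <= e ->
  (forall t, `|x t - y t| <= e) -> `|F x - F y| <= L * e.

Lemma lipC_normr L F : lipC L F -> lipC `|L| F.
Proof.
move=> hF x y e e0 xy; apply: (le_trans (hF x y e e0 xy)).
by rewrite ler_wpM2r // ler_norm.
Qed.

Lemma lipC_path01 L F (f g : R -> R) (cf : {within unitI R, continuous f})
    (cg : {within unitI R, continuous g}) (e : R) : lipC L F -> 0 <= e ->
  (forall t, unitI R t -> `|f t - g t| <= e) ->
  `|F (path01 cf) - F (path01 cg)| <= L * e.
Proof. by move=> hF e0 fg; apply: hF => // t; apply: fg; exact: set_valP. Qed.

(* The minorant inf_y (F y + k |x - y|), with upper bounds [e] of the uniform
   distance in place of that distance. *)
Definition infconv F (k : R) x : R :=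
  inf [set v | exists y e, [/\ 0 <= e, forall t, `|x t - y t| <= e & v = F y + k * e]].

Section infconv.
Variables (F : C01 R -> R) (M k : R).
Hypotheses (FM : forall x, - M <= F x) (k0 : 0 <= k).

Lemma infconv_lb x c :
  (forall y e, 0 <= e -> (forall t, `|x t - y t| <= e) -> c <= F y + k * e) ->
  c <= infconv F k x.
Proof.
move=> h; apply: lb_le_inf.
  by exists (F x + k * 0), x, 0; split => // t; rewrite subrr normr0.
by move=> _ [y [e [e0 xy ->]]]; exact: h.
Qed.

Lemma infconv_ub x y e : 0 <= e -> (forall t, `|x t - y t| <= e) ->
  infconv F k x <= F y + k * e.
Proof.
move=> e0 xy; apply: ge_inf; last by exists y, e.
exists (- M) => _ [z [a [a0 _ ->]]].
by have := FM z; have := mulr_ge0 k0 a0; lra.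
Qed.

Lemma infconv_le x : infconv F k x <= F x.
Proof.
have h t : `|x t - x t| <= 0 by rewrite subrr normr0.
by have := infconv_ub (lexx 0) h; rewrite mulr0 addr0.
Qed.

Lemma infconv_geN x : - M <= infconv F k x.
Proof.
apply: infconv_lb => y e e0 _.
by have := FM y; have := mulr_ge0 k0 e0; lra.
Qed.

Lemma infconv_lipC : lipC k (infconv F k).
Proof.
have half x y e : 0 <= e -> (forall t, `|x t - y t| <= e) ->
    infconv F k x - k * e <= infconv F k y.
  move=> e0 xy; apply: infconv_lb => z a a0 yz.
  have xz t : `|x t - z t| <= a + e.
    apply: (le_trans (ler_distD (y t) _ _)).
    by rewrite addrC; apply: lerD; [exact: yz|exact: xy].
  by have := infconv_ub (addr_ge0 a0 e0) xz; lra.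
move=> x y e e0 xy; have h1 := half x y e e0 xy.
have h2 := half y x e e0 (fun t => etrans (congr1 (fun z => z <= e) (distrC _ _)) (xy t)).
by rewrite ler_norml; apply/andP; split; lra.
Qed.

End infconv.

(** Paths within the continuity radius [de] of x keep F close to F x; farther away the penalty n de
    exceeds the oscillation 2 M of F. *)
Lemma infconv_cvg F M x : (forall x, `|F x| <= M) -> {for x, continuous F} ->
  infconv F n%:R x @[n --> \oo] --> F x.
Proof.
move=> FM cF; have FM' z : - M <= F z by have := FM z; rewrite ler_norml => /andP[].
apply/cvgrPdist_le => e e0.
have /cvgrPdist_le /(_ e e0) /nbhs_C01P [de de0 hd] := cF.
near=> n; have n0 : 0 <= n%:R :> R by [].
have h1 := infconv_le FM' n0 x.
rewrite ger0_norm ?subr_ge0 // lerBlDl -lerBlDr.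
apply: infconv_lb => y a a0 xy.
have na0 := mulr_ge0 n0 a0.
have [ad|da] := ltP a de.
  have /= := hd y (fun t => le_lt_trans (xy t) ad).
  by rewrite ler_norml => /andP[h2 h3]; lra.
have nd : 2 * M <= n%:R * de.
  rewrite -ler_pdivrMr //; near: n; exact: nbhs_infty_ger.
have : n%:R * de <= n%:R * a by rewrite ler_wpM2l.
have := FM' y; have := FM x; rewrite ler_norml => /andP[h4 h5].
by lra.
Unshelve. all: by end_near. Qed.

(** The inf-convolution of the indicator is the minimum of 1 and the distance to the complement, so
    every open set is the positivity set of a Lipschitz functional. *)
Lemma infconv_indic_open (O : set (C01 R)) x : open O ->
  O x <-> 0 < infconv \1_O 1 x.
Proof.
move=> oO; have F0 y : - 0 <= (\1_O y : R) by rewrite oppr0.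
split => [Ox|].
  have : nbhs x O by exact: open_nbhs_nbhs.
  move=> /nbhs_C01P [e e0 hO].
  apply: (@lt_le_trans _ _ (Num.min e 1)); first by rewrite lt_min e0 ltr01.
  apply: infconv_lb => y a a0 xy; rewrite mul1r ge_min.
  have [ae|ea] := ltP a e; last by apply/orP; left; rewrite ler_wpDl.
  apply/orP; right; rewrite indicE mem_set ?lerDl //.
  by apply: hO => t; exact: le_lt_trans (xy t) ae.
apply: contraPP => Ox; apply/negP; rewrite -leNgt.
apply: le_trans (infconv_le F0 ler01 x) _.
by rewrite indicE memNset.
Qed.

End PathFunctionals.

(** * Borel measurability and the portmanteau argument *)

Section PathMeasurability.
Context (R : realType) d (T : measurableType d).

(** Each open set is itself a positivity set of a Lipschitz functional, so its preimage is
    measurable directly, without a countable base; the sigma-algebra of good sets does the rest. *)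
Lemma C01_borel_measurable (X : T -> C01 R) :
  (forall L F, lipC L F -> measurable_fun setT (F \o X)) -> borel_measurable X.
Proof.
move=> mX; rewrite /borel_measurable => A.
apply: (smallest_sub (C := sigma_algebra setT)
  (X := [set A | measurable (X @^-1` A)])) => [|O oO] /=.
  split => /=.
  - by rewrite preimage_set0.
  - by move=> B mB; rewrite setTD preimage_setC; exact: measurableC.
  - move=> B mB; rewrite preimage_bigcup; exact: bigcupT_measurable.
rewrite (_ : X @^-1` O = (infconv \1_O 1 \o X) @^-1` `]0, +oo[).
  have hl : lipC 1 (infconv (\1_O : C01 R -> R) 1).
    by apply: (@infconv_lipC _ _ 0 1 _ ler01) => x; rewrite oppr0.
  by rewrite -[X in measurable X]setTI; apply: (mX _ _ hl).
apply/seteqP; split => w /=; rewrite in_itv /= andbT => h.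
  exact/(infconv_indic_open (X w) oO).
by apply/(infconv_indic_open (X w) oO).
Qed.

Lemma measurable_continuous_path (X : T -> C01 R) (F : C01 R -> R) :
  (forall L F, lipC L F -> measurable_fun setT (F \o X)) ->
  continuous F -> (exists M, forall x, `|F x| <= M) ->
  measurable_fun setT (F \o X).
Proof.
move=> mX cF [M FM].
have FM' z : - M <= F z by have := FM z; rewrite ler_norml => /andP[].
apply: (@measurable_fun_cvg _ _ _ setT (fun n => infconv F n%:R \o X)).
  by move=> n; exact: (mX _ _ (infconv_lipC FM' (ler0n R n))).
by move=> w _; exact: (infconv_cvg FM (cF _)).
Qed.

End PathMeasurability.

Section Portmanteau.
Context (R : realType) d (T : measurableType d) (P : probability T R).
Context d' (T' : measurableType d') (Q : probability T' R).
Variables (X : nat -> T -> C01 R) (Y : T' -> C01 R).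
Hypothesis mX : forall n L F, lipC L F -> measurable_fun setT (F \o X n).
Hypothesis mY : forall L F, lipC L F -> measurable_fun setT (F \o Y).
Hypothesis XY : forall (L M : R) F, 0 <= L -> lipC L F -> (forall x, `|F x| <= M) ->
  \int[P]_w F (X n w) @[n --> \oo] --> \int[Q]_w F (Y w).

(** Lipschitz minorants [infconv F k] give the lower half: k is fixed using their increase to F
    under the limit law, and only then n tends to infinity. *)
Let half F (e : R) : continuous F -> (exists M, forall x, `|F x| <= M) -> 0 < e ->
  \forall n \near \oo, \int[Q]_w F (Y w) - e <= \int[P]_w F (X n w).
Proof.
move=> cF [M FM] e0.
have FM' z : - M <= F z by have := FM z; rewrite ler_norml => /andP[].
have IM k x : 0 <= k -> `|infconv F k x| <= M.
  move=> k0; rewrite ler_norml (infconv_geN FM' k0) /=.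
  apply: le_trans (infconv_le FM' k0 x) _.
  by have := FM x; rewrite ler_norml => /andP[].
have mFY := measurable_continuous_path mY cF (ex_intro _ M FM).
have mFX n := measurable_continuous_path (@mX n) cF (ex_intro _ M FM).
have h : \int[Q]_w infconv F k%:R (Y w) @[k --> \oo] --> \int[Q]_w F (Y w).
  apply: (@mean_dominated _ _ _ Q (fun k w => infconv F k%:R (Y w)) (F \o Y)
    (fun=> M)) => //.
  - by move=> k; exact: (mY (infconv_lipC FM' (ler0n R k))).
  - exact: L1_cst.
  - by move=> k w; exact: IM.
  - by move=> w; exact: (infconv_cvg FM (cF _)).
have e2 : 0 < e / 2 by rewrite divr_gt0.
have /cvgrPdist_le /(_ _ e2) [k _ hk] := h.
have {hk} := hk k (leqnn k); rewrite ler_norml => /andP[_ hk].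
have k0 : 0 <= k%:R :> R by [].
have /cvgrPdist_le /(_ _ e2) := XY k0 (infconv_lipC FM' k0) (IM k%:R ^~ k0).
apply: filterS => n; rewrite ler_norml => /andP[_ hn].
have le : \int[P]_w infconv F k%:R (X n w) <= \int[P]_w F (X n w).
  apply: le_mean.
  - apply: (@L1_bounded _ _ _ _ _ M) => [|w]; last exact: IM.
    exact: (mX n (infconv_lipC FM' k0)).
  - by apply: (@L1_bounded _ _ _ _ _ M) => [|w]; [exact: mFX|exact: FM].
  - by move=> w; exact: (infconv_le FM' k0).
by lra.
Qed.

Lemma converges_weakly_lipC : converges_weakly P Q X Y.
Proof.
split.
- by move=> n; apply: C01_borel_measurable => L F; exact: mX.
- by apply: C01_borel_measurable => L F; exact: mY.
move=> F cF [M0 [_ bF]].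
have FM : exists M, forall x, `|F x| <= M.
  by exists (M0 + 1) => x; apply: bF => //; rewrite ltrDl.
have [M hM] := FM.
have FX n : P.-L1 (F \o X n).
  apply: (@L1_bounded _ _ _ _ _ M) => [|w]; last exact: hM.
  exact: (measurable_continuous_path (@mX n) cF FM).
have FY : Q.-L1 (F \o Y).
  apply: (@L1_bounded _ _ _ _ _ M) => [|w]; last exact: hM.
  exact: (measurable_continuous_path mY cF FM).
rewrite unlock L1_integral //.
under eq_fun do rewrite L1_integral //.
apply: cvg_EFin; first exact: nearW.
apply/cvgrPdist_le => e e0.
(* The upper half is the lower half applied to -F. *)
have cNF : continuous (fun x : C01 R => - F x : R).
  by move=> x; have cFx : F z @[z --> x] --> F x := cF x; exact: (cvgN cFx).
have NFM : exists M, forall x : C01 R, `|- F x : R| <= M.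
  by exists M => x; rewrite normrN.
near=> n.
have h1 : \int[Q]_w F (Y w) - e <= \int[P]_w F (X n w).
  by near: n; exact: (half cF FM e0).
have h2 : \int[Q]_w (- F (Y w)) - e <= \int[P]_w (- F (X n w)).
  by near: n; exact: (half cNF NFM e0).
rewrite (meanN FY) (meanN (FX n)) in h2.
by rewrite ler_norml /=; apply/andP; split; lra.
Unshelve. all: by end_near. Qed.

End Portmanteau.

(** * Comparison of the walk with a reflected driftless walk *)

Definition same_law (R : realType) d (T : measurableType d) (P : probability T R)
    d' (T' : measurableType d') (Q : probability T' R) (X : T -> R) (Y : T' -> R) :=
  forall A : set R, measurable A -> P (X @^-1` A) = Q (Y @^-1` A).

Section SameLaw.
Context (R : realType) d (T : measurableType d) (P : probability T R).
Context d' (T' : measurableType d') (Q : probability T' R).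
Variables (X : T -> R) (Y : T' -> R).
Hypotheses (mX : measurable_fun setT X) (mY : measurable_fun setT Y).
Hypothesis XY : same_law P Q X Y.

Let X' : {mfun T >-> R} := HB.pack X (isMeasurableFun.Build _ _ _ _ _ mX).
Let Y' : {mfun T' >-> R} := HB.pack Y (isMeasurableFun.Build _ _ _ _ _ mY).

Let integral_law (f : R -> \bar R) :
  (\int[distribution P X']_x f x = \int[distribution Q Y']_x f x)%E.
Proof. by apply: eq_measure_integral => A mA _; exact: XY. Qed.

Lemma same_law_mean (f : R -> R) : measurable_fun setT f ->
  Q.-L1 (fun w => f (Y w)) ->
  P.-L1 (fun w => f (X w)) /\ \int[P]_w f (X w) = \int[Q]_w f (Y w).
Proof.
move=> mf iY; have mfE : measurable_fun setT (EFin \o f) by exact/measurable_EFinP.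
have iX : P.-L1 (fun w => f (X w)).
  apply/integrableP; split.
    by apply/measurable_EFinP; exact: (measurableT_comp mf mX).
  have mA : measurable_fun setT (fun x => `|(EFin \o f) x|)%E.
    exact: measurableT_comp.
  have := ge0_integral_distr P X' mA (fun y => abse_ge0 _) => /= <-.
  rewrite integral_law (ge0_integral_distr Q Y' mA (fun y => abse_ge0 _)) /=.
  by move/integrableP : iY => [].
split => //; apply: EFin_inj; rewrite -!L1_integral //.
by rewrite -(integral_distr (X := X') mfE iX) integral_law (integral_distr (X := Y') mfE iY).
Qed.

End SameLaw.

Section CombinedFamily.
Context d (T : measurableType d) (R : realType) (P : probability T R).
Variables xi eta : nat -> T -> R.

(** Both sequences are merged into one independent family, so that their joint past is a set of
    indices. *)
Definition combined (z : nat + nat) : T -> R :=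
  match z with inl i => xi i | inr j => eta j end.

Let fl (z : nat + nat) := if z is inl i then Some i else None.
Let fr (z : nat + nat) := if z is inr i then Some i else None.

Let sigma_of_bigcap (X : nat -> T -> R) (s : seq nat) (A : nat -> set R) :
  (forall i, measurable (A i)) ->
  sigma_of X (\bigcap_(i in [set` s]) (X i @^-1` A i)).
Proof.
move=> mA.
have [_ sC sU] := smallest_sigma_algebra setT
  (\bigcup_i preimage_set_system setT (X i) measurable).
have gen i : sigma_of X (X i @^-1` A i).
  apply: sub_gen_smallest; exists i => //; exists (A i) => //.
  by rewrite setTI.
rewrite -[X in sigma_of _ X]setCK setC_bigcap -setTD; apply: (sC).
(* The finite intersection is the complement of a countable union, padded with empty sets. *)
pose F i := if i \in s then ~` (X i @^-1` A i) else set0.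
rewrite (_ : \bigcup_(i in _) _ = \bigcup_i F i).
  apply: (sU) => i; rewrite /F; case: ifP => _.
    by rewrite -setTD; apply: sC; exact: gen.
  by have [] := smallest_sigma_algebra setT
    (\bigcup_i preimage_set_system setT (X i) measurable).
apply/seteqP; split => w [i].
  by move=> /= si h; exists i => //; rewrite /F si.
by move=> _; rewrite /F; case: ifP => // si h; exists i.
Qed.

Lemma combined_independent : mutually_independent P xi ->
  mutually_independent P eta -> independent_families P xi eta ->
  mutually_independent P combined.
Proof.
move=> ixi ieta ind s A us mA.
pose s1 := pmap fl s; pose s2 := pmap fr s.
have us1 : uniq s1 by apply: (pmap_uniq (g := inl)) => // -[].
have us2 : uniq s2 by apply: (pmap_uniq (g := inr)) => // -[].
have m1 i : (i \in s1) = (inl i \in s).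
  rewrite mem_pmap; apply/mapP/idP => [[[j|j] // js [->]]|si] //.
  by exists (inl i).
have m2 i : (i \in s2) = (inr i \in s).
  rewrite mem_pmap; apply/mapP/idP => [[[j|j] // js [->]]|si] //.
  by exists (inr i).
have -> : \bigcap_(z in [set` s]) (combined z @^-1` A z) =
    \bigcap_(i in [set` s1]) (xi i @^-1` A (inl i)) `&`
    \bigcap_(i in [set` s2]) (eta i @^-1` A (inr i)).
  apply/seteqP; split => w /=.
    move=> h; split => i /=; first by rewrite m1 => /h.
    by rewrite m2 => /h.
  by move=> [h1 h2] [i|i] /= si; [apply: h1; rewrite /= m1|apply: h2; rewrite /= m2].
rewrite ind; [|exact: sigma_of_bigcap|exact: sigma_of_bigcap].
rewrite (ixi _ _ us1) // (ieta _ _ us2) //.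
rewrite /s1 /s2; elim: (s) => [|[i|i] r IH] /=.
- by rewrite !big_nil mule1.
- by rewrite !big_cons -muleA IH.
- by rewrite !big_cons muleCA IH.
Qed.

End CombinedFamily.

Section TailMean.
Context d (T : measurableType d) (R : realType) (P : probability T R).

Lemma measurable_ltr_indic (g : T -> R) (a : R) : measurable_fun setT g ->
  measurable_fun setT (fun w => (a < g w)%R%:R : R).
Proof.
move=> mg; rewrite (_ : (fun w => _) = (fun w => if a < g w then 1 else 0 : R)).
  by apply: measurable_fun_ifT => //; apply: measurable_fun_ltr.
by apply/funext => w; case: ifP.
Qed.

Lemma L1_indic (f g : T -> R) (a : R) : P.-L1 f -> measurable_fun setT g ->
  P.-L1 (fun w => f w * (a < g w)%R%:R).
Proof.
move=> iF mg; have mb := measurable_ltr_indic a mg.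
apply: L1_le (L1_norm iF).
  by apply: measurable_funM; [exact: L1_measurable iF|exact: mb].
by move=> w; rewrite normrM; case: (a < g w); rewrite ?normr1 ?normr0 ?mulr1 ?mulr0.
Qed.

Lemma tail_mean (f g : T -> R) (a : nat -> R) : P.-L1 f ->
  measurable_fun setT g -> a n @[n --> \oo] --> +oo ->
  \int[P]_w (f w * (a n < g w)%R%:R) @[n --> \oo] --> 0.
Proof.
move=> iF mg ca.
have -> : 0 = \int[P]_w (0 : R) by rewrite mean_cst.
apply: (@mean_dominated _ _ _ P (fun n w => f w * (a n < g w)%R%:R) _
  (fun w => `|f w|)) => //.
- by move=> n; apply: L1_measurable; exact: L1_indic.
- exact: L1_norm.
- move=> n w; rewrite normrM.
  by case: (a n < g w); rewrite ?normr1 ?normr0 ?mulr1 ?mulr0.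
move=> w; apply: cvg_near_cst.
have := ca; move/cvgryPge => /(_ (g w)); apply: filterS => n h.
by rewrite ltNge h mulr0.
Qed.

End TailMean.

Lemma cvg_sqrt_natr (R : realType) (e : R) : 0 < e ->
  e * Num.sqrt n%:R @[n --> \oo] --> +oo.
Proof.
move=> e0; apply/cvgryPge => A; near=> n.
have [A0|A0] := leP A 0; first by rewrite (le_trans A0) // mulr_ge0 ?sqrtr_ge0 // ltW.
rewrite -ler_pdivrMl // -[X in X <= _]ger0_norm; last first.
  by rewrite mulr_ge0 ?invr_ge0 // ltW.
rewrite -sqrtr_sqr ler_sqrt //.
near: n; exact: nbhs_infty_ger.
Unshelve. all: by end_near. Qed.

(** Used with a = eps sqrt n: summing the last term over k < n bounds every |xi k| - a at once, and
    the mean of this sum is o(sqrt n) by the second moment. *)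
Lemma indic_le_sqr (R : realType) (x a : R) : 0 < a ->
  `|x| <= a + x ^+ 2 * (a < `|x|)%R%:R / a.
Proof.
move=> a0; have [xa|ax] := leP `|x| a; first by rewrite mulr0 mul0r addr0.
rewrite mulr1 -(real_normK (num_real x)) -lerBlDl ler_pdivlMr //.
by have := normr_ge0 x; rewrite expr2; nra.
Qed.

Section AdaptedClosure.
Context d (T : measurableType d) (R : realType) (I : choiceType) (Z : I -> T -> R).
Implicit Types (J : set I) (f g : T -> R).

Lemma adapted_cst J (c : R) : adapted Z J (fun=> c).
Proof. exact: (@measurable_cst _ _ (g_sigma_algebraType (cylinders Z J)) R setT c). Qed.

Lemma adaptedD J f g : adapted Z J f -> adapted Z J g ->
  adapted Z J (fun w => f w + g w).
Proof. exact: (@measurable_funD _ (g_sigma_algebraType (cylinders Z J))). Qed.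

Lemma adaptedM J f g : adapted Z J f -> adapted Z J g ->
  adapted Z J (fun w => f w * g w).
Proof. exact: (@measurable_funM _ (g_sigma_algebraType (cylinders Z J))). Qed.

Lemma adaptedB J f g : adapted Z J f -> adapted Z J g ->
  adapted Z J (fun w => f w - g w).
Proof. exact: (@measurable_funB _ (g_sigma_algebraType (cylinders Z J))). Qed.

Lemma adapted_max J f g : adapted Z J f -> adapted Z J g ->
  adapted Z J (fun w => Num.max (f w) (g w)).
Proof. exact: (@measurable_maxr _ (g_sigma_algebraType (cylinders Z J))). Qed.

Lemma adapted_sum J n (F : nat -> T -> R) :
  (forall k, (k < n)%N -> adapted Z J (F k)) ->
  adapted Z J (fun w => \sum_(k < n) F k w).
Proof.
elim: n => [|n IH] h.
  rewrite (_ : (fun w => _) = (fun=> 0)); first exact: adapted_cst.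
  by apply/funext => w; rewrite big_ord0.
rewrite (_ : (fun w => _) = (fun w => \sum_(k < n) F k w + F n w)); last first.
  by apply/funext => w; rewrite big_ord_recr.
have h' k : (k < n)%N -> adapted Z J (F k) by move=> kn; exact: (h k (leqW kn)).
exact: (adaptedD (IH h') (h n (ltnSn n))).
Qed.

Lemma adapted_ifle J f g (a b : T -> R) : adapted Z J a -> adapted Z J b ->
  adapted Z J f -> adapted Z J g ->
  adapted Z J (fun w => if a w <= b w then f w else g w).
Proof.
move=> aa ab af ag.
apply: (@measurable_fun_ifT _ _ (g_sigma_algebraType (cylinders Z J))) => //.
exact: (@measurable_fun_ler _ (g_sigma_algebraType (cylinders Z J))).
Qed.

Lemma adapted_indic J (a b : T -> R) : adapted Z J a -> adapted Z J b ->
  adapted Z J (fun w => (a w <= b w)%R%:R).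
Proof.
move=> aa ab; rewrite (_ : (fun w => _) = (fun w => if a w <= b w then 1 else 0 : R)).
  exact: (adapted_ifle aa ab (@adapted_cst J 1) (@adapted_cst J 0)).
by apply/funext => w; case: ifP.
Qed.

Lemma adapted_rmax (J : nat -> set I) (N : nat -> T -> R) n :
  (forall k, J k `<=` J k.+1) -> (forall k, adapted Z (J k) (N k)) ->
  adapted Z (J n) (fun w => rmax (N ^~ w) n).
Proof.
move=> JS aN; elim: n => [|n IH] /=; first exact: adapted_cst.
apply: adapted_max; last exact: aN.
exact: (adapted_sub (@JS n) IH).
Qed.

End AdaptedClosure.

(** * Martingale transforms of independent steps *)

Section Martingale.
Context d (T : measurableType d) (R : realType) (P : probability T R).
Context (I : choiceType) (Z : I -> T -> R).
Hypothesis mZ : forall i, measurable_fun setT (Z i).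
Hypothesis iZ : mutually_independent P Z.
Variables (J K : nat -> set I) (X : nat -> T -> R) (v : R).
Hypothesis JK : forall i, J i `&` K i = set0.
Hypothesis JS : forall i, J i `<=` J i.+1.
Hypothesis KS : forall i, K i `<=` J i.+1.
Hypothesis aX : forall i, adapted Z (K i) (X i).
Hypothesis iX : forall i, P.-L1 (X i).
Hypothesis iX2 : forall i, P.-L1 (fun w => X i w ^+ 2).
Hypothesis EX : forall i, \int[P]_w X i w = 0.
Hypothesis EX2 : forall i, \int[P]_w X i w ^+ 2 = v.

(** The only form in which the martingale property is used: a factor determined by the past is
    independent of the centered step. *)
Lemma predictable_increment k (Y : T -> R) : adapted Z (J k) Y -> P.-L1 Y ->
  P.-L1 (fun w => Y w * X k w) /\ \int[P]_w (Y w * X k w) = 0.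
Proof.
move=> aY iY; have [h1 h2] := adapted_mul mZ iZ (JK k) aY (@aX k) iY (iX k).
by split => //; rewrite h2 EX mulr0.
Qed.

Variable b : nat -> T -> R.
Hypothesis ab : forall k, adapted Z (J k) (b k).
Hypothesis b1 : forall k w, `|b k w| <= 1.

Definition mart n w : R := \sum_(k < n) b k w * X k w.

Lemma martS n w : mart n.+1 w = mart n w + b n w * X n w.
Proof. by rewrite /mart big_ord_recr. Qed.

Lemma adapted_mart n : adapted Z (J n) (mart n).
Proof.
elim: n => [|n IH].
  rewrite (_ : mart 0 = fun=> 0); first exact: adapted_cst.
  by apply/funext => w; rewrite /mart big_ord0.
rewrite (_ : mart n.+1 = fun w => mart n w + b n w * X n w).
  apply: adaptedD; first exact: (adapted_sub (@JS n) IH).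
  apply: adaptedM; first exact: (adapted_sub (@JS n) (@ab n)).
  exact: (adapted_sub (@KS n) (@aX n)).
by apply/funext => w; rewrite martS.
Qed.

Lemma adapted_rmax_mart n : adapted Z (J n) (fun w => rmax (mart ^~ w) n).
Proof. exact: (@adapted_rmax _ _ _ _ Z J mart n JS (fun k => @adapted_mart k)). Qed.

Lemma b_L1 k : P.-L1 (b k).
Proof.
apply: (@L1_bounded _ _ _ _ _ 1) => [|w]; last exact: b1.
exact: (adapted_measurable mZ (@ab k)).
Qed.

Lemma b2_L1 k : P.-L1 (fun w => b k w ^+ 2).
Proof.
apply: (@L1_bounded _ _ _ _ _ 1) => [|w].
  by apply: measurable_funX; exact: (adapted_measurable mZ (@ab k)).
by rewrite normrX exprn_ile1.
Qed.

Lemma mart_L1 n : P.-L1 (mart n).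
Proof.
apply: L1_sum => k; have [] // := predictable_increment (@ab k) (b_L1 k).
Qed.

Lemma mart_sqr n : P.-L1 (fun w => mart n w ^+ 2) /\
  \int[P]_w mart n w ^+ 2 = v * \sum_(k < n) \int[P]_w b k w ^+ 2.
Proof.
elim: n => [|n [IH1 IH2]].
  have e : (fun w => mart 0 w ^+ 2) = fun=> 0.
    by apply/funext => w; rewrite /mart big_ord0 expr0n.
  by rewrite e big_ord0 mulr0; split; [exact: L1_cst|exact: mean_cst].
have aY : adapted Z (J n) (fun w => mart n w * b n w).
  by apply: adaptedM => //; exact: adapted_mart.
have iY : P.-L1 (fun w => mart n w * b n w).
  apply: L1_le (L1_norm (mart_L1 n)).
    exact: (adapted_measurable mZ aY).
  by move=> w; rewrite normrM ler_piMr.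
have [i1 e1] := predictable_increment aY iY.
have ab2 : adapted Z (J n) (fun w => b n w ^+ 2).
  by under eq_fun do rewrite expr2; exact: adaptedM.
have aX2 : adapted Z (K n) (fun w => X n w ^+ 2).
  by under eq_fun do rewrite expr2; apply: adaptedM; exact: aX.
have [i2 e2] := adapted_mul mZ iZ (JK n) ab2 aX2 (b2_L1 n) (iX2 n).
have E w : mart n.+1 w ^+ 2 = mart n w ^+ 2 + 2 * (mart n w * b n w * X n w) +
    b n w ^+ 2 * X n w ^+ 2 by rewrite martS; ring.
have i3 := L1_scale 2 i1; have i4 := L1_add IH1 i3.
split; first by apply: L1_eq (L1_add i4 i2) => w; rewrite E.
under eq_Rintegral do rewrite E.
rewrite meanD // meanD // meanZ // e1 mulr0 addr0 e2 EX2 IH2.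
by rewrite big_ord_recr /=; ring.
Qed.

Lemma rmax_mart_L1 n : P.-L1 (fun w => rmax (mart ^~ w) n).
Proof.
apply: (@L1_le _ _ _ _ _ (fun w => \sum_(k < n.+1) `|mart k w|)).
- exact: (adapted_measurable mZ (@adapted_rmax_mart n)).
- move=> w; rewrite ger0_norm ?rmax_ge0 //.
  elim: n => [|n IH] /=; first by rewrite sumr_ge0.
  rewrite ge_max big_ord_recr /=; apply/andP; split.
    by apply: (le_trans IH); rewrite lerDl.
  by rewrite (le_trans (ler_norm _)) // lerDr sumr_ge0.
- by apply: L1_sum => k; apply: L1_norm; exact: mart_L1.
Qed.

(** In the mean of the pathwise inequality [rmax_sqr], the sum is a transform whose multiplier, the
    running maximum times [b], is determined by the past; hence it has mean 0. *)
Lemma rmax_mart_sqr n : P.-L1 (fun w => rmax (mart ^~ w) n ^+ 2) /\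
  \int[P]_w rmax (mart ^~ w) n ^+ 2 <= 4 * (v * \sum_(k < n) \int[P]_w b k w ^+ 2).
Proof.
pose inc k w := rmax (mart ^~ w) k * b k w * X k w.
have incP k : P.-L1 (inc k) /\ \int[P]_w inc k w = 0.
  apply: predictable_increment.
    by apply: adaptedM => //; exact: (@adapted_rmax_mart k).
  apply: L1_le (rmax_mart_L1 k) => [|w].
    apply: measurable_funM; last exact: (adapted_measurable mZ (@ab k)).
    exact: (adapted_measurable mZ (@adapted_rmax_mart k)).
  by rewrite normrM (ger0_norm (rmax_ge0 _ _)) ler_piMr ?rmax_ge0.
have [iM eM] := mart_sqr n.
have iS := L1_sum (index_enum 'I_n) xpredT (fun k : 'I_n => (incP k).1).
have iB := L1_sub (L1_scale 4 iM) (L1_scale 4 iS).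
have bnd w : rmax (mart ^~ w) n ^+ 2 <= 4 * mart n w ^+ 2 - 4 * \sum_(k < n) inc k w.
  have m0 : mart 0 w = 0 by rewrite /mart big_ord0.
  have := @rmax_sqr R (mart ^~ w) n m0.
  congr (_ <= _ - 4 * _); apply: eq_bigr => k _.
  by rewrite martS addrAC subrr add0r mulrA.
have iR : P.-L1 (fun w => rmax (mart ^~ w) n ^+ 2).
  apply: L1_le iB => [|w].
    apply: measurable_funX.
    exact: (adapted_measurable mZ (@adapted_rmax_mart n)).
  by rewrite ger0_norm ?sqr_ge0.
split => //; apply: (le_trans (le_mean iR iB bnd)).
rewrite meanB; [|exact: L1_scale ..].
rewrite !meanZ // eM mean_sum => [|k]; last by have [] := incP k.
have -> : \sum_(k < n) \int[P]_w inc k w = 0.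
  by rewrite big1 // => k _; have [_] := incP k.
by rewrite mulr0 subr0.
Qed.

(** From r <= a + r^2 / a. The scale a is left free: it is taken as sqrt n for the occupation time
    and as a small multiple of sqrt n for the skipped steps. *)
Lemma rmax_mart_mean n (a : R) : 0 < a ->
  \int[P]_w rmax (mart ^~ w) n <=
    a + 4 * (v * \sum_(k < n) \int[P]_w b k w ^+ 2) / a.
Proof.
move=> a0; have [i2 e2] := rmax_mart_sqr n.
apply: (@le_trans _ _ (\int[P]_w (a + a^-1 * rmax (mart ^~ w) n ^+ 2))).
  apply: le_mean; first exact: rmax_mart_L1.
    by apply: L1_add (L1_cst _ _) _; exact: L1_scale.
  move=> w; set r := rmax _ n; rewrite -(ler_pM2l a0) mulrDr mulrA divff ?gt_eqF //.
  have := sqr_ge0 (a - r); rewrite mul1r !expr2; have := sqr_ge0 a.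
  by have := sqr_ge0 r; rewrite !expr2; nra.
rewrite meanD; [|exact: L1_cst|exact: L1_scale].
rewrite mean_cst meanZ // lerD2l mulrC ler_pM2r ?invr_gt0 //.
Qed.

(** The mean of the pathwise inequality [rmax_weak]. The right-hand side keeps a Lipschitz function
    of the sum, so that a central limit theorem can be applied to it. *)
Lemma rmax_mart_weak n (lam : R) : 0 < lam ->
  lam * \int[P]_w (2 * lam <= rmax (mart ^~ w) n)%R%:R <=
    \int[P]_w Num.max (mart n w - lam) 0.
Proof.
move=> lam0; pose c k w : R := (2 * lam <= rmax (mart ^~ w) k)%R%:R.
have ac k : adapted Z (J k) (c k).
  exact: (adapted_indic (@adapted_cst _ _ _ _ Z _ (2 * lam)) (@adapted_rmax_mart k)).
have c1 k w : `|c k w| <= 1.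
  by rewrite /c; case: (2 * lam <= _); rewrite ?normr1 ?normr0 ?ler01.
have ic k : P.-L1 (c k).
  apply: (@L1_bounded _ _ _ _ _ 1) => [|w]; last exact: c1.
  exact: (adapted_measurable mZ (@ac k)).
have incP k : P.-L1 (fun w => c k w * b k w * X k w) /\
    \int[P]_w (c k w * b k w * X k w) = 0.
  apply: predictable_increment; first exact: (adaptedM (@ac k) (@ab k)).
  apply: (@L1_bounded _ _ _ _ _ 1) => [|w].
    exact: (adapted_measurable mZ (adaptedM (@ac k) (@ab k))).
  by rewrite normrM mulr_ile1.
have iS := L1_sum (index_enum 'I_n) xpredT (fun k : 'I_n => (incP k).1).
have iM : P.-L1 (fun w => Num.max (mart n w - lam) 0).
  apply: L1_le (L1_add (L1_norm (mart_L1 n)) (L1_cst P lam)) => [|w].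
    apply: measurable_maxr => //; apply: measurable_funB => //.
    exact: L1_measurable (mart_L1 n).
  rewrite ger0_norm ?le_max ?lexx ?orbT // ge_max addr_ge0 ?(ltW lam0) // andbT.
  by have := ler_norm (mart n w); have h := lam0; lra.
rewrite -(meanZ lam (ic n)); apply: (@le_trans _ _ (\int[P]_w (Num.max (mart n w - lam) 0 -
    \sum_(k < n) c k w * b k w * X k w))).
  apply: le_mean; [exact: L1_scale (ic n)|exact: L1_sub|move=> w].
  have m0 : mart 0 w = 0 by rewrite /mart big_ord0.
  have := @rmax_weak R (mart ^~ w) n lam m0 lam0.
  congr (_ <= _ - _); apply: eq_bigr => k _.
  by rewrite martS addrAC subrr add0r mulrA.
rewrite meanB // mean_sum => [|k]; last by have [] := incP k.
by rewrite [X in _ - X]big1 ?subr0 // => k _; have [_] := incP k.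
Qed.

End Martingale.

(** * Occupation time of the nonpositive half-line and the L1 comparison *)

Section WalkEstimate.
Context d (T : measurableType d) (R : realType) (P : probability T R).
Variables (xi eta : nat -> T -> R) (v mu : R).
Hypotheses (mxi : forall k, measurable_fun setT (xi k))
  (meta : forall k, measurable_fun setT (eta k)).
Hypotheses (ixi : forall k, P.-L1 (xi k)) (ixi2 : forall k, P.-L1 (fun w => xi k w ^+ 2)).
Hypotheses (Exi : forall k, \int[P]_w xi k w = 0)
  (Exi2 : forall k, \int[P]_w xi k w ^+ 2 = v).
Hypotheses (ieta : forall k, P.-L1 (eta k)) (Eeta : forall k, \int[P]_w eta k w = mu).
Hypothesis mu0 : 0 < mu.
Hypothesis eta_pos : forall k, {ae P, forall w, 0 < eta k w}.
Hypothesis iZ : mutually_independent P (combined xi eta).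
Let tx (a : R) := \int[P]_w (xi 0%N w ^+ 2 * (a < `|xi 0%N w|)%R%:R).
Let te (a : R) := \int[P]_w (eta 0%N w * (a < eta 0%N w)%R%:R).
Hypothesis txE : forall k a, \int[P]_w (xi k w ^+ 2 * (a < `|xi k w|)%R%:R) = tx a.
Hypothesis teE : forall k a, \int[P]_w (eta k w * (a < eta k w)%R%:R) = te a.

Notation Z := (combined xi eta).
Notation s k w := (walk (xi ^~ w) (eta ^~ w) k).

Let past k : set (nat + nat) :=
  [set z | match z with inl i => (i < k)%N | inr i => (i < k)%N end].
Let Kx k : set (nat + nat) := [set inl k].
Let Ke k : set (nat + nat) := [set inr k].

Let mZ z : measurable_fun setT (Z z).
Proof. by case: z => k; [exact: mxi|exact: meta]. Qed.

Let pastKx k : past k `&` Kx k = set0.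
Proof.
apply/seteqP; split => // z [pz zE]; move: pz.
by rewrite (zE : z = inl k) /past /= ltnn.
Qed.

Let pastKe k : past k `&` Ke k = set0.
Proof.
apply/seteqP; split => // z [pz zE]; move: pz.
by rewrite (zE : z = inr k) /past /= ltnn.
Qed.

Let pastS k : past k `<=` past k.+1.
Proof. by move=> [i|i] /=; exact: leqW. Qed.

Let KxS k : Kx k `<=` past k.+1.
Proof. by move=> z ->; exact: ltnSn. Qed.

Let KeS k : Ke k `<=` past k.+1.
Proof. by move=> z ->; exact: ltnSn. Qed.

Let aKx k : adapted Z (Kx k) (xi k).
Proof. exact: (@adapted_index _ _ _ _ Z (Kx k) (inl k) erefl). Qed.

Let aKe k : adapted Z (Ke k) (eta k).
Proof. exact: (@adapted_index _ _ _ _ Z (Ke k) (inr k) erefl). Qed.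

Lemma adapted_walk k : adapted Z (past k) (fun w => s k w).
Proof.
elim: k => [|k IH]; first exact: adapted_cst.
rewrite (_ : (fun w => _) = (fun w => if s k w <= 0 then s k w + eta k w
    else s k w + xi k w)); last first.
  by apply/funext => w /=; rewrite leNgt; case: ifP.
have a1 := adapted_sub (@pastS k) IH.
have a2 := adapted_sub (@KeS k) (@aKe k).
have a3 := adapted_sub (@KxS k) (@aKx k).
exact: (adapted_ifle a1 (@adapted_cst _ _ _ _ Z _ 0) (adaptedD a1 a2) (adaptedD a1 a3)).
Qed.

Let down k w : R := (s k w <= 0)%R%:R.

Let adown k : adapted Z (past k) (down k).
Proof. exact: (adapted_indic (@adapted_walk k) (@adapted_cst _ _ _ _ Z _ 0)). Qed.

Let down01 k w : 0 <= down k w <= 1.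
Proof. by rewrite /down; case: (s k w <= 0); rewrite /= ?lexx ?ler01. Qed.

Let down1 k w : `|down k w| <= 1.
Proof. by have /andP[h1 h2] := down01 k w; rewrite ger0_norm. Qed.

(** Minus the indicator of s k > 0: the transform by [up] is minus the sum of the used xi-steps,
    that is drift minus walk ([upE]), which dominates the drift whenever the walk is nonpositive. *)
Let up k w : R := down k w - 1.

Let aup k : adapted Z (past k) (up k).
Proof. exact: (adaptedB (@adown k) (@adapted_cst _ _ _ _ Z _ 1)). Qed.

Let up1 k w : `|up k w| <= 1.
Proof.
have /andP[h1 h2] := down01 k w; rewrite /up ler_norml.
by apply/andP; split; lra.
Qed.

(** Since [rmax] is one-sided, bounding the absolute value of the skipped part takes the transforms
    by [down] and by [ndown]. *)
Let ndown k w : R := - 1 * down k w.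

Let andown k : adapted Z (past k) (ndown k).
Proof. exact: (adaptedM (@adapted_cst _ _ _ _ Z _ (- 1)) (@adown k)). Qed.

Let ndown1 k w : `|ndown k w| <= 1.
Proof. by rewrite /ndown mulN1r normrN. Qed.

Let idown k : P.-L1 (down k).
Proof. exact: (b_L1 P mZ adown down1). Qed.

Let tau n := \sum_(k < n) \int[P]_w down k w.

Let tau0 n : 0 <= tau n.
Proof.
apply: sumr_ge0 => k _; apply: mean_ge0 => w.
by have /andP[] := down01 k w.
Qed.

Let v0 : 0 <= v.
Proof. by rewrite -(Exi2 0); apply: mean_ge0 => w; exact: sqr_ge0. Qed.

Let down_sqr k w : down k w ^+ 2 = down k w.
Proof. by rewrite /down; case: (s k w <= 0); rewrite /= ?expr1n ?expr0n. Qed.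

Let skippedE w n : skipped (xi ^~ w) (eta ^~ w) n = mart xi down n w.
Proof. by apply: eq_bigr => k _; rewrite mulrC. Qed.

Let nskippedE w n : - skipped (xi ^~ w) (eta ^~ w) n = mart xi ndown n w.
Proof.
rewrite skippedE /mart -sumrN; apply: eq_bigr => k _.
by rewrite /ndown mulN1r mulNr.
Qed.

Let upE w n : drift (xi ^~ w) (eta ^~ w) n - s n w = mart xi up n w.
Proof.
rewrite walkE skippedE; set A := drift _ _ _.
have -> : A - (free_walk (xi ^~ w) n - mart xi down n w + A) =
  mart xi down n w - free_walk (xi ^~ w) n by ring.
rewrite /free_walk /mart -sumrB; apply: eq_bigr => k _.
by rewrite /up mulrBl mul1r.
Qed.

Let eta_tail_L1 k a : P.-L1 (fun w => eta k w * (a < eta k w)%R%:R).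
Proof. exact: L1_indic. Qed.

Let eta_tail_down k a : P.-L1 (fun w => down k w * (eta k w * (a < eta k w)%R%:R)) /\
  \int[P]_w (down k w * (eta k w * (a < eta k w)%R%:R)) = \int[P]_w down k w * te a.
Proof.
have at' : adapted Z (Ke k) (fun w => eta k w * (a < eta k w)%R%:R).
  apply: (adaptedM (@aKe k)).
  rewrite (_ : (fun w => _) = (fun w => if eta k w <= a then 0 else 1 : R)).
    exact: (adapted_ifle (@aKe k) (@adapted_cst _ _ _ _ Z _ a)
      (@adapted_cst _ _ _ _ Z _ 0) (@adapted_cst _ _ _ _ Z _ 1)).
  by apply/funext => w; rewrite leNgt; case: (a < eta k w).
have [h1 h2] := adapted_mul mZ iZ (pastKe k) (@adown k) at' (idown k) (eta_tail_L1 k a).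
by split => //; rewrite h2 teE.
Qed.

(** Wald's identity: whether s k <= 0 is decided before [eta k], so the two are independent. *)
Let drift_mean n : P.-L1 (fun w => drift (xi ^~ w) (eta ^~ w) n) /\
  \int[P]_w drift (xi ^~ w) (eta ^~ w) n = tau n * mu.
Proof.
have hk k : P.-L1 (fun w => eta k w * down k w) /\
    \int[P]_w (eta k w * down k w) = \int[P]_w down k w * mu.
  have [h1 h2] := adapted_mul mZ iZ (pastKe k) (@adown k) (@aKe k) (idown k) (ieta k).
  split; first by apply: L1_eq h1 => w; rewrite mulrC.
  by under eq_Rintegral do rewrite mulrC; rewrite h2 Eeta.
split; first by apply: L1_sum => k; have [] := hk k.
rewrite mean_sum => [|k]; last by have [] := hk k.
by rewrite /tau mulr_suml; apply: eq_bigr => k _; have [] := hk k.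
Qed.

(** At the last nonpositive time j, the drift is at most drift minus walk, hence at most the running
    maximum of the transform by [up]. The final jump [eta j] is either at most a or one of the
    summands; absolute values keep the bound true at every w, since [eta] is positive only almost
    surely. *)
Let drift_bound n a w : 0 <= a -> drift (xi ^~ w) (eta ^~ w) n <=
  rmax (mart xi up ^~ w) n + a +
  \sum_(k < n) `|down k w * (eta k w * (a < eta k w)%R%:R)|.
Proof.
move=> a0; set S := \sum_(k < n) _.
have S0 : 0 <= S by apply: sumr_ge0.
have r0 := rmax_ge0 (mart xi up ^~ w) n.
case: (driftP (xi ^~ w) (eta ^~ w) n) => [->|[j [jn sj ->]]].
  by rewrite addr_ge0 // addr_ge0.
have m0 : mart xi up 0 w = 0 by rewrite /mart big_ord0.
have h1 := @le_rmax R (mart xi up ^~ w) n j m0 (ltnW jn).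
rewrite -upE in h1.
have h2 : eta j w <= a + S.
  have [ea|ae] := leP (eta j w) a; first by rewrite (le_trans ea) // lerDl.
  rewrite /S (bigD1 (Ordinal jn)) //= /down sj ae mul1r mulr1.
  apply: (@le_trans _ _ `|eta j w|); first exact: ler_norm.
  by rewrite addrCA lerDl addr_ge0 // sumr_ge0.
by lra.
Qed.

(** The mean drift is mu tau, and [drift_bound] bounds it by the mean running maximum plus a plus
    tau times [te a]. A fixed a with [te a] <= mu / 2 lets the last term be absorbed on the left;
    the mean maximum is at most (1 + 4 v) sqrt n. *)
Let tau_bound : exists C, 0 <= C /\ forall n, (0 < n)%N -> tau n <= C * Num.sqrt n%:R.
Proof.
have te0 : te n%:R @[n --> \oo] --> 0.
  by apply: tail_mean => //; exact: cvgr_idn.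
have mu2 : 0 < mu / 2 by rewrite divr_gt0.
have /cvgrPdist_le /(_ _ mu2) [a _ ha] := te0.
have {ha} := ha a (leqnn a); rewrite sub0r normrN => ha.
have {}ha : te a%:R <= mu / 2 by apply: le_trans (ler_norm _) ha.
exists (2 / mu * (1 + 4 * v + a%:R)).
split; first by rewrite mulr_ge0 ?divr_ge0 ?(ltW mu0) // !addr_ge0 // mulr_ge0.
move=> n n0; have sn1 : 1 <= Num.sqrt (n%:R : R).
  by rewrite -[leLHS]sqrtr1 ler_sqrt // ler1n.
have sn0 : 0 < Num.sqrt (n%:R : R) by exact: lt_le_trans ltr01 sn1.
have [iD eD] := drift_mean n.
have r1 := rmax_mart_mean mZ iZ pastKx pastS KxS aKx ixi ixi2 Exi Exi2 aup up1 n sn0.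
have up_sqr : \sum_(k < n) \int[P]_w up k w ^+ 2 <= n%:R.
  apply: (@le_trans _ _ (\sum_(k < n) 1)); last first.
    by rewrite sumr_const card_ord.
  apply: ler_sum => k _; apply: mean_le_cst; first exact: (b2_L1 P mZ aup up1).
  by move=> w; have := up1 k w; rewrite -(real_normK (num_real (up k w))) => h;
    rewrite exprn_ile1.
have ir := rmax_mart_L1 mZ iZ pastKx pastS KxS aKx ixi Exi aup up1 n.
have it k := (eta_tail_down k a%:R).1.
have iS := L1_sum (index_enum 'I_n) xpredT (fun k : 'I_n => it k).
(* the truncated terms are a.e. nonnegative, so the norms can be dropped *)
have pos : {ae P, forall w, forall k, 0 < eta k w} by exact: ae_foralln.
have key : tau n * mu <= \int[P]_w rmax (mart xi up ^~ w) n + a%:R +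
    tau n * te a%:R.
  rewrite -eD.
  have -> : \int[P]_w rmax (mart xi up ^~ w) n + a%:R + tau n * te a%:R =
    \int[P]_w (rmax (mart xi up ^~ w) n + a%:R +
      \sum_(k < n) (down k w * (eta k w * (a%:R < eta k w)%R%:R))).
    have ia := L1_cst P a%:R.
    rewrite meanD //; last exact: L1_add.
    rewrite meanD // mean_cst mean_sum //; congr (_ + _).
    by rewrite /tau mulr_suml; apply: eq_bigr => k _; have [] := eta_tail_down k a%:R.
  apply: le_mean_ae => //.
    exact: (L1_add (L1_add ir (L1_cst P a%:R)) iS).
  apply: filterS pos => w hw; have := drift_bound n w (ler0n R a).
  congr (_ <= _ + _); apply: eq_bigr => k _.
  by rewrite ger0_norm // mulr_ge0 // mulr_ge0 // ltW.
have t0 := tau0 n.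
have r2 : \int[P]_w rmax (mart xi up ^~ w) n <= (1 + 4 * v) * Num.sqrt n%:R.
  apply: (le_trans r1).
  have -> : (1 + 4 * v) * Num.sqrt n%:R =
      Num.sqrt n%:R + 4 * (v * (Num.sqrt n%:R ^+ 2)) / Num.sqrt (n%:R : R).
    by field; rewrite gt_eqF.
  rewrite lerD2l ler_pM2r ?invr_gt0 // ler_pM2l // sqr_sqrtr //.
  exact: ler_wpM2l.
have h3 : tau n * te a%:R <= tau n * (mu / 2) by rewrite ler_wpM2l.
have h4 : a%:R <= a%:R * Num.sqrt (n%:R : R) by rewrite ler_peMr.
have h5 : tau n * mu <= 2 * ((1 + 4 * v) * Num.sqrt n%:R + a%:R * Num.sqrt n%:R).
  by lra.
have -> : 2 / mu * (1 + 4 * v + a%:R) * Num.sqrt n%:R =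
  2 * ((1 + 4 * v) * Num.sqrt n%:R + a%:R * Num.sqrt n%:R) / mu.
  by field; rewrite gt_eqF.
by rewrite ler_pdivlMr.
Qed.

(** [D] is the error of [reflect_comparison], with the largest |xi k| and the largest used [eta k]
    bounded by a level a n plus sums of tails. The xi-tails have mean n times [tx (a n)] over a n,
    the used eta-tails mean [tau n] times [te (a n)]; both are o(sqrt n), the latter because [tau n]
    is O(sqrt n). *)
Lemma walk_reflect_L1 (e : R) : 0 < e -> \forall n \near \oo,
  exists2 D : T -> R, P.-L1 D /\ \int[P]_w D w <= e &
  {ae P, forall w, 0 <= D w /\ forall t, unitI R t ->
    `|interpolate (walk (xi ^~ w) (eta ^~ w)) (n%:R * t) / Num.sqrt n%:R -
      Defs.reflect (fun t => interpolate (free_walk (xi ^~ w)) (n%:R * t)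
        / Num.sqrt n%:R) t| <= D w}.
Proof.
move=> e0; have [C [C0 hC]] := tau_bound.
(* The level a n enters the mean of [D] six times, four through [rp] and [rm] and two directly,
   which makes e / 2. The other half is shared equally by the xi-tails, the used eta-tails and the
   second-moment terms of [rp] and [rm]. *)
pose ep := e / 12; have ep0 : 0 < ep by rewrite divr_gt0.
pose a n : R := ep * Num.sqrt n%:R.
have ca : a n @[n --> \oo] --> +oo by exact: cvg_sqrt_natr.
have cx : tx (a n) @[n --> \oo] --> 0.
  by apply: tail_mean => //; exact: measurableT_comp.
have ce : te (a n) @[n --> \oo] --> 0 by exact: tail_mean.
have e6 : 0 < e / 6 by rewrite divr_gt0.
have ex : 0 < ep * e / 6 by rewrite divr_gt0 // mulr_gt0.
have ee : 0 < e / (6 * C + 6) by rewrite divr_gt0 //; lra.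
near=> n.
have n0 : (0 < n)%N by near: n; exists 1%N.
have hx : tx (a n) <= ep * e / 6.
  have : `|0 - tx (a n)| <= ep * e / 6.
    by near: n; move/cvgrPdist_le : cx => /(_ _ ex).
  by rewrite sub0r normrN; exact: le_trans (ler_norm _).
have he : te (a n) <= e / (6 * C + 6).
  have : `|0 - te (a n)| <= e / (6 * C + 6).
    by near: n; move/cvgrPdist_le : ce => /(_ _ ee).
  by rewrite sub0r normrN; exact: le_trans (ler_norm _).
(* Each of the four second-moment terms is at most 4 v C / ep, a constant in n. *)
have hc : 16 * v * C / ep / (e / 6) <= Num.sqrt n%:R.
  by near: n; have := @cvg_sqrt_natr R 1 ltr01; under eq_fun do rewrite mul1r;
    move/cvgryPge; apply.
set q := Num.sqrt n%:R in hc *.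
have q0 : 0 < q by rewrite sqrtr_gt0 ltr0n.
have a0 : 0 < a n by rewrite mulr_gt0.
have tn := hC n n0; rewrite -/q in tn.
pose rp w := rmax (mart xi down ^~ w) n; pose rm w := rmax (mart xi ndown ^~ w) n.
pose Sx w := \sum_(k < n) xi k w ^+ 2 * (a n < `|xi k w|)%R%:R.
pose Se w := \sum_(k < n) down k w * (eta k w * (a n < eta k w)%R%:R).
have irp : P.-L1 rp := rmax_mart_L1 mZ iZ pastKx pastS KxS aKx ixi Exi adown down1 n.
have irm : P.-L1 rm := rmax_mart_L1 mZ iZ pastKx pastS KxS aKx ixi Exi andown ndown1 n.
have ix k : P.-L1 (fun w => xi k w ^+ 2 * (a n < `|xi k w|)%R%:R).
  by apply: L1_indic => //; exact: measurableT_comp.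
have iSx : P.-L1 Sx by exact: L1_sum.
have iSe : P.-L1 Se by apply: L1_sum => k; have [] := eta_tail_down k (a n).
have Ep : \int[P]_w rp w <= a n + 4 * (v * tau n) / a n.
  have := rmax_mart_mean mZ iZ pastKx pastS KxS aKx ixi ixi2 Exi Exi2 adown down1 n a0.
  congr (_ <= _ + 4 * (_ * _) / _); apply: eq_bigr => k _.
  by apply: eq_Rintegral => w _; rewrite down_sqr.
have Em : \int[P]_w rm w <= a n + 4 * (v * tau n) / a n.
  have := rmax_mart_mean mZ iZ pastKx pastS KxS aKx ixi ixi2 Exi Exi2 andown ndown1 n a0.
  congr (_ <= _ + 4 * (_ * _) / _); apply: eq_bigr => k _.
  by apply: eq_Rintegral => w _; rewrite /ndown mulN1r sqrrN down_sqr.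
have ESx : \int[P]_w Sx w = n%:R * tx (a n).
  rewrite mean_sum //; under eq_bigr do rewrite txE.
  by rewrite sumr_const card_ord mulr_natl.
have ESe : \int[P]_w Se w = tau n * te (a n).
  rewrite mean_sum => [|k]; last by have [] := eta_tail_down k (a n).
  by rewrite /tau mulr_suml; apply: eq_bigr => k _; have [] := eta_tail_down k (a n).
pose D w := q^-1 * (2 * (rp w + rm w) + ((a n)^-1 * Sx w + Se w) + 2 * a n).
have iD1 := L1_scale 2 (L1_add irp irm).
have iSx' := L1_scale (a n)^-1 iSx.
have iD2 := L1_add iSx' iSe.
have iD3 := L1_add (L1_add iD1 iD2) (L1_cst P (2 * a n)).
exists D.
  split; first exact: L1_scale.
  rewrite meanZ // meanD //; [|exact: L1_add|exact: L1_cst].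
  rewrite meanD // mean_cst meanZ; last exact: L1_add.
  rewrite meanD // meanD // meanZ // ESx ESe mulrC ler_pdivrMr //.
  have nq : n%:R = q ^+ 2 by rewrite sqr_sqrtr.
  have b1 : (a n)^-1 * (n%:R * tx (a n)) <= e / 6 * q.
    rewrite nq /a -/q invfM.
    have -> : ep^-1 * q^-1 * (q ^+ 2 * tx (ep * q)) = tx (ep * q) / ep * q.
      by field; rewrite !gt_eqF.
    rewrite ler_pM2r // ler_pdivrMr //.
    by have -> : e / 6 * ep = ep * e / 6 by ring.
  have b2 : tau n * te (a n) <= e / 6 * q.
    have te00 : 0 < e / (6 * C + 6) := ee.
    have h1 : tau n * te (a n) <= tau n * (e / (6 * C + 6)) by rewrite ler_wpM2l.
    have h2 : tau n * (e / (6 * C + 6)) <= C * q * (e / (6 * C + 6)).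
      by rewrite ler_wpM2r // ltW.
    apply: (le_trans h1 (le_trans h2 _)).
    have -> : C * q * (e / (6 * C + 6)) = C * (e / (6 * C + 6)) * q by ring.
    rewrite ler_pM2r // mulrA ler_pdivrMr; last by lra.
    by nra.
  have b3 : 4 * (v * tau n) / a n <= e / 24 * q.
    have h1 : 4 * (v * tau n) / a n <= 4 * (v * (C * q)) / a n.
      by rewrite ler_pM2r ?invr_gt0 // ler_pM2l // ler_wpM2l.
    apply: (le_trans h1).
    have -> : 4 * (v * (C * q)) / a n = 4 * v * C / ep.
      by rewrite /a -/q; field; rewrite !gt_eqF.
    rewrite ler_pdivrMr // in hc.
    have -> : 4 * v * C / ep = (16 * v * C / ep) / 4 by field; rewrite gt_eqF.
    rewrite ler_pdivrMr //; apply: (le_trans hc).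
    by rewrite le_eqVlt; apply/orP; left; apply/eqP; field.
  have aE : a n = e / 12 * q by [].
  by rewrite aE in Ep Em b1 b2 b3 *; lra.
have pos : {ae P, forall w, forall k, 0 < eta k w} by exact: ae_foralln.
apply: filterS pos => w hw.
have Sx0 : 0 <= Sx w by apply: sumr_ge0 => k _; rewrite mulr_ge0 // sqr_ge0.
have Se0 : 0 <= Se w.
  by apply: sumr_ge0 => k _; rewrite mulr_ge0 // mulr_ge0 // ltW.
have rp0 : 0 <= rp w by exact: rmax_ge0.
have rm0 : 0 <= rm w by exact: rmax_ge0.
have ia0 : 0 <= (a n)^-1 by rewrite invr_ge0 ltW.
have iS0 := mulr_ge0 ia0 Sx0.
split.
  rewrite mulr_ge0 ?invr_ge0 ?(ltW q0) //.
  by apply: addr_ge0; [apply: addr_ge0|]; [rewrite mulr_ge0 // addr_ge0|rewrite addr_ge0|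
    rewrite mulr_ge0 // ltW].
move=> t It.
have := @reflect_comparison R (xi ^~ w) (eta ^~ w) n (a n + (a n)^-1 * Sx w)
  (rp w + rm w) (a n + Se w) n0.
have A0 : 0 <= a n + (a n)^-1 * Sx w by rewrite addr_ge0 // ltW.
have E0 : 0 <= a n + Se w by rewrite addr_ge0 // ltW.
have De0 : 0 <= rp w + rm w by rewrite addr_ge0.
move=> /(_ A0 E0 De0) h.
have {}h := h (fun k _ => ltW (hw k)).
apply: le_trans (h _ _ _ t It) _.
- move=> k kn; apply: (le_trans (indic_le_sqr (xi k w) a0)); rewrite lerD2l.
  rewrite mulrC ler_wpM2l // /Sx (bigD1 (Ordinal kn)) //= lerDl sumr_ge0 // => j _.
  by rewrite mulr_ge0 // sqr_ge0.
- move=> k kn sk; have [ea|ae] := leP (eta k w) (a n).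
    by rewrite (le_trans ea) // lerDl.
  rewrite /Se (bigD1 (Ordinal kn)) //= /down sk ae mul1r mulr1 addrCA lerDl.
  rewrite addr_ge0 ?(ltW a0) // sumr_ge0 // => j _.
  by rewrite mulr_ge0 // mulr_ge0 // ltW.
- move=> k kn.
  have m0 : mart xi down 0 w = 0 by rewrite /mart big_ord0.
  have m0' : mart xi ndown 0 w = 0 by rewrite /mart big_ord0.
  have h1 := @le_rmax R (mart xi down ^~ w) n k m0 kn.
  have h2 := @le_rmax R (mart xi ndown ^~ w) n k m0' kn.
  rewrite -skippedE in h1; rewrite -nskippedE in h2.
  rewrite -/(rp w) in h1; rewrite -/(rm w) in h2.
  by rewrite ler_norml; apply/andP; split; lra.
rewrite /D mulrC ler_pM2l ?invr_gt0 // le_eqVlt; apply/orP; left; apply/eqP.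
ring.
Unshelve. all: by end_near. Qed.

End WalkEstimate.

(** * The reflected driftless walk and Brownian motion *)

Section GaussianMeans.
Context (R : realType).
Notation N01 := (normal_prob (0 : R) 1).

Lemma normal_prob_scale_L1 (s : R) (f : R -> R) : 0 < s -> continuous f ->
  N01.-L1 (fun x => f (s * x)) ->
  (normal_prob 0 s).-L1 f /\
  \int[normal_prob 0 s]_x f x = \int[N01]_x f (s * x).
Proof.
move=> s0 cf iF; have mf := continuous_measurable_fun cf.
have ca : continuous (fun x => `|f x|).
  by move=> x; have cfx : f z @[z --> x] --> f x := cf x; exact: (cvg_norm cfx).
split.
  apply/integrableP; split; first exact/measurable_EFinP.
  have -> : (\int[normal_prob 0 s]_x `|(EFin \o f) x|)%E =
      (\int[normal_prob 0 s]_x (`|f x|)%:E)%E by [].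
  by rewrite normal_prob_scale //; move/integrableP : iF => [].
by rewrite /Rintegral normal_prob_scale.
Qed.

End GaussianMeans.

(** * Gaussian steps read off from Brownian increments *)

Section Brownian.
Context (R : realType) d (T : measurableType d) (Q : probability T R).
Context (B : R -> {RV Q >-> R}) (hB : standard_brownian_motion B).
Notation N01 := (normal_prob (0 : R) 1).

Lemma bm_increment_mean (s t : R) (f : R -> R) : 0 <= s -> s < t ->
  continuous f -> N01.-L1 (fun x => f (Num.sqrt (t - s) * x)) ->
  Q.-L1 (fun w => f (B t w - B s w)) /\
  \int[Q]_w f (B t w - B s w) = \int[N01]_x f (Num.sqrt (t - s) * x).
Proof.
move=> s0 st cf iF; have d0 : 0 < Num.sqrt (t - s) by rewrite sqrtr_gt0 subr_gt0.
have [h1 h2] := normal_prob_scale_L1 d0 cf iF.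
have mB : measurable_fun setT (fun w => B t w - B s w) by exact: measurable_funB.
have law : same_law Q (normal_prob 0 (Num.sqrt (t - s)))
    (fun w => B t w - B s w) id.
  by move=> A mA; exact: (bm_gaussian_increments hB).
have [|h3 h4] := @same_law_mean _ _ _ Q _ _ _ _ _ mB _ law f
  (continuous_measurable_fun cf) h1.
  by move=> _ A mA; rewrite setTI; exact: mA.
split; first exact: h3.
rewrite -h2; exact h4.
Qed.

(* The stability N(0,1) = N(0,1/2) + N(0,1/2) gives m = sqrt 2 * m for the mean. *)
Lemma mean_normal_prob : \int[N01]_x x = 0.
Proof.
have cid : continuous (fun x : R => x) by move=> x; exact: cvg_id.
have i c : N01.-L1 (fun x => c * x) by exact: L1_scale (normal_prob_L1_id R).
have h : (0 : R) <= 1 / 2 by lra.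
have h' : (1 / 2 : R) < 1 by lra.
have h'' : (0 : R) < 1 / 2 by lra.
have [i1 e1] := bm_increment_mean (lexx 0) ltr01 cid (i _).
have [i2 e2] := bm_increment_mean (lexx 0) h'' cid (i _).
have [i3 e3] := bm_increment_mean h h' cid (i _).
have E : \int[Q]_w (B 1 w - B 0 w) =
    \int[Q]_w (B (1 / 2) w - B 0 w) + \int[Q]_w (B 1 w - B (1 / 2) w).
  rewrite -meanD //; apply: eq_Rintegral => w _; ring.
rewrite e1 e2 e3 in E.
have s2 : (1 : R) - 1 / 2 = 1 / 2 by field.
rewrite subr0 s2 subr0 sqrtr1 in E.
rewrite !meanZ in E; [|exact: normal_prob_L1_id ..].
set m := \int[N01]_x x in E *; set q := Num.sqrt (1 / 2) in E.
have qq : q ^+ 2 = 1 / 2 by rewrite sqr_sqrtr.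
have q0 : 0 <= q by exact: sqrtr_ge0.
have : m * (1 - 2 * q) = 0 by lra.
move/eqP; rewrite mulf_eq0 => /orP[/eqP //|/eqP h1].
have : q = 1 / 2 by lra.
by move=> qE; move: qq; rewrite qE expr2; lra.
Qed.

Variable sigma : R.

Lemma N01_L1_scale : N01.-L1 (fun x => sigma * x).
Proof. exact: L1_scale (normal_prob_L1_id R). Qed.

Lemma N01_L1_scale_sqr : N01.-L1 (fun x => (sigma * x) ^+ 2).
Proof.
by apply: L1_eq (L1_scale (sigma ^+ 2) (normal_prob_L1_sqr R)) => x; rewrite exprMn.
Qed.

Lemma N01_mean_scale : \int[N01]_x (sigma * x) = 0.
Proof. by rewrite meanZ ?mean_normal_prob ?mulr0 //; exact: normal_prob_L1_id. Qed.

Lemma N01_mean_scale_sqr : \int[N01]_x (sigma * x) ^+ 2 = sigma ^+ 2.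
Proof.
under eq_Rintegral do rewrite exprMn.
rewrite meanZ; last exact: normal_prob_L1_sqr.
by rewrite /Rintegral integral_normal_prob_sqr /= mulr1.
Qed.

Section Mesh.
Variable m : nat.
Hypothesis m0 : (0 < m)%N.

Definition bm_increment (i : nat) (w : T) : R :=
  B (i.+1%:R / m%:R) w - B (i%:R / m%:R) w.

Lemma bm_increment_indep : mutually_independent Q bm_increment.
Proof.
apply: (bm_indep_increments hB (t := fun i => i%:R / m%:R)).
  by rewrite mul0r.
by move=> i j ij; rewrite ler_pM2r ?invr_gt0 ?ltr0n // ler_nat.
Qed.

Lemma bm_increment_measurable i : measurable_fun setT (bm_increment i).
Proof. exact: measurable_funB. Qed.

(** The factor sqrt m undoes the variance 1 / m of a mesh increment, so a step is distributed as
    sigma times a standard normal variable, whatever m. *)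
Definition bm_step (i : nat) (w : T) : R :=
  sigma * (Num.sqrt m%:R * bm_increment i w).

Lemma bm_step_mean i L f : lips L f ->
  \int[Q]_w f (bm_step i w) = \int[N01]_x f (sigma * x).
Proof.
move=> fL; have mR : 0 < m%:R :> R by rewrite ltr0n.
have i0 : 0 <= i%:R / m%:R :> R by rewrite divr_ge0.
have ii : i%:R / m%:R < i.+1%:R / m%:R :> R by rewrite ltr_pM2r ?invr_gt0 // ltr_nat.
pose g x := f (sigma * (Num.sqrt m%:R * x)).
have gL : lips (L * `|sigma * Num.sqrt m%:R|) g.
  move=> x y; apply: (le_trans (fL _ _)); rewrite -mulrA -normrM.
  by rewrite ler_wpM2l ?(lips_ge0 fL) // le_eqVlt; apply/orP; left; apply/eqP; congr `|_|; ring.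
have dE : i.+1%:R / m%:R - i%:R / m%:R = m%:R^-1 :> R.
  by rewrite -mulrBl -natr1 addrAC subrr add0r mul1r.
have E x : g (Num.sqrt (i.+1%:R / m%:R - i%:R / m%:R) * x) = f (sigma * x).
  rewrite /g dE sqrtrV ?(ltW mR) // mulrA mulfV ?mul1r // gt_eqF //.
  by rewrite sqrtr_gt0.
have [_] := bm_increment_mean i0 ii (lipschitz_continuous gL)
  (lips_L1 gL (L1_scale _ (normal_prob_L1_id R))).
by move=> ->; apply: eq_Rintegral => x _; rewrite E.
Qed.

Lemma bm_step_L1 i : Q.-L1 (bm_step i).
Proof.
have mR : 0 < m%:R :> R by rewrite ltr0n.
have i0 : 0 <= i%:R / m%:R :> R by rewrite divr_ge0.
have ii : i%:R / m%:R < i.+1%:R / m%:R :> R by rewrite ltr_pM2r ?invr_gt0 // ltr_nat.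
have cid : continuous (fun x : R => x) by move=> x; exact: cvg_id.
have [h _] := bm_increment_mean i0 ii cid (L1_scale _ (normal_prob_L1_id R)).
by apply: L1_scale; exact: L1_scale.
Qed.

Lemma bm_step_adapted i : adapted bm_increment [set i] (bm_step i).
Proof.
have a0 := @adapted_index _ _ _ _ bm_increment [set i] i erefl.
exact: (adaptedM (@adapted_cst _ _ _ _ _ _ sigma)
  (adaptedM (@adapted_cst _ _ _ _ _ _ (Num.sqrt m%:R)) a0)).
Qed.

End Mesh.

(** Stability of the Gaussian law under sums, without convolutions: the iterate is the mean over n
    increments of [B] on the mesh 1 / n, and these telescope to B 1 - B 0. *)
Lemma iter_shift_normal (n : nat) L f : (0 < n)%N -> lips L f ->
  iter n (shift_mean N01 (fun x => sigma * x) (Num.sqrt n%:R)^-1) f 0 =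
  \int[N01]_x f (sigma * x).
Proof.
move=> n0 fL; pose J (i : nat) : set nat := [set j | (j < i)%N].
have JK i : J i `&` [set i] = set0.
  by apply/seteqP; split => // z [+ zE]; rewrite /J /= zE ltnn.
have JS i : J i `<=` J i.+1 by move=> j /=; exact: leqW.
have KS i : [set i] `<=` J i.+1 by move=> j ->; exact: ltnSn.
rewrite -(mean_sum_iter (bm_increment_measurable n) (bm_increment_indep n0)
  JK JS KS (@bm_step_adapted n) (bm_step_L1 n0) N01_L1_scale
  (fun i L f => @bm_step_mean n n0 i L f) n (Num.sqrt n%:R)^-1 0 fL).
have nR : 0 < n%:R :> R by rewrite ltr0n.
have gL : lips (L * `|sigma|) (fun x => f (sigma * x)).
  move=> x y; apply: (le_trans (fL _ _)); rewrite -mulrBr normrM mulrA.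
  by [].
have q0 : Num.sqrt (n%:R : R) != 0 by rewrite gt_eqF // sqrtr_gt0.
have i1 := lips_L1 gL (L1_scale (Num.sqrt (1 - 0)) (normal_prob_L1_id R)).
have [_ e1] := bm_increment_mean (lexx 0) ltr01 (lipschitz_continuous gL) i1.
transitivity (\int[Q]_w f (sigma * (B 1 w - B 0 w))).
  apply: eq_Rintegral => w _; congr f; rewrite add0r /bm_step.
  rewrite -mulr_sumr -mulr_sumr /bm_increment.
  rewrite (_ : \sum_(i < n) _ = B 1 w - B 0 w); last first.
    rewrite -(big_mkord xpredT (fun i => B (i.+1%:R / n%:R) w - B (i%:R / n%:R) w)).
    by rewrite (telescope_sumr (fun i => B (i%:R / n%:R) w)) // mul0r divff // gt_eqF.
  by field.
rewrite e1; apply: eq_Rintegral => x _.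
by rewrite subr0 sqrtr1 mul1r.
Qed.

End Brownian.

(** * Functionals of walk paths and their mesh approximation *)

Section WalkPaths.
Context (R : realType).
Implicit Types (s u : nat -> R) (F : C01 R -> R).

Definition reflected_path s n : C01 R :=
  path01 (reflect_continuous (rescaled_continuous (s := s) (n := n))).

Lemma rescaled_dist s s' n (e t : R) : unitI R t ->
  (forall k, (k <= n)%N -> `|s k - s' k| <= e) ->
  `|interpolate s (n%:R * t) / Num.sqrt n%:R -
    interpolate s' (n%:R * t) / Num.sqrt n%:R| <= e / Num.sqrt n%:R.
Proof.
rewrite /unitI /= in_itv /= => /andP[t0 t1] h.
have [->|n0] := posnP n; first by rewrite sqrtr0 invr0 !mulr0 subrr normr0.
have nR : 0 < n%:R :> R by rewrite ltr0n.
rewrite -mulrBl normrM [X in _ * X]ger0_norm ?invr_ge0 ?sqrtr_ge0 //.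
rewrite ler_wpM2r ?invr_ge0 ?sqrtr_ge0 //.
have [||k [th [kn _ _ /andP[th0 th1] E]]] := @interpolate_conv R n (n%:R * t) n0.
- by rewrite mulr_ge0.
- by rewrite ler_piMr.
have := h _ kn; have := h _ (ltnW kn); rewrite !E !ler_norml.
by move=> /andP[a b] /andP[a' b']; apply/andP; split; nra.
Qed.

Lemma rescaled_path_dist s s' n L F (e : R) : lipC L F -> 0 <= e ->
  (forall k, (k <= n)%N -> `|s k - s' k| <= e) ->
  `|F (rescaled_path s n) - F (rescaled_path s' n)| <= L * (e / Num.sqrt n%:R).
Proof.
move=> hF e0 h; apply: lipC_path01 => // [|t It].
  by rewrite divr_ge0 ?sqrtr_ge0.
exact: rescaled_dist.
Qed.

Lemma reflected_path_dist s s' n L F (e : R) : lipC L F -> 0 <= e ->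
  (forall k, (k <= n)%N -> `|s k - s' k| <= e) ->
  `|F (reflected_path s n) - F (reflected_path s' n)| <=
    L * (2 * (e / Num.sqrt n%:R)).
Proof.
move=> hF e0 h; have e1 : 0 <= e / Num.sqrt n%:R by rewrite divr_ge0 ?sqrtr_ge0.
apply: lipC_path01 => // [|t It]; first by rewrite mulr_ge0.
apply: reflect_dist It; [exact: rescaled_continuous..|].
by move=> z Iz; exact: rescaled_dist.
Qed.

Lemma lip1_rescaled_path n L F : 0 <= L -> lipC L F ->
  lip1 n.+1 (L / Num.sqrt n%:R) (fun s => F (rescaled_path s n)).
Proof.
move=> L0 hF; split=> [|s s']; first by rewrite divr_ge0 ?sqrtr_ge0.
rewrite mulrAC -mulrA; apply: rescaled_path_dist => // [|k kn].
  by rewrite sumr_ge0.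
rewrite -ltnS in kn; rewrite (bigD1 (Ordinal kn)) //= lerDl.
by rewrite sumr_ge0.
Qed.

Definition walk_functional m F u := F (reflected_path (free_walk u) m).

Lemma lip1_walk_functional m L F : 0 <= L -> lipC L F ->
  lip1 m (L * (2 / Num.sqrt m%:R)) (walk_functional m F).
Proof.
move=> L0 hF; have q0 : 0 <= Num.sqrt m%:R :> R by rewrite sqrtr_ge0.
split=> [|u v]; first by rewrite mulr_ge0 // divr_ge0.
rewrite -mulrA mulrAC -[2 * _ / _]mulrA.
apply: reflected_path_dist => // [|k km]; first by rewrite sumr_ge0.
rewrite /free_walk -sumrB; apply: (le_trans (ler_norm_sum _ _ _)).
rewrite -(subnKC km) big_split_ord /= lerDl sumr_ge0 //.
Qed.

End WalkPaths.

(** [adapted_lip1] with every index set equal to all of nat, where the inclusions are trivial. *)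
Lemma lip1_measurable (R : realType) d (T : measurableType d) (V : nat -> T -> R)
    m L H : (forall i, measurable_fun setT (V i)) -> lip1 m L H ->
  measurable_fun setT (fun w => H (V ^~ w)).
Proof.
move=> mV hH.
have aV i : adapted V setT (V i) by exact: (@adapted_index _ _ _ _ V setT i).
have sT (i : nat) : (setT : set nat) `<=` setT by [].
have := adapted_measurable mV
  (@adapted_lip1 _ T R _ V (fun=> setT) (fun=> setT) V sT sT aV m L H m (fun=> 0) hH).
by apply: eq_measurable_fun => w _; apply: (lip1_eq hH) => j ->.
Qed.

Section MeshFunctional.
Context (R : realType).
Implicit Types (x : nat -> R) (F : C01 R -> R).

Lemma free_walk_blocks x l (c : R) k :
  free_walk (fun j => c * \sum_(i < l) x (j * l + i)%N) k = c * free_walk x (k * l).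
Proof.
rewrite /free_walk; elim: k => [|k IH]; first by rewrite !big_ord0 mulr0.
by rewrite big_ord_recr /= IH mulSnr big_split_ord /= mulrDr.
Qed.

(** Dichotomy on the blocks: if some oscillation is large, the trivial bound 2 M applies; otherwise
    [mesh_comparison] with osc = 2 de sqrt n puts the free paths within 8 de, and reflection doubles
    this. There are m + 1 blocks because n may exceed m l, and two signs because [rmax] is
    one-sided. *)
Lemma mesh_functional x L (M : R) F (de : R) n m l : lipC L F -> 0 <= L ->
  (forall y, `|F y| <= M) -> 0 < de -> (0 < m)%N -> (m <= l)%N -> (m * l <= n)%N ->
  (n < m * l.+1)%N ->
  `|walk_functional n F x - walk_functional m F
      (fun j => (Num.sqrt l%:R)^-1 * \sum_(i < l) x (j * l + i)%N)| <=
  L * (16 * de) + 2 * M * \sum_(j < m.+1)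
    ((2 * (de * Num.sqrt n%:R) <=
       rmax (fun k => 1 * \sum_(i < k) x (j * l + i)%N) l)%R%:R +
     (2 * (de * Num.sqrt n%:R) <=
       rmax (fun k => - 1 * \sum_(i < k) x (j * l + i)%N) l)%R%:R).
Proof.
move=> hF L0 FM de0 m0 ml n1 n2.
have M0 : 0 <= M by exact: (le_trans (normr_ge0 _) (FM (reflected_path x n))).
have n0 : (0 < n)%N by apply: leq_trans n1; rewrite muln_gt0 m0 (leq_trans m0).
have qn0 : 0 < Num.sqrt n%:R :> R by rewrite sqrtr_gt0 ltr0n.
set lam := 2 * (de * Num.sqrt n%:R).
pose b c (j : nat) := lam <= rmax (fun k => c * \sum_(i < k) x (j * l + i)%N) l.
have ind0 (j : 'I_m.+1) : 0 <= (b 1 j)%:R + (b (- 1) j)%:R :> R by rewrite addr_ge0.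
have [/existsP[j hj]|/existsPn h] := boolP [exists j : 'I_m.+1, b 1 j || b (- 1) j].
  apply: (@le_trans _ _ (2 * M)).
    apply: (le_trans (ler_normB _ _)).
    have := FM (reflected_path (free_walk x) n); rewrite /walk_functional.
    set y := reflected_path (free_walk (fun _ => _)) m; have := FM y; lra.
  apply: (@le_trans _ _ (2 * M * \sum_(j < m.+1) ((b 1 j)%:R + (b (- 1) j)%:R))).
    rewrite ler_peMr ?mulr_ge0 // (bigD1 j) //= ler_wpDr //.
      by apply: sumr_ge0 => i _; exact: ind0.
    by move: hj; case: (b 1 j); case: (b (- 1) j) => //= _; lra.
  by rewrite lerDr mulr_ge0 // mulr_ge0 // ltW.
have osc j k : (j <= m)%N -> (k <= l)%N ->
    `|free_walk x (j * l + k) - free_walk x (j * l)| <= lam.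
  rewrite -ltnS => jm kl; have := h (Ordinal jm); rewrite negb_or /b -!ltNge /=.
  have -> : free_walk x (j * l + k) - free_walk x (j * l) =
      \sum_(i < k) x (j * l + i)%N.
    by rewrite /free_walk big_split_ord /= addrAC subrr add0r.
  have z c : c * \sum_(i < k) x (j * l + i)%N <=
      rmax (fun k => c * \sum_(i < k) x (j * l + i)%N) l.
    by apply: (@le_rmax R (fun k => _ * \sum_(i < k) _)) => //; rewrite big_ord0 mulr0.
  have := z 1; have := z (- 1); move=> h1 h2 /andP[h3 h4].
  by rewrite ler_norml; apply/andP; split; lra.
apply: (@le_trans _ _ (L * (16 * de))); last first.
  rewrite lerDl mulr_ge0 ?mulr_ge0 // sumr_ge0 // => j _; exact: ind0.
have -> : 16 * de = 2 * (8 * de) by ring.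
have d8 : 0 <= 8 * de by rewrite mulr_ge0 // ltW.
apply: lipC_path01 => // [|t It]; first by rewrite mulr_ge0.
apply: reflect_dist It; [exact: rescaled_continuous|exact: rescaled_continuous|].
move=> u Iu.
have S0 : free_walk x 0 = 0 by rewrite /free_walk big_ord0.
have := mesh_comparison S0 m0 ml n1 n2 osc Iu.
have -> : 4 * lam / Num.sqrt n%:R = 8 * de by rewrite /lam; field; rewrite gt_eqF.
congr (`|_ - _ / _| <= _); congr interpolate; apply/funext => k.
by rewrite free_walk_blocks mulrC.
Qed.

End MeshFunctional.

Section MeshLimit.
Context (R : realType).
Implicit Types (f g : R -> R).

Lemma uniformly_continuous01 g (e : R) : {within unitI R, continuous g} -> 0 < e ->
  exists2 de : R, 0 < de &
    forall s t, unitI R s -> unitI R t -> `|s - t| < de -> `|g s - g t| <= e.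
Proof.
move=> /subspace_continuousP cg e0.
have /compact_near_coveringP /near_covering_withinP cK := @segment_compact R 0 1.
have [|de /= de0 h] := cK R (0 : R)^'+ (fun de t => forall s, unitI R s ->
    `|s - t| < de -> `|g s - g t| <= e).
  move=> x Kx; have e2 : 0 < e / 2 by rewrite divr_gt0.
  have /cvgrPdist_lt /(_ _ e2) := cg x Kx.
  move=> /nbhs_ballP [r /= r0 hr].
  have r2 : 0 < r / 2 by rewrite divr_gt0.
  exists (ball x (r / 2), [set de | de < r / 2]) => [|[t de] /= [xt der] Kt s Ks st].
    by split; [exact: nbhsx_ballx|exact: nbhs_right_lt].
  have h1 : `|g x - g t| < e / 2.
    by apply: hr => //=; rewrite /ball /= in xt *; lra.
  have h2 : `|g x - g s| < e / 2.
    apply: hr => //=; rewrite /ball /= in xt *.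
    apply: (le_lt_trans (ler_distD t _ _)); rewrite (distrC t s); lra.
  apply: (le_trans (ler_distD (g x) _ _)); rewrite (distrC (g s)); lra.
exists (de / 2) => [|s t Ks Kt st]; first by rewrite divr_gt0.
apply: (h (de / 2)) => //=.
- by rewrite /= sub0r normrN gtr0_norm ?divr_gt0 //; lra.
- by rewrite divr_gt0.
Qed.

(** The mesh path starts at 0 whereas g 0 is arbitrary, B 0 = 0 being known only almost surely;
    reflection does not see the difference. *)
Lemma reflect_shift f (c t : R) : {within unitI R, continuous f} -> unitI R t ->
  Defs.reflect (fun s => f s - c) t = Defs.reflect f t.
Proof.
move=> cf It.
have cfc : {within unitI R, continuous (fun s => f s - c)}.
  by move=> x; apply: cvgB; [exact: cf|exact: cvg_cst].
have [a1 a2] := reflect_inf cf It; have [b1 b2] := reflect_inf cfc It.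
rewrite /Defs.reflect; set i1 := inf _ in a1 a2 *; set i2 := inf _ in b1 b2 *.
have le1 : i1 - c <= i2 by apply: b2 => u tu; rewrite lerD2r; exact: a1.
have le2 : i2 + c <= i1 by apply: a2 => u tu; have := b1 u tu; lra.
lra.
Qed.

(** With these steps the rescaled free walk is the piecewise linear interpolation of g - g 0 on the
    mesh. The interpolation point lies within 1 / m of both mesh points used, strictly below 2 / m
    <= de. *)
Lemma mesh_path_cvg L (F : C01 R -> R) g (cg : {within unitI R, continuous g}) :
  0 <= L -> lipC L F ->
  walk_functional m F (fun i => Num.sqrt m%:R * (g (i.+1%:R / m%:R) - g (i%:R / m%:R)))
    @[m --> \oo] --> F (path01 (reflect_continuous cg)).
Proof.
move=> L0 hF; apply/cvgrPdist_le => e e0.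
pose e' := e / (2 * L + 1).
have e'0 : 0 < e' by rewrite divr_gt0 // ltr_wpDl // mulr_ge0.
have [de de0 hde] := uniformly_continuous01 cg e'0.
near=> m.
have m0 : (0 < m)%N by near: m; exact: nbhs_infty_gt.
have mR : 0 < m%:R :> R by rewrite ltr0n.
have md : 2 / de <= m%:R by near: m; exact: nbhs_infty_ger.
have {}md : 2 / m%:R <= de.
  by rewrite ler_pdivrMr // mulrC -ler_pdivrMr.
have Le : L * (2 * e') <= e.
  rewrite /e' mulrA mulrA ler_pdivrMr ?ltr_wpDl ?mulr_ge0 //.
  by have h := e0; nra.
apply: le_trans Le; rewrite distrC; apply: lipC_path01 => // [|t It].
  by rewrite mulr_ge0 // ltW.
rewrite -(reflect_shift (g 0) cg It).
have cgc : {within unitI R, continuous (fun s => g s - g 0)}.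
  by move=> x; apply: cvgB; [exact: cg|exact: cvg_cst].
apply: reflect_dist It; [exact: rescaled_continuous|exact: cgc|].
move=> u Iu; set x := free_walk _.
have q0 : 0 < Num.sqrt m%:R :> R by rewrite sqrtr_gt0.
have xE k : x k / Num.sqrt m%:R = g (k%:R / m%:R) - g 0.
  rewrite /x /free_walk -mulr_sumr.
  rewrite -(big_mkord xpredT (fun i => g (i.+1%:R / m%:R) - g (i%:R / m%:R))).
  rewrite (telescope_sumr (fun i => g (i%:R / m%:R))) // mul0r.
  by field; rewrite gt_eqF.
have Iu' := Iu; move: Iu'; rewrite /unitI /= in_itv /= => /andP[u0 u1].
have [||k [th [km /andP[k1 k2] _ /andP[th0 th1] E]]] := @interpolate_conv R m (m%:R * u) m0.
- by rewrite mulr_ge0 // ltW.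
- by rewrite ler_piMr // ltW.
rewrite E.
have -> : ((1 - th) * x k + th * x k.+1) / Num.sqrt m%:R =
    (1 - th) * (g (k%:R / m%:R) - g 0) + th * (g (k.+1%:R / m%:R) - g 0).
  by rewrite -!xE; ring.
have close (j : nat) : (j <= m)%N -> j%:R <= m%:R * u + 1 -> m%:R * u <= j%:R + 1 ->
    `|g (j%:R / m%:R) - g u| <= e'.
  move=> jm j1 j2; apply: hde => //.
    by rewrite /unitI /= in_itv /= divr_ge0 //= ler_pdivrMr // mul1r ler_nat.
  apply: (@lt_le_trans _ _ (2 / m%:R)) => //; rewrite ltr_pdivlMr //.
  rewrite -[X in _ * X](gtr0_norm mR) -normrM mulrBl divfK ?gt_eqF // ltr_norml.
  by rewrite [u * _]mulrC; apply/andP; split; lra.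
rewrite -[k.+1%:R]natr1 in k2.
have := close k (ltnW km); have := close k.+1 km; rewrite -natr1.
move=> c1 c2; have {}c1 : `|g ((k%:R + 1) / m%:R) - g u| <= e' by apply: c1; lra.
have {}c2 : `|g (k%:R / m%:R) - g u| <= e' by apply: c2; lra.
move: c1 c2; rewrite !ler_norml => /andP[p1 p2] /andP[p3 p4].
by apply/andP; split; nra.
Unshelve. all: by end_near. Qed.

End MeshLimit.

Lemma lips_max (R : realType) (c a : R) : `|c| <= 1 ->
  lips 1 (fun y : R => Num.max (c * y - a) 0).
Proof.
move=> c1 x y; rewrite mul1r.
have : `|c * x - c * y| <= `|x - y| by rewrite -mulrBr normrM ler_piMl.
have [] := leP (c * x - a) 0; have [] := leP (c * y - a) 0; rewrite !ler_norml.
- by move=> _ _ _; rewrite subrr oppr_le0 normr_ge0.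
- by move=> h1 h2 /andP[h3 h4]; apply/andP; split; lra.
- by move=> h1 h2 /andP[h3 h4]; apply/andP; split; lra.
- by move=> h1 h2 /andP[h3 h4]; apply/andP; split; lra.
Qed.

(** * Invariance principle for the driftless walk *)

Section FreeWalk.
Context d (T : measurableType d) (R : realType) (P : probability T R).
Variables (V : nat -> T -> R) (sigma : R).
Hypothesis mV : forall k, measurable_fun setT (V k).
Hypothesis iV : mutually_independent P V.
Hypotheses (iV1 : forall k, P.-L1 (V k)) (iV2 : forall k, P.-L1 (fun w => V k w ^+ 2)).
Hypotheses (EV : forall k, \int[P]_w V k w = 0)
  (EV2 : forall k, \int[P]_w V k w ^+ 2 = sigma ^+ 2).
Hypothesis lawV : forall k L f, lips L f ->
  \int[P]_w f (V k w) = \int[P]_w f (V 0%N w).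
Context d' (T' : measurableType d') (Q : probability T' R).
Context (B : R -> {RV Q >-> R}) (hB : standard_brownian_motion B).
Notation N01 := (normal_prob (0 : R) 1).

Section Block.
Variable a : nat.

Let past (i : nat) : set nat := [set j | (j < a + i)%N].
Let now (i : nat) : set nat := [set (a + i)%N].
Let X (i : nat) := V (a + i).

Let past_now i : past i `&` now i = set0.
Proof. by apply/seteqP; split => // z [+ zE]; rewrite /past /= zE ltnn. Qed.

Let pastS i : past i `<=` past i.+1.
Proof. by move=> j /=; rewrite /past /= addnS; exact: leqW. Qed.

Let now_past i : now i `<=` past i.+1.
Proof. by move=> j ->; rewrite /past /= addnS. Qed.

Let aX i : adapted V (now i) (X i).
Proof. exact: (@adapted_index _ _ _ _ V (now i) (a + i)%N erefl). Qed.

Let iX i : P.-L1 (X i). Proof. exact: iV1. Qed.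
Let EX i : \int[P]_w X i w = 0. Proof. exact: EV. Qed.

Lemma block_sum_iter n L f c : lips L f ->
  \int[P]_w f (c * \sum_(i < n) V (a + i) w) = iter n (shift_mean P (V 0%N) c) f 0.
Proof.
move=> fL; rewrite -(mean_sum_iter mV iV past_now pastS now_past aX iX (iV1 0)
  (fun i L f => @lawV (a + i)%N L f) n c 0 fL).
by apply: eq_Rintegral => w _; rewrite add0r.
Qed.

(** A constant multiplier c is used; later c is 1 or -1, to cover both signs of the oscillation. *)
Lemma block_weak (c : R) n (lam : R) : `|c| <= 1 -> 0 < lam ->
  lam * \int[P]_w (2 * lam <= rmax (fun k => c * \sum_(i < k) V (a + i) w) n)%R%:R <=
    \int[P]_w Num.max (c * \sum_(i < n) V (a + i) w - lam) 0.
Proof.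
move=> c1 lam0; pose b (k : nat) (w : T) := c.
have ab k : adapted V (past k) (b k) by exact: adapted_cst.
have b1 k w : `|b k w| <= 1 by [].
have E : (fun k w => c * \sum_(i < k) V (a + i) w) = mart X b.
  by apply/funext => k; apply/funext => w; rewrite mulr_sumr.
have := rmax_mart_weak mV iV past_now pastS now_past aX iX EX ab b1 n lam0.
by rewrite -E.
Qed.

Lemma block_indic_L1 (c : R) n (lam : R) :
  P.-L1 (fun w => (lam <= rmax (fun k => c * \sum_(i < k) V (a + i) w) n)%R%:R).
Proof.
pose b (k : nat) (w : T) := c.
have ab k : adapted V (past k) (b k) by exact: adapted_cst.
have E w : (fun k => c * \sum_(i < k) V (a + i) w) = mart X b ^~ w.
  by apply/funext => k; rewrite mulr_sumr.
apply: (@L1_bounded _ _ _ _ _ 1) => [|w].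
  under eq_fun do rewrite E.
  apply: (adapted_measurable mV (adapted_indic (@adapted_cst _ _ _ _ V (past n) lam)
    (@adapted_rmax _ _ _ _ V past (mart X b) n pastS _))) => k.
  exact: (adapted_mart pastS now_past aX ab).
by case: (lam <= _); rewrite ?normr1 ?normr0 ?ler01.
Qed.

End Block.

(** [N] is uniform in the test function and in the offset a of the block, whose mean reduces to the
    same iterate. *)
Lemma block_clt (L e : R) : 0 <= L -> 0 < e ->
  exists N, forall n a f, (N <= n)%N -> lips L f ->
    `|\int[P]_w f ((Num.sqrt n%:R)^-1 * \sum_(i < n) V (a + i) w) -
      \int[N01]_x f (sigma * x)| <= e.
Proof.
move=> L0 e0.
have EVN : \int[P]_w V 0%N w ^+ 2 = \int[N01]_x (sigma * x) ^+ 2.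
  by rewrite EV2 N01_mean_scale_sqr.
have [N hN] := lindeberg_clt (iV1 0) (iV2 0) (N01_L1_scale sigma)
  (N01_L1_scale_sqr sigma) (EV 0) (N01_mean_scale hB sigma) EVN L0 e0.
exists N.+1 => n a f Nn fL.
rewrite (block_sum_iter a n _ fL).
have n0 : (0 < n)%N by exact: leq_trans Nn.
by have := hN n f (ltnW Nn) fL; rewrite (iter_shift_normal hB sigma n0 fL).
Qed.

Let tail (a : R) := \int[N01]_x ((sigma * x) ^+ 2 * (a < `|sigma * x|)%R%:R).

Lemma tail_L1 (a : R) : N01.-L1 (fun x => (sigma * x) ^+ 2 * (a < `|sigma * x|)%R%:R).
Proof.
apply: L1_indic; first exact: N01_L1_scale_sqr.
exact: (L1_measurable (L1_norm (N01_L1_scale sigma))).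
Qed.

Lemma max_tail (c a : R) : `|c| <= 1 -> 0 < a ->
  \int[N01]_x Num.max (c * (sigma * x) - a) 0 <= tail a / a.
Proof.
move=> c1 a0.
have i1 := N01_L1_scale sigma.
have i2 : N01.-L1 (fun x => a^-1 * ((sigma * x) ^+ 2 * (a < `|sigma * x|)%R%:R)).
  exact: L1_scale (tail_L1 a).
have fL := lips_max a c1.
rewrite mulrC -(meanZ a^-1 (tail_L1 a)).
apply: (@le_mean _ _ _ _ _ _ (lips_L1 fL i1) i2) => x.
have h := indic_le_sqr (sigma * x) a0.
have cx : c * (sigma * x) <= `|sigma * x|.
  by rewrite (le_trans (ler_norm _)) // normrM ler_piMl.
have p : 0 <= a^-1 * ((sigma * x) ^+ 2 * (a < `|sigma * x|)%R%:R).
  by rewrite mulr_ge0 ?invr_ge0 ?(ltW a0) // mulr_ge0 // sqr_ge0.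
rewrite ge_max p andbT lerBlDl [X in _ + X]mulrC.
exact: (le_trans cx h).
Qed.

(** Doob's weak inequality at level de sqrt n, rescaled by sqrt l: since sqrt (m l) <= sqrt n, the
    level becomes at least de sqrt m. The central limit theorem makes the block sum Gaussian up to
    e, and [max_tail] gives a tail with the factor 1 / m, so that summing over the blocks leaves a
    quantity vanishing as m grows. *)
Lemma block_prob (de e : R) m : 0 < de -> 0 < e -> (0 < m)%N ->
  exists N, forall n l a c, (N <= l)%N -> (m * l <= n)%N -> `|c| <= 1 ->
    \int[P]_w (2 * (de * Num.sqrt n%:R) <=
      rmax (fun k => c * \sum_(i < k) V (a + i) w) l)%R%:R <=
    tail (de * Num.sqrt m%:R) / (de ^+ 2 * m%:R) + e / (de * Num.sqrt m%:R).
Proof.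
move=> de0 e0 m0; have [N hN] := block_clt ler01 e0.
exists N.+1 => n l a c Nl mln c1.
have l0 : (0 < l)%N by exact: leq_trans Nl.
have n0 : (0 < n)%N by apply: leq_trans mln; rewrite muln_gt0 m0.
have mR : 0 < m%:R :> R by rewrite ltr0n.
have lR : 0 < l%:R :> R by rewrite ltr0n.
have nR : 0 < n%:R :> R by rewrite ltr0n.
set qm := Num.sqrt m%:R; set qn := Num.sqrt n%:R; pose ql : R := Num.sqrt l%:R.
have qm0 : 0 < qm by rewrite sqrtr_gt0.
have qn0 : 0 < qn by rewrite sqrtr_gt0.
have ql0 : 0 < ql by rewrite sqrtr_gt0.
have qmE : qm ^+ 2 = m%:R by rewrite sqr_sqrtr // ltW.
have qq : qm * ql <= qn.
  by rewrite -sqrtrM ?(ltW mR) // ler_sqrt // -natrM ler_nat.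
set a' := de * qm; have a0 : 0 < a' by rewrite mulr_gt0.
have lam0 : 0 < de * qn by rewrite mulr_gt0.
pose f (y : R) := Num.max (c * y - a') 0.
have fL : lips 1 f by exact: lips_max.
have w1 := block_weak a l c1 lam0.
have iS : P.-L1 (fun w => \sum_(i < l) V (a + i) w) by apply: L1_sum => i.
have iF : P.-L1 (fun w => f (ql^-1 * \sum_(i < l) V (a + i) w)).
  exact: lips_L1 fL (L1_scale _ iS).
have gL := lips_max (de * qn) c1.
have w2 : \int[P]_w Num.max (c * \sum_(i < l) V (a + i) w - de * qn) 0 <=
    ql * \int[P]_w f (ql^-1 * \sum_(i < l) V (a + i) w).
  rewrite -(meanZ ql iF); apply: le_mean (lips_L1 gL iS) (L1_scale ql iF) _ => w /=.
  rewrite /f; set s := \sum_(i < l) _.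
  have [f1 f2] : c * (ql^-1 * s) - a' <= Num.max (c * (ql^-1 * s) - a') 0 /\
      0 <= Num.max (c * (ql^-1 * s) - a') 0 by rewrite !le_max !lexx orbT.
  rewrite ge_max (mulr_ge0 (ltW ql0) f2) andbT.
  apply: (@le_trans _ _ (ql * (c * (ql^-1 * s) - a'))); last by rewrite ler_pM2l.
  have -> : ql * (c * (ql^-1 * s) - a') = c * s - de * (qm * ql).
    by rewrite /a'; field; rewrite gt_eqF.
  by rewrite lerD2l lerN2 ler_pM2l.
have w3 := hN l a f (ltnW Nl) fL; rewrite -/ql in w3.
have w4 := max_tail c1 a0.
set p := \int[P]_w _ in w1 *.
set y := \int[P]_w f _ in w2 w3.
have y1 : y <= tail a' / a' + e.
  by move: w3; rewrite ler_norml => /andP[_ w3]; rewrite /f in w3; lra.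
have p1 : p * (de * qn) <= ql * (tail a' / a' + e).
  rewrite mulrC; apply: (le_trans w1); apply: (le_trans w2).
  by rewrite ler_pM2l.
have p0 : 0 <= p by apply: mean_ge0 => w.
have p2 : p * a' <= tail a' / a' + e.
  rewrite -(ler_pM2l ql0); apply: le_trans p1.
  have -> : ql * (p * a') = p * (de * (qm * ql)) by rewrite /a'; ring.
  by rewrite ler_wpM2l // ler_pM2l.
have -> : tail a' / (de ^+ 2 * m%:R) + e / a' = (tail a' / a' + e) / a'.
  by rewrite -qmE /a'; field; rewrite !gt_eqF.
by rewrite ler_pdivlMr.
Qed.

Lemma walk_functional_L1 m L (M : R) F (W : nat -> T -> R) : 0 <= L -> lipC L F ->
  (forall y, `|F y| <= M) -> (forall i, measurable_fun setT (W i)) ->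
  P.-L1 (fun w => walk_functional m F (W ^~ w)).
Proof.
move=> L0 hF FM mW; apply: (@L1_bounded _ _ _ _ _ M) => [|w]; last exact: FM.
exact: lip1_measurable mW (lip1_walk_functional m L0 hF).
Qed.

Section Blocks.
Variable l : nat.
Hypothesis l0 : (0 < l)%N.

Let past (j : nat) : set nat := [set i | (i < j * l)%N].
Let now (j : nat) : set nat := [set i | (j * l <= i < j.+1 * l)%N].

Definition block (j : nat) (w : T) : R :=
  (Num.sqrt l%:R)^-1 * \sum_(i < l) V (j * l + i) w.

Let past_now j : past j `&` now j = set0.
Proof.
apply/seteqP; split => // z [].
by rewrite /past /now /= ltnNge => /negP h /andP[/h].
Qed.

Let pastS j : past j `<=` past j.+1.
Proof. by move=> z; rewrite /past /= mulSn => /leq_trans; apply; exact: leq_addl. Qed.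

Let now_past j : now j `<=` past j.+1.
Proof. by move=> z; rewrite /now /past /= => /andP[]. Qed.

Let ablock j : adapted V (now j) (block j).
Proof.
apply: (adaptedM (@adapted_cst _ _ _ _ V (now j) (Num.sqrt l%:R)^-1)).
apply: (@adapted_sum _ _ _ _ V (now j) l (fun i => V (j * l + i)%N)) => i il.
apply: (@adapted_index _ _ _ _ V (now j)).
by rewrite /now /= leq_addr mulSn addnC ltn_add2r.
Qed.

Lemma block_L1 j : P.-L1 (block j).
Proof. by apply: L1_scale; apply: L1_sum => i. Qed.

Lemma block_comparison m L F (e : R) : (0 < m)%N -> 0 <= L -> lipC L F ->
  (forall j f, lips (L * (2 / Num.sqrt m%:R)) f ->
    `|\int[P]_w f (block j w) - \int[N01]_x f (sigma * x)| <= e) ->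
  `|\int[P]_w walk_functional m F (block ^~ w) -
    \int[Q]_w walk_functional m F (bm_step B sigma m ^~ w)| <= m%:R * e.
Proof.
move=> m0 L0 hF h; pose J (i : nat) : set nat := [set j | (j < i)%N].
have JK i : J i `&` [set i] = set0.
  by apply/seteqP; split => // z [+ zE]; rewrite /J /= zE ltnn.
have JS i : J i `<=` J i.+1 by move=> j /=; exact: leqW.
have KS i : [set i] `<=` J i.+1 by move=> j ->; exact: ltnSn.
apply: (tensor_comparison mV iV past_now pastS now_past ablock block_L1
  (bm_increment_measurable B m) (bm_increment_indep hB m0) JK JS KS
  (@bm_step_adapted _ _ _ _ B sigma m) (bm_step_L1 hB sigma m0)
  (lip1_walk_functional m L0 hF)) => j f fL.
by rewrite (bm_step_mean hB sigma m0 j fL); exact: h.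
Qed.

End Blocks.

(** The factor 8 M is 2 M from the bound on F, times 2 for the two signs, times 2 from m + 1 <= 2 m.
    As m is fixed before n, the central limit errors can be taken as small as m requires. *)
Lemma mesh_mean L (M : R) F (de e : R) m : lipC L F -> 0 <= L ->
  (forall y, `|F y| <= M) -> 0 < de -> 0 < e -> (0 < m)%N ->
  exists N, forall n, (N <= n)%N ->
    `|\int[P]_w walk_functional n F (V ^~ w) -
      \int[Q]_w walk_functional m F (bm_step B sigma m ^~ w)| <=
    L * (16 * de) + 8 * M * (\int[N01]_x ((sigma * x) ^+ 2 *
      (de * Num.sqrt m%:R < `|sigma * x|)%R%:R) / de ^+ 2) + e.
Proof.
move=> hF L0 FM de0 e0 m0.
set qm : R := Num.sqrt m%:R; set tl := \int[N01]_x _.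
have M0 : 0 <= M by exact: (le_trans (normr_ge0 _) (FM (reflected_path (V ^~ point) 0))).
have mR : 0 < m%:R :> R by rewrite ltr0n.
have qm0 : 0 < qm by rewrite sqrtr_gt0.
have qmE : qm ^+ 2 = m%:R by rewrite sqr_sqrtr // ltW.
(* Summed over the blocks, [e1] contributes 8 M e / (16 (M + 1)) <= e / 2; the m replacements at
   cost [e2] contribute the other e / 2. *)
pose e1 := e * de / (16 * (M + 1) * qm).
have M1 : 0 < M + 1 by rewrite ltr_wpDl.
have e10 : 0 < e1 by rewrite !mulr_gt0 // invr_gt0 !mulr_gt0.
pose e2 := e / (2 * m%:R).
have e20 : 0 < e2 by rewrite divr_gt0 // mulr_gt0.
have L1' : 0 <= L * (2 / qm) by rewrite mulr_ge0 // divr_ge0 // ltW.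
have [N1 hN1] := block_prob de0 e10 m0.
have [N2 hN2] := block_clt L1' e20.
(* This makes the block length n / m exceed m, N1 and N2. *)
exists (m * (maxn m (maxn N1 N2)).+1)%N => n nN.
pose l := (n %/ m)%N.
have lN : (maxn m (maxn N1 N2) < l)%N by rewrite leq_divRL // mulnC.
have ml : (m <= l)%N by apply: leq_trans (ltnW lN); exact: leq_maxl.
have N1l : (N1 <= l)%N.
  by apply: leq_trans (ltnW lN); rewrite leq_max [X in _ || X]leq_max leqnn orbT.
have N2l : (N2 <= l)%N.
  by apply: leq_trans (ltnW lN); rewrite leq_max [X in _ || X]leq_max leqnn !orbT.
have l0 : (0 < l)%N by exact: leq_trans m0 ml.
have n1 : (m * l <= n)%N by rewrite mulnC leq_divM.
have n2 : (n < m * l.+1)%N by rewrite mulnC ltn_ceil.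

have stepC : `|\int[P]_w walk_functional m F (block l ^~ w) -
    \int[Q]_w walk_functional m F (bm_step B sigma m ^~ w)| <= m%:R * e2.
  by apply: (@block_comparison l m L F e2 m0 L0 hF) => j f fL; exact: (hN2 l (j * l)%N f N2l fL).
pose ind (c : R) (j : nat) (w : T) : R := (2 * (de * Num.sqrt n%:R) <=
  rmax (fun k => c * \sum_(i < k) V (j * l + i)%N w) l)%R%:R.
have iI c j : P.-L1 (ind c j) by exact: (block_indic_L1 (j * l)%N c l).
have i2 (j : 'I_m.+1) : P.-L1 (fun w => ind 1 j w + ind (- 1) j w) by exact: L1_add.
have iS := L1_sum (index_enum 'I_m.+1) xpredT i2.
have iC := L1_cst P (L * (16 * de)).
have iZ := L1_scale (2 * M) iS.
have bW := walk_functional_L1 n L0 hF FM mV.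
have bB := walk_functional_L1 m L0 hF FM (fun j => L1_measurable (block_L1 l j)).
have stepB : `|\int[P]_w walk_functional n F (V ^~ w) -
    \int[P]_w walk_functional m F (block l ^~ w)| <=
    \int[P]_w (L * (16 * de) + 2 * M * \sum_(j < m.+1) (ind 1 j w + ind (- 1) j w)).
  apply: mean_dist_le => //; first exact: L1_add.
  by apply: aeW => w; exact: (@mesh_functional R (V ^~ w) L M F de n m l).
rewrite meanD // mean_cst meanZ // mean_sum // in stepB.
pose p := tl / (de ^+ 2 * m%:R) + e1 / (de * qm).
have pI j : \int[P]_w (ind 1 j w + ind (- 1) j w) <= 2 * p.
  have a1 : \int[P]_w ind 1 j w <= p.
    by apply: hN1 => //; rewrite normr1.
  have a2 : \int[P]_w ind (- 1) j w <= p.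
    by apply: hN1 => //; rewrite normrN normr1.
  by rewrite meanD //; lra.
have sI : \sum_(j < m.+1) \int[P]_w (ind 1 j w + ind (- 1) j w) <= m.+1%:R * (2 * p).
  apply: (@le_trans _ _ (\sum_(j < m.+1) 2 * p)); first by apply: ler_sum => j _.
  by rewrite sumr_const card_ord -[leLHS]mulr_natl.

have t0 : 0 <= tl by apply: mean_ge0 => x; rewrite mulr_ge0 // sqr_ge0.
have dm0 : 0 <= de ^+ 2 * m%:R by rewrite mulr_ge0 // sqr_ge0.
have dq0 : 0 <= de * qm by rewrite mulr_ge0 // ltW.
have p0 : 0 <= p by exact: (addr_ge0 (divr_ge0 t0 dm0) (divr_ge0 (ltW e10) dq0)).
have m1 : m.+1%:R <= 2 * m%:R :> R by rewrite -natrM ler_nat mul2n -addnn -addn1 leq_add2l.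
have sI2 : 2 * M * \sum_(j < m.+1) \int[P]_w (ind 1 j w + ind (- 1) j w) <=
    8 * M * (m%:R * p).
  have -> : 8 * M * (m%:R * p) = 2 * M * (2 * m%:R * (2 * p)) by ring.
  rewrite ler_wpM2l ?mulr_ge0 //; apply: (le_trans sI).
  exact: (ler_wpM2r (mulr_ge0 (ler0n _ 2) p0) m1).
have pE : m%:R * p = tl / de ^+ 2 + e / (16 * (M + 1)).
  by rewrite /p /e1 -qmE; field; rewrite !gt_eqF.
have Me : 8 * M * (e / (16 * (M + 1))) <= e / 2.
  have -> : 8 * M * (e / (16 * (M + 1))) = e / 2 * (M / (M + 1)) by field; rewrite gt_eqF.
  by rewrite ler_piMr ?divr_ge0 ?(ltW e0) // ler_pdivrMr // mul1r lerDl.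
rewrite pE mulrDr in sI2.
have me : m%:R * e2 = e / 2 by rewrite /e2; field; rewrite gt_eqF.
rewrite me in stepC.
apply: (le_trans (ler_distD (\int[P]_w walk_functional m F (block l ^~ w)) _ _)).
apply: (le_trans (lerD stepB stepC)).
by lra.
Qed.

Section Limit.
Variables (L M : R) (F : C01 R -> R).
Hypotheses (L0 : 0 <= L) (hF : lipC L F) (FM : forall y, `|F y| <= M).

Let Y := reflected_brownian_motion sigma hB.

Let mesh m w := walk_functional m F (bm_step B sigma m ^~ w).

Let mesh_measurable m : measurable_fun setT (mesh m).
Proof.
apply: lip1_measurable (lip1_walk_functional m L0 hF) => i.
have mb := bm_increment_measurable B m i.
apply: measurable_funM; first exact: measurable_cst.
by apply: measurable_funM; [exact: measurable_cst|exact: mb].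
Qed.

Let mesh_cvg w : mesh m w @[m --> \oo] --> F (Y w).
Proof.
have := mesh_path_cvg (cg := @scaled_bm_continuous _ _ _ _ sigma _ hB w) L0 hF.
rewrite (_ : (fun m => walk_functional m F _) = mesh ^~ w); first by [].
apply/funext => m; rewrite /mesh; congr walk_functional; apply/funext => i.
by rewrite /bm_step /bm_increment; ring.
Qed.

(** A limit, at every w, of functions of finitely many Brownian increments. *)
Lemma reflected_brownian_motion_measurable : measurable_fun setT (fun w => F (Y w)).
Proof. by apply: (measurable_fun_cvg mesh_measurable) => w _; exact: mesh_cvg. Qed.

(** The parameters are chosen in the order de, m, N: de for the block oscillations, m for the
    Gaussian tail and for the mesh limit of the Brownian functional, N for the remaining error of
    [mesh_mean]. Each of the four errors is at most e / 4. *)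
Lemma free_walk_cvg :
  \int[P]_w walk_functional n F (V ^~ w) @[n --> \oo] --> \int[Q]_w F (Y w).
Proof.
have cM : \int[Q]_w mesh m w @[m --> \oo] --> \int[Q]_w F (Y w).
  apply: (@mean_dominated _ _ _ Q mesh _ (fun=> M)).
  - exact: mesh_measurable.
  - exact: reflected_brownian_motion_measurable.
  - exact: L1_cst.
  - by move=> m w; exact: FM.
  - exact: mesh_cvg.
apply/cvgrPdist_le => e e0.
pose de := e / (64 * L + 64).
have de0 : 0 < de by rewrite divr_gt0 // ltr_wpDl // mulr_ge0.
have Lde : L * (16 * de) <= e / 4.
  have -> : L * (16 * de) = e / 4 * (L / (L + 1)).
    by rewrite /de; field; rewrite !gt_eqF // ltr_wpDl // mulr_ge0.
  by rewrite ler_piMr ?divr_ge0 ?(ltW e0) // ler_pdivrMr ?ltr_wpDl // mul1r lerDl.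
pose N01 := normal_prob (0 : R) 1.
pose tl (m : nat) := \int[N01]_x ((sigma * x) ^+ 2 * (de * Num.sqrt m%:R < `|sigma * x|)%R%:R).
have ct : 8 * M * (tl m / de ^+ 2) @[m --> \oo] --> 0.
  have -> : 0 = 8 * M * (0 / de ^+ 2) by rewrite mul0r mulr0.
  apply: cvgM; first exact: cvg_cst.
  apply: cvgM; last exact: cvg_cst.
  apply: (tail_mean (N01_L1_scale_sqr sigma)); last exact: cvg_sqrt_natr.
  exact: (L1_measurable (L1_norm (N01_L1_scale sigma))).
have e4 : 0 < e / 4 by rewrite divr_gt0.
have [m [m0 h1 h2]] : exists m, [/\ (0 < m)%N,
    `|\int[Q]_w F (Y w) - \int[Q]_w mesh m w| <= e / 4 &
    8 * M * (tl m / de ^+ 2) <= e / 4].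
  have c1 := cM; move/cvgrPdist_le : c1 => /(_ _ e4) [k1 _ hk1].
  have c2 := ct; move/cvgrPdist_le : c2 => /(_ _ e4) [k2 _ hk2].
  exists (maxn k1 k2).+1; split => //.
    by apply: hk1; rewrite /= ltnW // ltnS leq_maxl.
  have := hk2 (maxn k1 k2).+1; rewrite /= sub0r normrN.
  move=> /(_ _)/(le_trans (ler_norm _)); apply.
  by rewrite ltnW // ltnS leq_maxr.
have [N hN] := mesh_mean hF L0 FM de0 e4 m0.
exists N => // n /= Nn; have := hN n Nn.
rewrite -/(tl m) -/(mesh m _) => h3.
apply: (le_trans (ler_distD (\int[Q]_w mesh m w) _ _)).
rewrite (distrC (\int[Q]_w mesh m w)).
by apply: (le_trans (lerD h1 h3)); lra.
Qed.

End Limit.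

End FreeWalk.

(** Finiteness is given for the integral without absolute values; a.e. positivity identifies f with
    |f|. A zero mean would make f vanish a.e., and then the whole space would be null. *)
Lemma ae_gt0_mean d (T : measurableType d) (R : realType) (P : probability T R)
    (f : T -> R) : measurable_fun setT f -> {ae P, forall w, 0 < f w} ->
  (\int[P]_w (f w)%:E < +oo)%E -> P.-L1 f /\ 0 < \int[P]_w f w.
Proof.
move=> mf f0 fy; have mfE : measurable_fun setT (EFin \o f) by exact/measurable_EFinP.
have mfA : measurable_fun setT (fun w => `|(f w)%:E|%E) by exact: measurableT_comp.
have absE : (\int[P]_w `|(f w)%:E| = \int[P]_w (f w)%:E)%E.
  apply: ae_eq_integral => //; apply: filterS f0 => w fw _.
  by rewrite /= gtr0_norm.
have iF : P.-L1 f by apply/integrableP; split => //=; rewrite absE.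
split => //; rewrite lt_neqAle; apply/andP; split; last first.
  have := @le_mean_ae _ _ _ P (fun=> 0) f (L1_cst P 0) iF; rewrite mean_cst; apply.
  by apply: filterS f0 => w /ltW.
apply/negP => /eqP E.
have : (\int[P]_w `|(f w)%:E| = 0)%E by rewrite absE L1_integral // -E.
move/(ae_eq_integral_abs P measurableT mfE) => f1.
have : {ae P, forall w : T, False}.
  apply: filterS2 f0 f1 => w fw /(_ I) [fE].
  by rewrite fE ltxx in fw.
move=> [A [mA PA sA]].
have AT : A = setT by apply/seteqP; split => // w _; apply: sA => /=.
by have := @probability_setT _ _ _ P; rewrite -AT PA => /eqP; rewrite eq_sym onee_eq0.
Qed.

(* [xi k] and [eta k] are the (k+1)-st terms of sequences indexed from 1. *)
Theorem theorem1 (R : realType)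
    (d : measure_display) (T : measurableType d) (P : probability T R)
    (xi eta : nat -> {RV P >-> R}) (sigma : R)
    (d' : measure_display) (T' : measurableType d') (Q : probability T' R)
    (B : R -> {RV Q >-> R}) (hB : standard_brownian_motion B)
    (xi_iid : iid P xi) (eta_iid : iid P eta)
    (xi_eta_indep : independent_families P xi eta)
    (sigma_ge0 : 0 <= sigma)
    (xi_mean : ('E_P[xi 0%N])%E = 0%:E)
    (xi_second_moment : ('E_P[(fun w => xi 0%N w ^+ 2)%R])%E = (sigma ^+ 2)%:E)
    (eta_gt0 : forall k, {ae P, forall w, 0 < eta k w})
    (eta_mean : ('E_P[eta 0%N] < +oo)%E) :
  converges_weakly P Q
    (fun n w => rescaled_path (walk (fun k => xi k w) (fun k => eta k w)) n)
    (reflected_brownian_motion sigma hB).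
Proof.
rewrite unlock in xi_mean; rewrite unlock in xi_second_moment.
rewrite unlock in eta_mean.
pose x k : T -> R := xi k; pose y k : T -> R := eta k.
have mx k : measurable_fun setT (x k) by exact: measurable_funPT.
have my k : measurable_fun setT (y k) by exact: measurable_funPT.
have lx k : same_law P P (x k) (x 0%N) by move=> A mA; exact: (xi_iid.2 k 0%N A mA).
have ly k : same_law P P (y k) (y 0%N) by move=> A mA; exact: (eta_iid.2 k 0%N A mA).
have mX2 : measurable_fun setT (fun z : R => z ^+ 2) by exact: exprn_measurable.
have i20 : P.-L1 (fun w => x 0%N w ^+ 2).
  apply/integrableP; split.
    by apply/measurable_EFinP; exact: (measurableT_comp mX2 (mx 0%N)).
  rewrite (_ : (\int[P]_w _)%E = (sigma ^+ 2)%:E) ?ltry // -xi_second_moment.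
  by apply: eq_integral => w _ /=; rewrite ger0_norm ?sqr_ge0.
have i10 : P.-L1 (x 0%N).
  apply: L1_le (L1_add (L1_cst P 1) i20) => // w.
  by rewrite -(real_normK (num_real (x 0%N w))); have := normr_ge0 (x 0%N w);
    set a := `|_|; rewrite expr2 => a0; nra.
have [iy0 mu0] := ae_gt0_mean (my 0%N) (eta_gt0 0%N) eta_mean.
have mid : measurable_fun setT (id : R -> R) by exact: measurable_id.
have X k f := @same_law_mean _ _ _ P _ _ P _ _ (mx k) (mx 0%N) (lx k) f.
have Y k f := @same_law_mean _ _ _ P _ _ P _ _ (my k) (my 0%N) (ly k) f.
have ix k : P.-L1 (x k) by have [] := X k id mid i10.
have ix2 k : P.-L1 (fun w => x k w ^+ 2) by have [] := X k _ mX2 i20.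
have Ex k : \int[P]_w x k w = 0.
  by have [_ ->] := X k id mid i10; rewrite /Rintegral xi_mean.
have Ex2 k : \int[P]_w x k w ^+ 2 = sigma ^+ 2.
  by have [_ ->] := X k _ mX2 i20; rewrite /Rintegral xi_second_moment.
have iy k : P.-L1 (y k) by have [] := Y k id mid iy0.
have Ey k : \int[P]_w y k w = \int[P]_w y 0%N w by have [] := Y k id mid iy0.
have lipx k L f (fL : lips L f) : \int[P]_w f (x k w) = \int[P]_w f (x 0%N w).
  have mf := continuous_measurable_fun (lipschitz_continuous fL).
  by have [] := X k f mf (lips_L1 fL i10).
have tx k a : \int[P]_w (x k w ^+ 2 * (a < `|x k w|)%R%:R) =
    \int[P]_w (x 0%N w ^+ 2 * (a < `|x 0%N w|)%R%:R).
  have mf : measurable_fun setT (fun z : R => z ^+ 2 * (a < `|z|)%R%:R).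
    by apply: measurable_funM => //; apply: measurable_ltr_indic; exact: normr_measurable.
  have i : P.-L1 (fun w => x 0%N w ^+ 2 * (a < `|x 0%N w|)%R%:R).
    by apply: L1_indic => //; exact: measurableT_comp.
  by have [] := X k _ mf i.
have te k a : \int[P]_w (y k w * (a < y k w)%R%:R) =
    \int[P]_w (y 0%N w * (a < y 0%N w)%R%:R).
  have mf : measurable_fun setT (fun z : R => z * (a < z)%R%:R).
    by apply: measurable_funM => //; exact: measurable_ltr_indic.
  have i : P.-L1 (fun w => y 0%N w * (a < y 0%N w)%R%:R) by exact: L1_indic.
  by have [] := Y k _ mf i.
have iZ := combined_independent xi_iid.1 eta_iid.1 xi_eta_indep.
have mZ z : measurable_fun setT (combined x y z) by case: z => k; [exact: mx|exact: my].
have mW k : measurable_fun setT (fun w => walk (x ^~ w) (y ^~ w) k).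
  exact: (adapted_measurable mZ (@adapted_walk _ _ _ x y k)).
have mF n L F : lipC L F ->
    measurable_fun setT (fun w => F (rescaled_path (walk (x ^~ w) (y ^~ w)) n)).
  move=> /lipC_normr hF.
  exact: (lip1_measurable mW (lip1_rescaled_path n (normr_ge0 L) hF)).
apply: converges_weakly_lipC => [n L F hF|L F hF|L M F L0 hF FM].
- exact: mF hF.
- exact: (reflected_brownian_motion_measurable sigma hB (normr_ge0 L) (lipC_normr hF)).
(* The limit is reached through the reflected driftless walk; the given walk is within [D] of it in
   uniform distance, and the Lipschitz constant of F turns a mean of [D] at most e3 into an error at
   most e / 2. *)
have cW := free_walk_cvg mx xi_iid.1 ix ix2 Ex Ex2 lipx (hB := hB) L0 hF FM.
apply/cvgrPdist_le => e e0.
have e2 : 0 < e / 2 by rewrite divr_gt0.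
pose e3 := e / (2 * (L + 1)).
have e30 : 0 < e3 by rewrite divr_gt0 // mulr_gt0 // ltr_wpDl.
have Le : L * e3 <= e / 2.
  have -> : L * e3 = e / 2 * (L / (L + 1)).
    by rewrite /e3; field; rewrite gt_eqF // ltr_wpDl.
  by rewrite ler_piMr ?(ltW e2) // ler_pdivrMr ?ltr_wpDl // mul1r lerDl.
near=> n.
have c1 : `|\int[Q]_w F (reflected_brownian_motion sigma hB w) -
    \int[P]_w walk_functional n F (x ^~ w)| <= e / 2.
  by near: n; move/cvgrPdist_le : cW; apply.
have [D [iD De] hD] : exists2 D : T -> R, P.-L1 D /\ \int[P]_w D w <= e3 &
    {ae P, forall w, 0 <= D w /\ forall t, unitI R t ->
      `|interpolate (walk (x ^~ w) (y ^~ w)) (n%:R * t) / Num.sqrt n%:R -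
      Defs.reflect (fun t => interpolate (free_walk (x ^~ w)) (n%:R * t)
        / Num.sqrt n%:R) t| <= D w}.
  by near: n; exact: (walk_reflect_L1 mx my ix ix2 Ex Ex2 iy Ey mu0 eta_gt0 iZ tx te e30).
have c2 : `|\int[P]_w walk_functional n F (x ^~ w) -
    \int[P]_w F (rescaled_path (walk (x ^~ w) (y ^~ w)) n)| <= \int[P]_w (L * D w).
  apply: mean_dist_le; last 1 first.
  - apply: filterS hD => w [D0 hDw]; rewrite distrC.
    by apply: lipC_path01 hF D0 _ => t It; exact: hDw.
  - exact: (walk_functional_L1 P n L0 hF FM mx).
  - by apply: (@L1_bounded _ _ _ _ _ M) => [|w]; [exact: mF hF|exact: FM].
  - exact: L1_scale.
apply: (le_trans (ler_distD (\int[P]_w walk_functional n F (x ^~ w)) _ _)).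
have : \int[P]_w (L * D w) <= L * e3 by rewrite meanZ // ler_wpM2l.
by move=> c3; move: (le_trans c2 c3) c1 Le; lra.
Unshelve. all: by end_near. Qed.
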